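(* Let $p$ be a prime and let $G = E_1 \times \ldots \times E_r$ be a finite direct product of finitely generated pro-$p$ groups $E_j$, each of which is either free or Demushkin. Suppose that at least one factor $E_j$ is non-soluble. Then $G$ has full Hausdorff spectrum $\mathrm{hspec}^{\mathcal{Z}}(G) = [0,1]$ with respect to the Zassenhaus series $\mathcal{Z}$ of $G$.
   Context: Subgroups of pro-$p$ groups are understood to be closed and generation is topological. ''Free'' means free pro-$p$. A Demushkin pro-$p$ group is a Poincaré duality pro-$p$ group of dimension $2$ (i.e. a pro-$p$ group $D$ of cohomological dimension $2$ with $H^1(D,\mathbb{F}_p)$ finite, $\dim_{\mathbb{F}_p} H^2(D,\mathbb{F}_p)=1$, and non-degenerate cup product $H^1(D,\mathbb{F}_p)\times H^1(D,\mathbb{F}_p)\to H^2(D,\mathbb{F}_p)$). A filtration of a finitely generated infinite pro-$p$ group $G$ is a descending chain $\mathcal{S}\colon G_i$ of open normal subgroups with trivial intersection (indexed by $i\in\mathbb{N}_0$ or $i\in\mathbb{N}$). The Hausdorff dimension of a closed subgroup $H\le G$ with respect to $\mathcal{S}$ is $$\mathrm{hdim}_G^{\mathcal{S}}(H) = \liminf_{i\to\infty} \frac{\log_p |HG_i:G_i|}{\log_p |G:G_i|},$$ and the Hausdorff spectrum is $\mathrm{hspec}^{\mathcal{S}}(G) = \{\mathrm{hdim}_G^{\mathcal{S}}(H) \mid H \le G \text{ a closed subgroup}\}$. The Zassenhaus series $\mathcal{Z}\colon Z_i(G)$, $i\in\mathbb{N}$, is defined by $Z_1(G)=G$ and $Z_i(G)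 = Z_{\lceil i/p\rceil}(G)^p \prod_{1\le j<i}[Z_j(G),Z_{i-j}(G)]$ for $i\ge2$. *)

(* Defs.v *)
From HB Require Import structures.
From mathcomp Require Import all_boot all_order all_algebra.
From mathcomp Require Import finmap zify.
From mathcomp Require Import all_classical all_reals topology.
From mathcomp Require Import sequences exp.

Set Implicit Arguments.
Unset Strict Implicit.
Unset Printing Implicit Defensive.

Import Order.TTheory GRing.Theory Num.Theory.

Local Open Scope classical_set_scope.
Local Open Scope ring_scope.

(** * Topological groups *)

HB.mixin Record isTopGroup G of Group G & Topological G := {
  mulg_continuous : continuous (fun xy : G * G => (xy.1 * xy.2)%g);
  invg_continuous : continuous (fun x : G => (x^-1)%g)
}.

#[short(type="topGroupType")]
HB.structure Definition TopGroup :=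
  {G of Group G & Topological G & isTopGroup G}.

(** The direct product of a family of topological groups, carried by the
    library's [prod_topology]. *)
Section ProductGroup.
Variables (I : eqType) (E : I -> topGroupType).

Definition prodG : Type := prod_topology (fun i => E i : topologicalType).

HB.instance Definition _ := Topological.on prodG.

Definition prodG_one : prodG := fun i => 1%g.
Definition prodG_inv (x : prodG) : prodG := fun i => (x i)^-1%g.
Definition prodG_mul (x y : prodG) : prodG := fun i => (x i * y i)%g.

Lemma prodG_mulA : associative prodG_mul.
Proof. by move=> x y z; apply: functional_extensionality_dep => i; exact: mulgA. Qed.

Lemma prodG_mul1g : left_id prodG_one prodG_mul.
Proof. by move=> x; apply: functional_extensionality_dep => i; exact: mul1g. Qed.

Lemma prodG_mulg1 : right_id prodG_one prodG_mul.
Proof. by move=> x; apply: functional_extensionality_dep => i; exact: mulg1. Qed.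

Lemma prodG_mulVg : left_inverse prodG_one prodG_inv prodG_mul.
Proof. by move=> x; apply: functional_extensionality_dep => i; exact: mulVg. Qed.

Lemma prodG_mulgV : right_inverse prodG_one prodG_inv prodG_mul.
Proof. by move=> x; apply: functional_extensionality_dep => i; exact: mulgV. Qed.

HB.instance Definition _ := isGroup.Build prodG
  prodG_mulA prodG_mul1g prodG_mulg1 prodG_mulVg prodG_mulgV.

Lemma prodG_cvg (F : set_system prodG) (x : prodG) : Filter F ->
  (forall i, (fun y : prodG => y i) @ F --> x i) -> F --> x.
Proof.
move=> FF cF; apply/cvg_sup => i U [V /= [[W oW <-] /= Wx] sVU].
apply: (filterS sVU); apply: (cF i); exact: open_nbhs_nbhs.
Qed.

Lemma prodG_proj_continuous (i : I) : continuous (fun y : prodG => y i).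
Proof. exact: (@proj_continuous I (fun i => E i : topologicalType) i). Qed.

Lemma prodG_mul_continuous :
  continuous (fun xy : prodG * prodG => (xy.1 * xy.2)%g).
Proof.
move=> [x y]; apply: prodG_cvg => i.
have fi : (fun xy : prodG * prodG => (xy.1 i, xy.2 i)) @ (x, y) --> (x i, y i).
  apply: cvg_pair => /=.
    exact: (cvg_comp _ _ (@cvg_fst _ _ (nbhs x) (nbhs y) _)
              (@prodG_proj_continuous i x)).
  exact: (cvg_comp _ _ (@cvg_snd _ _ (nbhs x) (nbhs y) _)
            (@prodG_proj_continuous i y)).
exact: (cvg_comp _ _ fi (@mulg_continuous (E i) (x i, y i))).
Qed.

Lemma prodG_inv_continuous : continuous (fun x : prodG => (x^-1)%g).
Proof.
move=> x; apply: (prodG_cvg (fmap_filter _ (nbhs_filter x))) => i.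
exact: (cvg_comp _ _ (@prodG_proj_continuous i x) (@invg_continuous (E i) (x i))).
Qed.

HB.instance Definition _ := isTopGroup.Build prodG
  prodG_mul_continuous prodG_inv_continuous.

End ProductGroup.

(** * Closed subgroups, generation, indices *)

Section Subgroups.
Variable G : topGroupType.
Implicit Types A B H K N : set G.

Definition is_subgroup H :=
  H 1%g /\ forall x y, H x -> H y -> H (x * y^-1)%g.

Definition closed_subgroup H := is_subgroup H /\ closed H.

Definition normal_subgroup N :=
  is_subgroup N /\ forall x y, N x -> N (x ^ y)%g.

Definition tgen A : set G := smallest closed_subgroup A.

Definition mulset A B : set G := [set (x * y)%g | x in A & y in B].

Definition commset A B : set G := [set commg x y | x in A & y in B].

(** The index |K : N|, as the number of left cosets xN with x in K; it is 0
    when the index is infinite. *)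
Definition gindex K N : nat :=
  #|` fset_set [set [set (x * y)%g | y in N] | x in K]|.

Definition finitely_generated := exists s : seq G, tgen [set` s] = setT.

(** The topological derived series: it reaches 1 iff the abstract one does. *)
Fixpoint derived_series (n : nat) : set G :=
  if n is m.+1 then tgen (commset (derived_series m) (derived_series m))
  else setT.

Definition soluble := exists n, derived_series n = [set 1%g].

End Subgroups.

Arguments finitely_generated : clear implicits.
Arguments soluble : clear implicits.

Definition pro_p (p : nat) (G : topGroupType) :=
  [/\ compact [set: G], hausdorff_space G, totally_disconnected [set: G] &
      forall N : set G, normal_subgroup N -> open N ->
        exists n, gindex setT N = (p ^ n)%N].

(** * Free pro-p groups *)

(** A map from a set to a pro-p group converges to 1 if every open subgroup
    contains all but finitely many of its values. *)
Definition converges_to_1 (X : Type) (G : topGroupType) (f : X -> G) :=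
  forall U : set G, is_subgroup U -> open U -> finite_set [set x | ~ U (f x)].

Definition free_pro_p_on (p : nat) (F : topGroupType) (X : Type) (b : X -> F) :=
  [/\ pro_p p F, converges_to_1 b &
      forall (P : topGroupType) (f : X -> P), pro_p p P -> converges_to_1 f ->
        exists! h : F -> P,
          [/\ continuous h, {morph h : x y / (x * y)%g} & forall x, h (b x) = f x]].

Definition free_pro_p (p : nat) (F : topGroupType) :=
  exists (X : Type) (b : X -> F), free_pro_p_on p b.

(** * Continuous cochain cohomology *)

(** Inhomogeneous cochains with values in a discrete module [A], on which [G]
    acts by [act]. *)
Section Cohomology.
Variables (G : topGroupType) (A : zmodType) (act : G -> A -> A).

Definition discrete_module :=
  [/\ forall a, act 1%g a = a,
      forall g h a, act (g * h)%g a = act g (act h a),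
      forall g a b, act g (a + b) = act g a + act g b &
      forall a, open [set g | act g a = a]].

Definition torsion_module := forall a : A, exists2 n, (0 < n)%N & a *+ n = 0.

Definition cochain n (f : ('I_n -> G) -> A) :=
  continuous (f : {ptws 'I_n -> G} -> discrete_topology A).

(** (x_0, ..., x_n) |-> (x_0, ..., x_k x_(k+1), ..., x_n) *)
Definition contract n (k : 'I_n) (x : 'I_n.+1 -> G) : 'I_n -> G :=
  fun i => if (i < k)%N then x (widen_ord (leqnSn n) i)
           else if i == k
           then (x (widen_ord (leqnSn n) i) * x (lift ord0 i))%g
           else x (lift ord0 i).

Definition cobd n (f : ('I_n -> G) -> A) : ('I_n.+1 -> G) -> A :=
  fun x =>
    act (x ord0) (f (fun i => x (lift ord0 i)))
    + \sum_(k < n) f (contract k x) *~ (-1) ^+ k.+1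
    + f (fun i => x (widen_ord (leqnSn n) i)) *~ (-1) ^+ n.+1.

Definition cocycle n (f : ('I_n -> G) -> A) := cochain f /\ cobd f = (fun=> 0).

Definition coboundary n : (('I_n -> G) -> A) -> Prop :=
  match n with
  | 0 => fun f => f = (fun=> 0)
  | m.+1 => fun f => exists2 h : ('I_m -> G) -> A, cochain h & f = cobd h
  end.

Definition coh_class n (f : ('I_n -> G) -> A) : set (('I_n -> G) -> A) :=
  [set g | cocycle g /\ coboundary (fun x => g x - f x)].

(** H^n(G, A), as the set of classes of cocycles modulo coboundaries *)
Definition coh n : set (set (('I_n -> G) -> A)) :=
  [set coh_class f | f in @cocycle n].

Definition coh_zero n := forall f : ('I_n -> G) -> A, cocycle f -> coboundary f.

End Cohomology.

Arguments coh {G A} act n%_N.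
Arguments coh_zero {G A} act n%_N.

Definition cd_le (G : topGroupType) (n : nat) :=
  forall (A : zmodType) (act : G -> A -> A),
    discrete_module act -> torsion_module A ->
    forall q, (n < q)%N -> coh_zero act q.

Definition cd_eq (G : topGroupType) (n : nat) :=
  cd_le G n /\ forall m, cd_le G m -> (n <= m)%N.

(** * Demushkin groups *)

Section TrivialCoefficients.
Variables (p : nat) (G : topGroupType).

Definition triv (g : G) (a : 'F_p) : 'F_p := a.

(** dim H^n(G, F_p) = d: there are d cocycles whose classes form a basis. *)
Definition coh_dim (n d : nat) :=
  exists2 c : 'I_d -> ('I_n -> G) -> 'F_p,
    forall i, cocycle triv (c i) &
    forall f, cocycle triv f ->
      exists! a : 'rV['F_p]_d,
        coboundary triv (fun x => f x - \sum_i a 0 i * c i x).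

Definition cup m n (a : ('I_m -> G) -> 'F_p) (b : ('I_n -> G) -> 'F_p) :
    ('I_(m + n) -> G) -> 'F_p :=
  fun x => a (fun i => x (lshift n i)) * b (fun j => x (rshift m j)).

Definition cup11_nondegenerate :=
  (forall a : ('I_1 -> G) -> 'F_p, cocycle triv a ->
    (forall b : ('I_1 -> G) -> 'F_p, cocycle triv b ->
       coboundary triv (cup a b)) -> coboundary triv a) /\
  (forall b : ('I_1 -> G) -> 'F_p, cocycle triv b ->
    (forall a : ('I_1 -> G) -> 'F_p, cocycle triv a ->
       coboundary triv (cup a b)) -> coboundary triv b).

Definition demushkin :=
  [/\ pro_p p G, cd_eq G 2, finite_set (coh triv 1), coh_dim 2 1 &
      cup11_nondegenerate].

End TrivialCoefficients.

(** * Zassenhaus series *)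

Section Zassenhaus.
Variables (p : nat) (G : topGroupType).

(** [(i + p).-1 %/ p] is the ceiling of i / p. *)
Definition zassenhaus_step (Z : nat -> set G) (i : nat) : set G :=
  mulset (tgen [set (x ^+ p)%g | x in Z ((i + p).-1 %/ p)%N])
    (\big[@mulset G / [set 1%g]]_(1 <= j < i) tgen (commset (Z j) (Z (i - j)%N))).

(** [n] is fuel for the strong recursion on [i]; see [zassenhausE]. *)
Fixpoint zassenhaus_rec (n i : nat) : set G :=
  if n is m.+1 then
    if (i <= 1)%N then setT else zassenhaus_step (zassenhaus_rec m) i
  else setT.

(** The unused term of index 0 is [setT], like that of index 1. *)
Definition zassenhaus (i : nat) : set G := zassenhaus_rec i i.

Lemma zassenhaus1 : zassenhaus 1 = setT.
Proof. by []. Qed.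

Lemma zassenhausE i : prime p -> (2 <= i)%N ->
  zassenhaus i = zassenhaus_step zassenhaus i.
Proof.
move=> /prime_gt1 p1 i2.
have ceil_lt k : (2 <= k)%N -> ((k + p).-1 %/ p < k)%N.
  by move=> k2; rewrite ltn_divLR ?(ltnW p1)//; nia.
have step_ext Z Z' k : (2 <= k)%N -> (forall j, (j < k)%N -> Z j = Z' j) ->
    zassenhaus_step Z k = zassenhaus_step Z' k.
  move=> k2 ZZ'; rewrite /zassenhaus_step ZZ' ?ceil_lt//; congr mulset.
  rewrite !big_nat; apply: eq_bigr => j /andP[j0 jk].
  by rewrite !ZZ'// ltn_subrL j0 (leq_trans _ k2).
have fuel m n k : (k <= m)%N -> (k <= n)%N ->
    zassenhaus_rec m k = zassenhaus_rec n k.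
  elim: m n k => [|m IH] [|n] k; rewrite ?leqn0 //=.
  - by move=> /eqP ->.
  - by move=> _ /eqP ->.
  - move=> km kn; case: ltnP => // k2; apply: step_ext => // j jk.
    by apply: IH; rewrite -ltnS (leq_trans jk).
case: i i2 => // i i2; rewrite {1}/zassenhaus /= leqNgt i2 /=.
by apply: step_ext => // j ji; exact: fuel.
Qed.

End Zassenhaus.

Arguments zassenhaus : clear implicits.

(** * Hausdorff dimension and spectrum *)

Section Hausdorff.
Variables (R : realType) (p : nat) (G : topGroupType).

Definition logp (x : R) : R := ln x / ln p%:R.

(** Terms with [S i = G] are 0 / 0 = 0; for infinite [G] and a filtration [S]
    there are finitely many of them, so they do not affect the liminf. *)
Definition hdim (S : nat -> set G) (H : set G) : R :=
  limn_inf (fun i => logp (gindex (mulset H (S i)) (S i))%:R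
                     / logp (gindex [set: G] (S i))%:R).

Definition hspec (S : nat -> set G) : set R :=
  [set hdim S H | H in @closed_subgroup G].

End Hausdorff.

Arguments hdim R p {G} S H.
Arguments hspec R p {G} S.

(* Main.v *)
Require Import Defs.
From HB Require Import structures.
From mathcomp Require Import all_boot all_order all_fingroup all_algebra all_solvable.
From mathcomp Require Import finmap zify ring lra.
From mathcomp Require Import all_classical all_reals topology.
From mathcomp Require Import sequences exp.

(** The Zassenhaus term Z_n(E) is dual to the locally constant functions
E -> F_p of degree less than n, those killed by all products of n difference
operators (Jennings). Counting such functions gives both growth estimates
needed for l_n(E) = log_p |E : Z_n(E)|. If E is free or Demushkin of rank d, a
Golod-Shafarevich argument in H^2 shows that there are at least about lam^n of
them, where lam = d, respectively lam^2 - d lam + 1 = 0, so that l_n(E) is not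
O(mu^n) for any mu < lam. Conversely, if K is generated by sets X_w of elements
of Z_w, then log_p |K Z_n : Z_n| is at most the number of words of weight less
than n in these generators; it is O(mu^n) for some mu < lam as soon as
sum_w |X_w| lam^-w < 1.

A non-soluble factor contains a subgroup of codimension O(log n) with
sum_w |X_w| lam^-w = 1: omit one generator t and keep the iterated commutators
of the others with t (for Demushkin groups, take t dual to an isotropic class;
the relation makes one family of commutators redundant). Eliminating a generator
x of weight u, that is, replacing it by x^p and the commutators [y, x, ..., x]
with fewer than p entries x, keeps this sum at most 1 and, as long as
log_p |K Z_n : Z_n| is not O(mu^n) for any mu < lam, lowers it by exactly 1 for
n > u and leaves it unchanged for n <= u.

Eliminate generators, weight by weight and over all non-soluble factors, until
the total codimension at level n reaches the integral part of (1 - a) l_n. If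
this target were missed for all large n, only generators with
sum_w |X_w| lam^-w < 1 would be left in every factor, and the growth estimates
would contradict a > 0. So it is reached infinitely often, and the limit of the
subgroups has Hausdorff dimension a. The remaining factors are products of two
procyclic groups modulo every Z_n, hence metabelian, with l_n at most linear. *)

(** No freeness of the generating systems is ever proved. What replaces it is criticality: a
    weighted sum at most 1 together with growth at the full rate lam. A generator of weight u that
    is redundant modulo Z_(u+1) could be traded for one of weight u + 1; the sum would fall below 1
    and the growth rate below lam. Hence each elimination costs exactly one dimension. With q =
    lam^-1, elimination preserves the bound because q^(pu) + (1 - q^u)(1 + q^u + ... + q^((p-1)u)) =
    1. The starting systems are critical because (d - 1)(q + q^2 + ...) = 1 for q = d^-1 in the free
    case, and q + (d - 2)(q + q^2 + ...) = 1 when q^2 - d q + 1 = 0 in the Demushkin case. The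
    codimension never exceeds its target and meets it infinitely often, which is just what a lower
    limit requires; the O(log n) lost at the start is harmless as l_n grows at least linearly.
    Factors may have different rates lam; only the largest one enters the final contradiction. That
    argument divides by a, so the value 0 is taken from the trivial subgroup. *)

Set Implicit Arguments.
Unset Strict Implicit.
Unset Printing Implicit Defensive.

Import Order.TTheory GRing.Theory Num.Theory.

Local Open Scope classical_set_scope.
Local Open Scope ring_scope.

(** * Compact totally disconnected groups *)

(** The traces on K of the clopen neighbourhoods of x would otherwise form a filter base, and a
    cluster point of it in K could not be separated from x. *)
Lemma clopen_avoid (T : topologicalType) (K : set T) (x : T) : compact K ->
  (forall z, K z -> exists C : set T, [/\ clopen C, C x & ~ C z]) ->
  exists C : set T, [/\ clopen C, C x & C `<=` ~` K].
Proof.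
move=> cK sepK; apply: contrapT => nC.
have meetK (C : set T) : clopen C -> C x -> C `&` K !=set0.
  move=> cC Cx; apply: contrapT => CK0; apply: nC; exists C; split=> // z Cz Kz.
  by apply: CK0; exists z.
pose F := filter_from [set C : set T | C x /\ clopen C] (fun C => C `&` K).
have FF : ProperFilter F.
  apply: filter_from_proper; last by move=> C [Cx cC]; exact: meetK.
  apply: filter_from_filter; first by exists setT; split=> //; exact: clopenT.
  move=> A B [Ax cA] [Bx cB]; exists (A `&` B); first by split=> //; exact: clopenI.
  by move=> z [[? ?] ?].
have [] := cK F FF.
  by exists setT; [split=> //; exact: clopenT|move=> z []].
move=> z [Kz clz]; have [C [cC Cx nCz]] := sepK z Kz.
have [w [[Cw _] /= nCw]] : (C `&` K) `&` ~` C !=set0.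
  apply: clz; first by exists C.
  by apply: open_nbhs_nbhs; split=> //; case: cC => _; exact: closed_openC.
by [].
Qed.

(* In a compact Hausdorff space, the intersection of the clopen sets containing
   a point is connected. *)
Lemma compact_zero_dimensional (T : topologicalType) : compact [set: T] ->
  hausdorff_space T -> totally_disconnected [set: T] -> zero_dimensional T.
Proof.
move=> cT hT tdT x y xy; apply: contrapT => nU.
have yU (U : set T) : clopen U -> U x -> U y.
  by move=> cU Ux; apply: contrapT => nUy; apply: nU; exists U.
pose Q := \bigcap_(U in [set U : set T | clopen U /\ U x]) U.
have cQ : closed Q by apply: closed_bigI => U [[]].
(* Normality gives an open U' around A inside a set U whose closure misses B. [clopen_avoid] puts a
   clopen C around x into the union of U' and the complement of that closure; C meets U' in a clopen
   set, which therefore contains Q. *)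
have split0 (A B : set T) : closed A -> closed B -> A `&` B = set0 ->
    Q = A `|` B -> A x -> B = set0.
  move=> cA cB AB0 QE Ax.
  have [] := @compact_normal _ hT cT A cA (~` B).
    apply/set_nbhsP; exists (~` B); split=> //; first exact: closed_openC.
    by move=> z Az Bz; rewrite -[False]/(set0 z) -AB0.
  move=> U /set_nbhsP[U' [oU' AU' U'U]] UB.
  pose V := ~` closure U.
  have oV : open V by apply: closed_openC; exact: closed_closure.
  have oUV : open (U' `|` V) by exact: openU.
  have [||C [[oC cC] Cx CUV]] := @clopen_avoid T (~` (U' `|` V)) x.
  - by apply: subclosed_compact cT _ => //; exact: open_closedC.
  - move=> z nz; apply: contrapT => nC.
    have : Q z.
      by move=> D [cD Dx]; apply: contrapT => nDz; apply: nC; exists D; split.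
    rewrite QE => -[Az|Bz]; first by apply: nz; left; exact: AU'.
    by apply: nz; right=> /UB.
  have cCU : clopen (C `&` U').
    split; first exact: openI.
    have -> : C `&` U' = C `&` ~` V.
      apply/seteqP; split=> z [Cz zU]; split=> //.
        by rewrite /V setCK; apply: subset_closure; exact: U'U.
      by have /CUV := Cz; rewrite setCK => -[].
    by apply: closedI => //; exact: open_closedC.
  apply/seteqP; split=> // z Bz.
  have Qz : Q z by rewrite QE; right.
  have [_ U'z] := Qz (C `&` U') (conj cCU (conj Cx (AU' _ Ax))).
  by have /subset_closure/UB := U'U _ U'z.
have conQ : connected Q.
  move=> B [b Bb] [O oO BO] [F cF BF].
  have cB : closed B by rewrite BF; exact: closedI.
  have cQB : closed (Q `\` B).
    have -> : Q `\` B = Q `&` ~` O.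
      apply/seteqP; split=> z [Qz nz]; split=> // h; apply: nz.
        by rewrite BO.
      by move: h; rewrite BO => -[].
    by apply: closedI => //; exact: open_closedC.
  have BQ : B `<=` Q by rewrite BO => z [].
  have QU : Q = B `|` (Q `\` B) by rewrite setDUK.
  have [Bx|nBx] := pselect (B x).
    have := split0 _ _ cB cQB _ QU Bx; rewrite setDIK => /(_ erefl).
    by rewrite {2}QU => ->; rewrite setU0.
  have Qx : (Q `\` B) x by split=> // U [].
  have := split0 _ _ cQB cB _ _ Qx; rewrite setIC setDIK setUC => /(_ erefl QU) B0.
  by rewrite B0 in Bb.
have : connected_component [set: T] x y.
  by exists Q; [split=> // U []|move=> U [cU Ux]; exact: yU].
by rewrite tdT // => yx; rewrite yx eqxx in xy.
Qed.

Section TopGroupBasics.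
Variable G : topGroupType.
Implicit Types (H K N U V : set G) (x y : G).

Lemma subgroup1 H : is_subgroup H -> H 1%g.
Proof. by case. Qed.

Lemma subgroupV H x : is_subgroup H -> H x -> H x^-1%g.
Proof. by move=> [H1 HB] Hx; rewrite -(mul1g x^-1%g); exact: HB. Qed.

Lemma subgroupM H x y : is_subgroup H -> H x -> H y -> H (x * y)%g.
Proof.
by move=> sH Hx Hy; rewrite -(invgK y); apply: (sH.2) => //; exact: subgroupV.
Qed.

Lemma subgroupX H x n : is_subgroup H -> H x -> H (x ^+ n)%g.
Proof.
move=> sH Hx; elim: n => [|n IH]; first by rewrite expg0; exact: subgroup1.
by rewrite expgS; exact: subgroupM.
Qed.

Lemma subgroupR H x y : is_subgroup H -> H x -> H y -> H [~ x, y]%g.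
Proof.
move=> sH Hx Hy; rewrite /commg /conjg.
by do ![exact: subgroupV|exact: Hx|exact: Hy|apply: (subgroupM sH)].
Qed.

Lemma cvgMg (T : Type) (F : set_system T) (u v : T -> G) x y : Filter F ->
  u @ F --> x -> v @ F --> y -> (fun w => u w * v w)%g @ F --> (x * y)%g.
Proof.
move=> FF cu cv; have cuv : (fun w => (u w, v w)) @ F --> (x, y) by exact: cvg_pair.
exact: (cvg_comp _ _ cuv (@mulg_continuous G (x, y))).
Qed.

Lemma translate_open V x : open V -> open [set y | V (x * y)%g].
Proof.
move=> oV; have /continuousP : continuous (fun y : G => (x * y)%g); last exact.
by move=> y; apply: cvgMg; [exact: cvg_cst|exact: cvg_id].
Qed.

Lemma open_subgroup H : is_subgroup H -> nbhs 1%g H -> open H.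
Proof.
move=> sH; rewrite nbhsE => -[V [oV V1] VH]; rewrite openE => x Hx.
rewrite /interior nbhsE; exists [set y | V (x^-1 * y)%g].
  by split; [exact: translate_open|rewrite /= mulVg].
move=> y /= /VH Hy; rewrite -(mulVKg x y).
exact: subgroupM.
Qed.

Lemma supergroup_open H K : is_subgroup K -> open H -> is_subgroup H ->
  H `<=` K -> open K.
Proof.
move=> sK oH sH HK; apply: open_subgroup => //.
by apply: filterS HK _; apply: open_nbhs_nbhs; split=> //; exact: subgroup1.
Qed.

Lemma open_subgroup_closed H : is_subgroup H -> open H -> closed H.
Proof.
move=> sH oH; rewrite -[H]setCK; apply: open_closedC; rewrite openE => x nHx.
rewrite /interior nbhsE; exists [set y | H (x^-1 * y)%g].
  by split; [exact: translate_open|rewrite /= mulVg; exact: subgroup1].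
move=> y /= Hy Hy'; apply: nHx.
have -> : x = (y * (x^-1 * y)^-1)%g by rewrite invMg invgK mulVKg.
by apply: subgroupM => //; exact: subgroupV.
Qed.

Lemma mulset_subgroup H N : is_subgroup H -> normal_subgroup N ->
  is_subgroup (mulset H N).
Proof.
move=> sH [sN nN]; split.
  by exists 1%g; [exact: subgroup1|exists 1%g; [exact: subgroup1|rewrite mulg1]].
move=> _ _ [h Hh [n Nn <-]] [k Hk [m Nm <-]].
exists (h * k^-1)%g; first exact: (sH.2).
exists ((n * m^-1) ^ k^-1)%g; first by apply: nN; exact: (sN.2).
by rewrite /conjg invgK invMg !mulgA mulgKV.
Qed.

Lemma mulset_normal H N : normal_subgroup H -> normal_subgroup N ->
  normal_subgroup (mulset H N).
Proof.
move=> [sH nH] nN; split; first exact: mulset_subgroup.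
move=> _ y [h Hh [n Nn <-]]; rewrite conjMg.
by exists (h ^ y)%g; [exact: nH|exists (n ^ y)%g => //; exact: (nN.2)].
Qed.

Lemma mulset_subl H N : N 1%g -> H `<=` mulset H N.
Proof. by move=> N1 x Hx; exists x => //; exists 1%g => //; rewrite mulg1. Qed.

Lemma mulset_subr H N : H 1%g -> N `<=` mulset H N.
Proof. by move=> H1 x Nx; exists 1%g => //; exists x => //; rewrite mul1g. Qed.

Lemma mulset_compact H K : compact H -> compact K -> compact (mulset H K).
Proof.
move=> cH cK.
have -> : mulset H K = (fun xy : G * G => (xy.1 * xy.2)%g) @` (H `*` K).
  apply/seteqP; split=> [_ [h Hh [k Kk <-]]|_ [[h k] [/= Hh Kk] <-]].
    by exists (h, k).
  by exists h => //; exists k.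
apply: continuous_compact; last exact: compact_setX.
by apply: continuous_subspaceT; exact: mulg_continuous.
Qed.

Lemma compact_closedE (A : set G) : compact [set: G] -> hausdorff_space G ->
  closed A <-> compact A.
Proof.
move=> cG hG; split; last exact: compact_closed.
by move=> cA; apply: subclosed_compact cG _.
Qed.

Lemma tgen_closed (A : set G) : closed_subgroup (tgen A).
Proof.
split; last by apply: closed_bigI => H [[]].
split; first by move=> H [[sH _] _]; exact: subgroup1.
move=> x y Hx Hy H [[sH cH] AH]; apply: (sH.2); [exact: Hx|exact: Hy].
Qed.

Lemma tgen_sub (A : set G) : A `<=` tgen A.
Proof. by move=> x Ax H [_]; exact. Qed.

Lemma tgen_min (A H : set G) : closed_subgroup H -> A `<=` H -> tgen A `<=` H.
Proof. by move=> cH AH x; apply. Qed.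

Lemma conj_closed_subgroup H y : closed_subgroup H ->
  closed_subgroup [set x | H (x ^ y)%g].
Proof.
move=> [sH cH]; split.
  split; first by rewrite /= conj1g; exact: subgroup1.
  by move=> a b /= Ha Hb; rewrite conjMg conjVg; exact: (sH.2).
have cJ : continuous (fun x => x ^ y : G)%g.
  move=> x; apply: (@cvgMg _ (nbhs x) (fun=> y^-1)%g (fun x => x * y)%g).
    exact: cvg_cst.
  by apply: cvgMg; [exact: cvg_id|exact: cvg_cst].
by move/continuous_closedP : cJ; exact.
Qed.

Lemma tgen_normal (A : set G) :
  (forall x y, A x -> A (x ^ y)%g) -> normal_subgroup (tgen A).
Proof.
move=> nA; split; first exact: (tgen_closed A).1.
move=> x y Ax; suff : tgen A `<=` [set x | tgen A (x ^ y)%g] by move=> /(_ x); exact.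
apply: tgen_min; first by apply: conj_closed_subgroup; exact: tgen_closed.
by move=> z Az; apply: tgen_sub; exact: nA.
Qed.

(* The uniform continuity of f, proved on both sides at once so that the
   subgroup it yields is normal. *)
Lemma invariance_subgroup (T : Type) (f : G -> T) : compact [set: G] ->
  (forall x, nbhs x [set y | f y = f x]) ->
  let N := [set n | forall a b, f (a * n * b)%g = f (a * b)%g] in
  normal_subgroup N /\ open N.
Proof.
move=> cG cf N.
have sN : is_subgroup N.
  split; first by move=> a b; rewrite mulg1.
  by move=> x y Nx Ny a b; rewrite mulgA -(Ny _ b) mulgKV Nx.
have nN : normal_subgroup N.
  split=> // x y Nx a b; rewrite /conjg.
  by rewrite !mulgA -(mulgA _ y b) Nx !mulgA mulgKV.
split=> //; apply: open_subgroup => //.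
have cGG : compact [set: G * G].
  by rewrite -setXTT; exact: compact_setX.
(* For each pair (a, b) the identity holds for n near 1 and for nearby pairs; compactness makes the
   neighbourhood of 1 uniform. *)
move/compact_near_coveringP : cGG => /(_ G (nbhs 1%g)
  (fun n (ab : G * G) => f (ab.1 * n * ab.2)%g = f (ab.1 * ab.2)%g) (nbhs_filter 1%g)) cov.
have -> : N = [set n | [set: G * G] `<=`
    (fun ab : G * G => f (ab.1 * n * ab.2)%g = f (ab.1 * ab.2)%g)].
  by apply/seteqP; split=> n Nn; [move=> [a b] _|move=> a b; exact: (Nn (a, b))].
apply: cov => -[a b] _.
pose F (w : (G * G) * G) := (w.1.1 * w.2 * w.1.2)%g.
pose F0 (w : (G * G) * G) := (w.1.1 * w.1.2)%g.
have c1 : (fun w : (G * G) * G => w.1.1) @ ((a, b), 1%g) --> a.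
  by apply: (cvg_comp _ _ cvg_fst); exact: cvg_fst.
have c2 : (fun w : (G * G) * G => w.1.2) @ ((a, b), 1%g) --> b.
  by apply: (cvg_comp _ _ cvg_fst); exact: cvg_snd.
have c3 : (fun w : (G * G) * G => w.2) @ ((a, b), 1%g) --> 1%g by exact: cvg_snd.
have cF : F @ ((a, b), 1%g) --> (a * b)%g.
  by rewrite -[X in (X * b)%g]mulg1; do 2!apply: cvgMg => //.
have cF0 : F0 @ ((a, b), 1%g) --> (a * b)%g by exact: cvgMg.
have n1 : nbhs ((a, b), 1%g) [set w | f (F w) = f (a * b)%g].
  exact: (cF _ (cf _)).
have n2 : nbhs ((a, b), 1%g) [set w | f (F0 w) = f (a * b)%g].
  exact: (cF0 _ (cf _)).
by apply: filterS (filterI n1 n2) => -[[a' b'] n] [/= -> <-].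
Qed.

End TopGroupBasics.

Section ProP.
Variables (p : nat) (E : topGroupType).
Hypothesis Ep : pro_p p E.

Definition open_normal (V : set E) := normal_subgroup V /\ open V.

Lemma open_normalI V W : open_normal V -> open_normal W -> open_normal (V `&` W).
Proof.
move=> [[sV nV] oV] [[sW nW] oW]; split; last exact: openI.
split; last by move=> x y [Vx Wx]; split; [exact: nV|exact: nW].
split; first by split; exact: subgroup1.
by move=> x y [Vx Wx] [Vy Wy]; split; [exact: (sV.2)|exact: (sW.2)].
Qed.

(** The invariance subgroup of the indicator function of a clopen neighbourhood of 1 lies inside
    that neighbourhood. *)
Lemma open_normal_basis (U : set E) : nbhs 1%g U ->
  exists2 V, open_normal V & V `<=` U.
Proof.
case: Ep => cE hE tE _ U1.
have zE : zero_dimensional E by exact: compact_zero_dimensional.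
have [D [D1 [oD cD]] DU] := zero_dimensional_cvg hE zE cE U1.
pose f x := `[< D x >].
have cf x : nbhs x [set y | f y = f x].
  have [Dx|nDx] := pselect (D x).
    apply: filterS (open_nbhs_nbhs (conj oD Dx)) => y Dy /=.
    by rewrite /f !asboolT.
  apply: filterS (open_nbhs_nbhs (conj (closed_openC cD) nDx)) => y nDy /=.
  by rewrite /f !asboolF.
have [nN oN] := invariance_subgroup cE cf.
eexists; first by split; [exact: nN|exact: oN].
move=> n /= /(_ 1%g 1%g); rewrite !mulg1 mul1g => fn; apply: DU.
by apply/asboolP; rewrite -/(f n) fn; exact/asboolP.
Qed.

Lemma closed_sep (C : set E) x : closed C -> ~ C x ->
  exists2 V, open_normal V & forall v, V v -> ~ C (x * v)%g.
Proof.
move=> cC nCx; have [|V nV VC] := @open_normal_basis [set y | (~` C) (x * y)%g].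
  apply: open_nbhs_nbhs; split; last by rewrite /= mulg1.
  by apply: translate_open; exact: closed_openC.
by exists V.
Qed.

Lemma pro_p_compact : compact [set: E]. Proof. by case: Ep. Qed.

End ProP.

(** * Finite quotients and indices *)

Definition fimage (A : Type) (T : finType) (f : A -> T) (H : set A) : {set T} :=
  finset (fun t => `[< exists2 x, H x & f x = t >]).

Lemma fimageP (A : Type) (T : finType) (f : A -> T) (H : set A) t :
  (t \in fimage f H) <-> exists2 x, H x & f x = t.
Proof. by rewrite inE; split=> /asboolP. Qed.

Lemma mem_fimage (A : Type) (T : finType) (f : A -> T) (H : set A) x :
  H x -> f x \in fimage f H.
Proof. by move=> Hx; apply/fimageP; exists x. Qed.

Lemma fimageS (A : Type) (T : finType) (f : A -> T) (H K : set A) :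
  H `<=` K -> fimage f H \subset fimage f K.
Proof.
by move=> HK; apply/fintype.subsetP => t /fimageP[x Hx <-]; exact/mem_fimage/HK.
Qed.

Section Index.
Variables (G : topGroupType) (T : finType) (pi : G -> T) (V : set G).
Hypothesis piP : forall x y, pi x = pi y <-> V (x^-1 * y)%g.

Lemma gindexE (K : set G) : gindex K V = #|fimage pi K|.
Proof.
pose h (t : T) : set G := [set y | pi y = t].
have -> : gindex K V = #|` fset_set (h @` [set` enum (fimage pi K)])|.
  rewrite /gindex; congr (#|` fset_set _|); apply/seteqP; split.
    move=> _ [x Kx <-]; exists (pi x).
      by rewrite /= mem_enum; exact: mem_fimage.
    apply/seteqP; split=> y /=.
      move=> xy; exists (x^-1 * y)%g; last by rewrite mulVKg.
      by apply/piP.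
    by move=> [v Vv <-]; apply/esym/piP; rewrite mulKg.
  move=> _ [t /= + <-]; rewrite mem_enum => /fimageP[x Kx xt]; exists x => //.
  rewrite -xt; apply/seteqP; split=> y /=.
    by move=> [v Vv <-]; apply/esym/piP; rewrite mulKg.
  by move=> xy; exists (x^-1 * y)%g; [apply/piP|rewrite mulVKg].
rewrite fset_set_image; last exact: finite_seq.
rewrite card_in_imfset /=; last first.
  move=> s t; rewrite !in_fset_set; try exact: finite_seq.
  rewrite !inE /= !mem_enum => /fimageP[x _ xs] /fimageP[y _ yt] hst.
  have : h s x by [].
  by rewrite hst /h /= => <-.
rewrite cardE -(undup_id (enum_uniq (fimage pi K))) -card_fseq.
congr (#|` _|); apply/fsetP => t; rewrite in_fset_set; last exact: finite_seq.
by rewrite !inE mem_setE mem_undup.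
Qed.

Lemma fimage_mulset (K : set G) : V 1%g -> fimage pi (mulset K V) = fimage pi K.
Proof.
move=> V1; apply/setP => t; apply/idP/idP => /fimageP[].
  move=> _ [x Kx [v Vv <-]] <-; apply/fimageP; exists x => //.
  by apply/piP; rewrite mulKg.
by move=> x Kx <-; apply: mem_fimage; exact: mulset_subl.
Qed.

End Index.

Section FiniteQuotient.
Variables (p : nat) (E : topGroupType).
Hypotheses (p_pr : prime p) (Ep : pro_p p E).

Lemma finite_cosets (V : set E) : open_normal V ->
  exists (T : finType) (f : E -> T),
    (forall t, exists x, f x = t) /\ forall x y, f x = f y <-> V (y * x^-1)%g.
Proof.
move=> [[sV nV] oV].
pose c (x : E) : set E := [set y | V (y * x^-1)%g].
have ccE x y : c x = c y <-> V (y * x^-1)%g.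
  split=> [cxy|Vyx].
    by rewrite -[V _]/(c x y) cxy /c /= mulgV; exact: subgroup1.
  apply/seteqP; split=> z; rewrite /c /= => Vz.
    have -> : (z * y^-1 = z * x^-1 * (y * x^-1)^-1)%g.
      by rewrite invMg invgK !mulgA mulgKV.
    by apply: (sV.2).
  have -> : (z * x^-1 = z * y^-1 * (y * x^-1))%g by rewrite !mulgA mulgKV.
  exact: subgroupM.
have oc x : open (c x).
  have cR : continuous (fun y : E => (y * x^-1)%g).
    by move=> y; apply: (@cvgMg E _ (nbhs y)); [exact: cvg_id|exact: cvg_cst].
  by move/continuousP : cR; exact.
(* Finite lists directed by inclusion: the near-covering form of compactness then yields one list
   that meets every coset. *)
pose F : set_system (seq E) := 
  fun P => exists s : seq E, forall t : seq E, {subset s <= t} -> P t.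
have FF : Filter F.
  split; first by exists [::].
    move=> P Q [s sP] [t tQ]; exists (s ++ t) => u stu; split.
      by apply: sP => x xs; apply: stu; rewrite mem_cat xs.
    by apply: tQ => x xt; apply: stu; rewrite mem_cat xt orbT.
  by move=> P Q PQ [s sP]; exists s => t /sP/PQ.
have [s Ds] : \near F, [set: E] `<=` (fun x => exists2 y, y \in F & c x = c y).
  have /compact_near_coveringP/(_ _ F) := pro_p_compact Ep; apply=> // x _.
  exists (c x, [set s : seq E | x \in s]) => /=.
    split; first by apply: open_nbhs_nbhs; split=> //; rewrite /c /= mulgV; exact: subgroup1.
    by exists [:: x] => t; apply; rewrite inE.
  move=> [y s] [/= xy xs]; exists x => //; apply/esym/ccE.
  exact: xy.
have finC : finite_set (range c).
  apply: (@sub_finite_set _ _ (c @` [set` s])); last by apply: finite_image; exact: finite_seq.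
  by move=> _ [x _ <-]; have [] := Ds s (fun _ => id) x I => y ys ->; exists y.
pose C := fset_set (range c).
have cC x : c x \in C by rewrite in_fset_set //; apply/mem_set; exists x.
exists C, (fun x => [` cC x]%fset); split.
  move=> [t tC]; have := tC; rewrite in_fset_set // => /set_mem[x _ xt].
  by exists x; apply: val_inj.
move=> x y; rewrite -ccE; split=> [/(congr1 val)//|cxy]; exact: val_inj.
Qed.

(** The cosets come as a finite type without group law, so the quotient is realized as the group of
    permutations that right translations induce on them; normality makes V the kernel. *)
Lemma finite_quotient (V : set E) : open_normal V ->
  exists (gT : finGroupType) (pi : E -> gT),
    [/\ {morph pi : x y / (x * y)%g}, forall x, pi x = 1%g <-> V x,
        forall t, exists x, pi x = t & p.-nat #|gT|].
Proof.
move=> oV; have [T [f [fS fV]]] := finite_cosets oV.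
case: oV => [[sV nV] oV].
have [s sK] := choice fS.
have fM x y h : f x = f y -> f (x * h)%g = f (y * h)%g.
  by move=> /fV Vyx; apply/fV; rewrite invMg mulgA mulgK.
pose rho g t := f (s t * g)%g.
have rho_inj g : injective (rho g).
  by move=> t u /(@fM _ _ g^-1%g); rewrite !mulgK !sK.
pose act g := perm (@rho_inj g).
have actM : {morph act : x y / (x * y)%g}.
  move=> x y; apply/permP => t; rewrite permM !permE /rho mulgA; apply: fM.
  by rewrite sK.
have act1 x : act x = 1%g <-> V x.
  split=> [/permP/(_ (f 1%g))|Vx].
    rewrite permE perm1 /rho => /esym; rewrite -(sK (f 1%g)) => /fV.
    rewrite sK; set u := s _ => Vu; have := nV _ u Vu.
    by rewrite /conjg mulgKV mulKg.
  apply/permP => t; rewrite permE perm1 /rho -[RHS]sK; apply/esym/fV.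
  by have := nV _ (s t)^-1%g Vx; rewrite /conjg invgK mulgA.
pose P := fimage act [set: E].
have gP : group_set P.
  apply/group_setP; split.
    by apply/fimageP; exists 1%g => //; apply/act1; exact: subgroup1.
  by move=> a b /fimageP[x _ <-] /fimageP[y _ <-]; apply/fimageP; exists (x * y)%g.
pose PG := Group gP.
have actP x : act x \in PG by exact: mem_fimage.
have piM : {morph (fun x => subg PG (act x)) : x y / (x * y)%g}.
  by move=> x y /=; rewrite actM morphM.
have pi1 x : subg PG (act x) = 1%g <-> V x.
  rewrite -act1; split=> [|->]; last by rewrite morph1.
  by move/(congr1 sgval); rewrite subgK // => ->.
exists (subg_of PG), (fun x => subg PG (act x)); split=> //.
  move=> t; have /fimageP[x _ xt] := subgP t.
  by exists x; rewrite xt sgvalK.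
have [_ _ _ /(_ V (conj sV nV) oV)[n iV]] := Ep.
have piV x y : subg PG (act x) = subg PG (act y) <-> V (x^-1 * y)%g.
  rewrite -pi1 piM.
  have -> : subg PG (act x^-1%g) = (subg PG (act x))^-1%g.
    by apply/eqP; rewrite eq_sym eq_invg_mul -piM mulgV; apply/eqP/pi1; exact: subgroup1.
  split=> [->|]; first by rewrite mulVg.
  by move/eqP; rewrite -eq_mulVg1 => /eqP.
have -> : #|subg_of PG| = (p ^ n)%N.
  rewrite -iV (gindexE piV); apply: eq_card => t; apply/esym/fimageP.
  have /fimageP[x _ xt] := subgP t.
  by exists x => //; rewrite xt sgvalK.
by rewrite pnatX pnat_id.
Qed.

End FiniteQuotient.

(** * Polynomial functions *)

Section Differences.
Variables (p : nat) (E : groupType).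
Implicit Types (f : E -> 'F_p) (x y g h : E) (n m : nat).

Definition dif g f : E -> 'F_p := fun x => f (x * g)%g - f x.
Definition rtr g f : E -> 'F_p := fun x => f (x * g)%g.
Definition ltr g f : E -> 'F_p := fun x => f (g * x)%g.

(* [polf n f]: f has degree less than n. *)
Fixpoint polf n f : Prop :=
  if n is m.+1 then forall g, polf m (dif g f) else f = 0.

Lemma faddE f1 f2 x : (f1 + f2) x = f1 x + f2 x. Proof. by []. Qed.
Lemma foppE f x : (- f) x = - f x. Proof. by []. Qed.
Lemma fscaleE (a : 'F_p) f x : (a \*o f) x = a * f x. Proof. by []. Qed.

Lemma difE g f x : dif g f x = f (x * g)%g - f x. Proof. by []. Qed.

Lemma rtrE g f : rtr g f = f + dif g f.
Proof. by apply/funext => x; rewrite faddE difE addrC subrK. Qed.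

Lemma difD g f1 f2 : dif g (f1 + f2) = dif g f1 + dif g f2.
Proof. by apply/funext => x; rewrite ?(faddE, foppE, difE); ring. Qed.

Lemma difZ g (a : 'F_p) f : dif g (a \*o f) = a \*o dif g f.
Proof. by apply/funext => x; rewrite fscaleE !difE !fscaleE mulrBr. Qed.

Lemma dif0 g : dif g 0 = 0.
Proof. by apply/funext => x; rewrite difE subr0. Qed.

Lemma difMn g f k : dif g (f *+ k) = dif g f *+ k.
Proof.
elim: k => [|k IH]; first by rewrite !mulr0n; exact: dif0.
by rewrite !mulrS difD IH.
Qed.

Lemma dif_sum g (I : Type) (r : seq I) (P : pred I) (F : I -> E -> 'F_p) :
  dif g (\sum_(i <- r | P i) F i) = \sum_(i <- r | P i) dif g (F i).
Proof.
by elim/big_rec2 : _ => [|i y1 y2 _ <-]; [exact: dif0|rewrite difD].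
Qed.

Lemma dif1 f : dif 1%g f = 0.
Proof. by apply/funext => x; rewrite difE mulg1 subrr. Qed.

Lemma difM g h f : dif (g * h)%g f = dif g (dif h f) + dif g f + dif h f.
Proof. by apply/funext => x; rewrite !(faddE, difE) mulgA; ring. Qed.

Lemma rtr_rtr g h f : rtr g (rtr h f) = rtr (g * h)%g f.
Proof. by apply/funext => x; rewrite /rtr mulgA. Qed.

Lemma dif_ltr g h f : dif g (ltr h f) = ltr h (dif g f).
Proof. by apply/funext => x; rewrite /ltr !difE mulgA. Qed.

Lemma polfD n f1 f2 : polf n f1 -> polf n f2 -> polf n (f1 + f2).
Proof.
elim: n f1 f2 => [|n IH] f1 f2 /=; first by move=> -> ->; rewrite addr0.
by move=> h1 h2 g; rewrite difD; exact: IH.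
Qed.

Lemma polfZ n a f : polf n f -> polf n (a \*o f).
Proof.
elim: n f => [|n IH] f /=; first by move=> ->; apply/funext => x; rewrite fscaleE mulr0.
by move=> hf g; rewrite difZ; exact: IH.
Qed.

Lemma polfN n f : polf n f -> polf n (- f).
Proof.
move=> /(@polfZ n (-1)); congr (polf n _).
by apply/funext => x; rewrite fscaleE foppE mulN1r.
Qed.

Lemma polf0 n : polf n 0.
Proof. by elim: n => [//|n IH] g /=; rewrite dif0. Qed.

Lemma polfS n f : polf n f -> polf n.+1 f.
Proof.
elim: n f => [|n IH] f /=; first by move=> -> g; rewrite dif0.
by move=> hf g; exact: IH.
Qed.

Lemma polf_le n m f : (n <= m)%N -> polf n f -> polf m f.
Proof. by move=> /subnK <- hf; elim: (m - n)%N => // k; rewrite addSn; exact: polfS. Qed.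

Lemma polf_dif n g f : polf n f -> polf n.-1 (dif g f).
Proof. by case: n => [|n] /=; [move=> ->; rewrite dif0|exact]. Qed.

Lemma polf_rtr n g f : polf n f -> polf n (rtr g f).
Proof.
move=> hf; rewrite rtrE; apply: polfD => //.
by apply: (@polf_le n.-1); [exact: leq_pred|exact: polf_dif].
Qed.

Lemma polf_ltr n g f : polf n f -> polf n (ltr g f).
Proof.
elim: n f => [|n IH] f /=; first by move=> ->; apply/funext => x.
by move=> hf h; rewrite dif_ltr; exact: IH.
Qed.

Lemma polf1 f : polf 1 f <-> f = cst (f 1%g).
Proof.
split=> [hf|->]; last by move=> g; apply/funext => x; rewrite difE subrr.
apply/funext => x; have /= := hf x => /(congr1 (@^~ 1%g)).
by rewrite difE mul1g => /eqP; rewrite subr_eq0 => /eqP.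
Qed.

Lemma polf_cst (a : 'F_p) n : polf n.+1 (cst a).
Proof. by apply: (@polf_le 1) => //; apply/polf1. Qed.

Definition difl y f : E -> 'F_p := fun x => f (y * x)%g - f x.

Lemma difl_dif y g f : difl y (dif g f) = dif g (difl y f).
Proof. by apply/funext => x; rewrite /difl !difE !mulgA; ring. Qed.

Lemma polf_difl n y f : polf n.+1 f -> polf n (difl y f).
Proof.
elim: n f => [|n IH] f hf.
  move/polf1 : hf => ->; apply/funext => x; rewrite /difl /= subrr; exact.
by move=> g; rewrite -difl_dif; apply: IH; exact: hf.
Qed.

(** Left and right differences commute, so with [polf_difl] they measure the same degree. Left
    differences allow induction on the degree in statements about right differences, as in
    [relation_cpol]. *)
Lemma difl_polf n f : (forall y, polf n (difl y f)) -> polf n.+1 f.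
Proof.
elim: n f => [|n IH] f hf.
  apply/polf1/funext => x; have := congr1 (@^~ 1%g) (hf x).
  by rewrite /difl mulg1 => /eqP; rewrite subr_eq0 => /eqP.
by move=> g; apply: IH => y; rewrite difl_dif; exact: hf.
Qed.

Hypothesis p_pr : prime p.

(** The binomial theorem for 1 + [dif g], the operator of right translation by g. *)
Lemma rtrX g f n : rtr (g ^+ n)%g f = \sum_(j < n.+1) iter j (dif g) f *+ 'C(n, j).
Proof.
elim: n => [|n IH].
  by rewrite big_ord1 bin0 /=; apply/funext => x; rewrite /rtr mulg1.
rewrite expgS -rtr_rtr IH rtrE dif_sum.
rewrite [in RHS]big_ord_recl [in RHS]bin0 /= mulr1n.
under [in RHS]eq_bigr => j _ do rewrite /bump /= add1n binS mulrnDr.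
rewrite [in RHS]big_split /= addrA; congr (_ + _); last first.
  by apply: eq_bigr => j _; rewrite difMn.
rewrite [in LHS]big_ord_recl bin0 /= mulr1n; congr (_ + _).
by rewrite [in RHS]big_ord_recr /= bin_small // mulr0n addr0.
Qed.

(** In characteristic p the middle binomial coefficients vanish: (1 + D)^p = 1 + D^p. This is why
    p-th powers multiply weights by p. *)
Lemma difXp g f : dif (g ^+ p)%g f = iter p (dif g) f.
Proof.
apply/funext => x; have := congr1 (@^~ x) (rtrX g f p).
rewrite difE /rtr => ->; rewrite (bigD1 ord0) //= (bigD1 ord_max) /=; last first.
  by rewrite -val_eqE /= -lt0n prime_gt0.
rewrite bin0 binn !mulr1n big1 ?addr0; first by rewrite faddE addrC addKr.
move=> i /andP[i0 ip].
have /dvdnP[k ->] : (p %| 'C(p, i))%N.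
  rewrite prime_dvd_bin // lt0n [_ != _]i0 ltn_neqAle -ltnS ltn_ord andbT.
  exact: ip.
apply/funext => y; rewrite mulrnA.
have -> (h : E -> 'F_p) : h *+ p = 0; last by [].
apply/funext => z; rewrite -[RHS](mulrn_pchar (pchar_Fp p_pr) (h z)).
have fMn m : (h *+ m) z = h z *+ m.
  by elim: m => [|m IH]; rewrite ?mulr0n// !mulrS faddE IH.
exact: fMn.
Qed.

End Differences.

(** * Jennings' theorem *)

Ltac natonly :=
  repeat match goal with
  | H : ?T |- _ => lazymatch T with
    | is_true (leq _ _) => fail
    | nat => fail
    | @eq nat _ _ => fail
    | _ => clear H
    end
  end.
Ltac natlia := natonly; lia.
Ltac natnia := natonly; nia.

Section Jennings.
Local Open Scope group_scope.
Variables (p : nat) (gT : finGroupType) (zeta : nat -> {group gT}) (n : nat).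
Implicit Types (M : {group gT}) (h : gT -> 'F_p) (w x y z : gT) (k m : nat).
Hypothesis p_pr : prime p.
Hypothesis zeta_dec : forall i j, (i <= j)%N -> zeta j \subset zeta i.
Hypothesis zetaR : forall i j x y, (0 < i)%N -> (0 < j)%N ->
  x \in zeta i -> y \in zeta j -> [~ x, y] \in zeta (i + j).
Hypothesis zetaX : forall i x, (0 < i)%N -> x \in zeta i -> x ^+ p \in zeta (p * i).
Hypothesis zeta_top : forall x, x \in zeta 1.
Hypothesis zeta_bot : forall x, x \in zeta n -> x = 1.

(** The encoding is impredicative: a degree bound is proved by exhibiting any relation Q that is
    stable under the recursion, which is how the lemmas below proceed. *)
Definition wdeg_closed M (Q : nat -> (gT -> 'F_p) -> Prop) :=
  (forall h, Q 0 h -> forall x, x \in M -> h x = 0%R) /\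
  forall m k h z, Q m h -> z \in M -> (0 < k)%N -> z \in zeta k ->
    Q (m - k)%N (dif z h).

(* On M, h has degree less than m when differences along zeta_k have weight k:
   the greatest solution of the defining recursion. *)
Definition wdeg M m h := exists2 Q, wdeg_closed M Q & Q m h.

Lemma wdegP M : wdeg_closed M (wdeg M).
Proof.
split=> [h [Q [Q0 _] /Q0]//|m k h z [Q cQ Qh] zM k0 zk].
by exists Q => //; apply: cQ.2.
Qed.

Lemma wdeg_le M m k h : (m <= k)%N -> wdeg M m h -> wdeg M k h.
Proof.
move=> mk [Q cQ Qh]; exists (fun k h => exists2 m, (m <= k)%N & Q m h); last by exists m.
split=> [h' [i]|k' j h' z [i ik Qi] zM j0 zj].
  by rewrite leqn0 => /eqP -> /cQ.1.
by exists (i - j)%N; [exact: leq_sub2r|exact: cQ.2].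
Qed.

Lemma wdegD M m h h' : wdeg M m h -> wdeg M m h' -> wdeg M m (h + h')%R.
Proof.
move=> [Q cQ Qh] [Q' cQ' Qh'].
exists (fun k f => exists f1 f2, [/\ Q k f1, Q' k f2 & f = (f1 + f2)%R]); last by exists h, h'.
split=> [f [f1 [f2 [/cQ.1 h1 /cQ'.1 h2 ->]]] x xM|k j f z [f1 [f2 [h1 h2 ->]]] zM j0 zj].
  by rewrite faddE h1 // h2 // addr0.
exists (dif z f1), (dif z f2); split; last exact: difD.
  exact: cQ.2.
exact: cQ'.2.
Qed.

Lemma wdeg_ext M m h h' : (forall x, x \in M -> h x = h' x) ->
  wdeg M m h -> wdeg M m h'.
Proof.
move=> hh' [Q cQ Qh].
exists (fun k f => exists2 g, Q k g & forall x, x \in M -> g x = f x); last by exists h.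
split=> [f [g /cQ.1 g0 gf] x xM|k j f z [g Qg gf] zM j0 zj]; first by rewrite -gf ?g0.
exists (dif z g); first exact: cQ.2.
by move=> x xM; rewrite !difE !gf ?groupM.
Qed.

Lemma wdeg0 M m : wdeg M m 0%R.
Proof.
exists (fun _ h => h = 0%R) => //; split=> [h -> //|k j h z -> *]; exact: dif0.
Qed.

(** The statement that climbs from zeta_n, where it is vacuous, to zeta_1 in steps of index p. The
    degree of the separating function is tied to the term zeta_m that x avoids. *)
Definition separated M := forall m x, (m <= n)%N -> x \in M -> x \notin zeta m ->
  exists2 h, wdeg M m h & h x <> h 1.

Lemma iter_difD y e (h h' : gT -> 'F_p) :
  iter e (dif y) (h + h')%R = (iter e (dif y) h + iter e (dif y) h')%R.
Proof. by elim: e => //= e ->; exact: difD. Qed.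

Section Extension.
Variables (M' M : {group gT}) (w : nat) (y : gT).
Hypothesis w0 : (0 < w)%N.
Hypothesis zM' : zeta w.+1 \subset M'.
Hypothesis Mz : M \subset zeta w.
Hypothesis M'M : M' \subset M.
Hypothesis yM : y \in M.
Hypothesis yM' : y \notin M'.
Hypothesis MP : forall x, x \in M -> exists (a : gT) (e : nat),
  [/\ a \in M', (e < p)%N & x = a * y ^+ e].

Let yw : y \in zeta w. Proof. exact: fintype.subsetP yM. Qed.

Let ypM' : y ^+ p \in M'.
Proof.
apply: (fintype.subsetP zM'); apply: (fintype.subsetP (@zeta_dec w.+1 (p * w) _)).
  by have := prime_gt1 p_pr; nia.
exact: zetaX.
Qed.

(** Degree on M = M' <y> read off along M'. Each difference in direction y has weight w, and p - 1
    of them are enough, the p-th being a difference along y^p in M'. *)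
Definition stepdeg e m h := forall e', (e' <= e)%N ->
  wdeg M' (m - e' * w) (iter e' (dif y) h).

Lemma stepdegS e e' m h : (e <= e')%N -> stepdeg e' m h -> stepdeg e m h.
Proof. by move=> ee' hh i ie; apply: hh; exact: leq_trans ee'. Qed.

Lemma stepdeg_le e m m' h : (m <= m')%N -> stepdeg e m h -> stepdeg e m' h.
Proof. by move=> mm' hh i ie; apply: wdeg_le (hh i ie); exact: leq_sub2r. Qed.

Lemma stepdegD e m h h' : stepdeg e m h -> stepdeg e m h' -> stepdeg e m (h + h')%R.
Proof. by move=> hh hh' i ie; rewrite iter_difD; apply: wdegD; [exact: hh|exact: hh']. Qed.

Lemma stepdeg_difS e m h : stepdeg e.+1 m h -> stepdeg e (m - w) (dif y h).
Proof. by move=> hh i ie; rewrite -iterSr -subnDA -mulSn; exact: hh. Qed.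

(** The operators [dif y] and [dif z] commute up to a difference along the commutator c of weight w
    + k, which lies in M' again; hence the induction on the number of differences in direction y,
    over all z at once. *)
Lemma stepdeg_dif_inner e m h k z : stepdeg e m h -> z \in M' -> (0 < k)%N ->
  z \in zeta k -> stepdeg e (m - k) (dif z h).
Proof.
elim: e m h k z => [|e IH] m h k z hh zM0 k0 zk.
  move=> i; rewrite leqn0 => /eqP ->; rewrite mul0n subn0 /=.
  apply: (wdegP M').2 => //.
  by have := hh 0%N (leqnn _); rewrite mul0n subn0.
have he : stepdeg e m h by exact: stepdegS hh.
move=> i; rewrite leq_eqVlt => /orP[/eqP ->|ie]; last exact: (IH m h k z).
pose c := [~ y^-1, z^-1].
have ck : c \in zeta (w + k) by apply: zetaR; rewrite ?groupV.
have cM' : c \in M'.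
  apply: (fintype.subsetP zM'); apply: fintype.subsetP ck.
  by apply: zeta_dec; natlia.
have E1 : dif y (dif z h) = (dif z (dif y h) + dif c (rtr z (rtr y h)))%R.
  apply/funext => x; rewrite faddE !difE /rtr.
  have -> : x * c * z * y = x * y * z.
    by rewrite /c /commg /conjg !invgK !mulgA !mulgKV.
  by ring.
rewrite iterSr E1 iter_difD.
have hy := stepdeg_difS hh.
have hm : (m - k - e.+1 * w = m - w - k - e * w)%N.
  by rewrite mulSn -!subnDA; congr (m - _)%N; ring.
apply: wdegD; first by rewrite hm; exact: (IH (m - w)%N).
have -> : (m - k - e.+1 * w = m - (w + k) - e * w)%N.
  by rewrite mulSn -!subnDA; congr (m - _)%N; ring.
apply: (IH m) => //; last by rewrite addn_gt0 w0.
have hr : stepdeg e m (rtr y h).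
  by rewrite rtrE; apply: stepdegD => //; apply: stepdeg_le hy; exact: leq_subr.
rewrite rtrE; apply: stepdegD => //; apply: stepdeg_le (IH m _ k z hr zM0 k0 zk).
exact: leq_subr.
Qed.

Lemma stepdeg_dif_y m h : stepdeg p.-1 m h -> stepdeg p.-1 (m - w) (dif y h).
Proof.
move=> hh i; rewrite leq_eqVlt => /orP[/eqP ->|ip]; last first.
  by rewrite -iterSr -subnDA -mulSn; exact: hh.
rewrite -iterSr -subnDA -mulSn prednK ?prime_gt0 // -difXp //.
apply: (wdegP M').2 => //; last by apply: zetaX.
  by have := hh 0%N (leq0n _); rewrite mul0n subn0.
by rewrite muln_gt0 prime_gt0.
Qed.

Lemma stepdeg_dif m h k z : stepdeg p.-1 m h -> z \in M -> (0 < k)%N ->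
  z \in zeta k -> stepdeg p.-1 (m - k) (dif z h).
Proof.
move=> hh zM k0 zk; have [zM0|zM0] := boolP (z \in M').
  exact: stepdeg_dif_inner.
have kw : (k <= w)%N.
  rewrite leqNgt; apply: contra zM0 => wk; apply: (fintype.subsetP zM').
  by apply: fintype.subsetP zk; exact: zeta_dec.
apply: (@stepdeg_le _ (m - w)); first exact: leq_sub2l.
have [a [e [aM' _ ->]]] := MP zM.
have aw : a \in zeta w by apply: (fintype.subsetP Mz); exact: fintype.subsetP aM'.
have hy : stepdeg p.-1 (m - w) (dif (y ^+ e) h).
  elim: e => [|e IH].
    rewrite expg0 dif1 => i _; have -> : iter i (dif y) (0 : gT -> 'F_p)%R = 0%R.
      by elim: i => //= i ->; exact: dif0.
    exact: wdeg0.
  rewrite expgS difM; apply: stepdegD; last exact: IH.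
  apply: stepdegD; last exact: stepdeg_dif_y.
  by apply: stepdeg_le (stepdeg_dif_y IH); exact: leq_subr.
rewrite difM; apply: stepdegD => //; apply: stepdegD; last exact: stepdeg_dif_inner.
by apply: stepdeg_le (stepdeg_dif_inner hy aM' w0 aw); exact: leq_subr.
Qed.

(** The relation [stepdeg p.-1] is itself stable in the sense of [wdeg_closed]. In degree 0, the
    value at a * y^e is expanded by the binomial formula into values at a of functions of degree 0
    on M'. *)
Lemma stepdeg_wdeg m h : stepdeg p.-1 m h -> wdeg M m h.
Proof.
move=> hh; exists (stepdeg p.-1) => //; split.
  move=> h' hh' x /MP[a [e [aM' ep ->]]].
  rewrite -[LHS]/(rtr (y ^+ e) h' a) rtrX fct_sumE big1 // => i _.
  have fMn (f : gT -> 'F_p) j : (f *+ j)%R a = (f a *+ j)%R.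
    by elim: j => [|j IH]; rewrite ?mulr0n// !mulrS faddE IH.
  have hi : wdeg M' (0 - i * w) (iter i (dif y) h').
    by apply: hh'; have := ltn_ord i; have := prime_gt0 p_pr; natlia.
  by rewrite sub0n in hi; rewrite fMn ((wdegP M').1 _ hi) // mul0rn.
by move=> m' k h' z hh' zM k0 zk; exact: stepdeg_dif.
Qed.

(** Otherwise a power of y prime to p, and with it y, would lie in M' by Bezout. *)
Let ex_uniq a b i j : a \in M' -> b \in M' -> (i < p)%N -> (j < p)%N ->
  a * y ^+ i = b * y ^+ j -> i = j.
Proof.
wlog ij : a b i j / (i <= j)%N.
  move=> H aM bM ip jp e; have [ij|/ltnW ji] := leqP i j; first exact: (H a b).
  by apply/esym; exact: (H b a).
move=> aM bM ip jp e; apply/eqP; rewrite eqn_leq ij leqNgt; apply/negP => lij.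
have yd : y ^+ (j - i) \in M'.
  have -> : y ^+ (j - i) = b^-1 * a.
    apply: (mulIg (y ^+ i)); rewrite -expgD subnK //.
    by rewrite -mulgA e mulKg.
  by rewrite groupM ?groupV.
have d0 : (0 < j - i)%N by natlia.
have cop : coprime p (j - i).
  by rewrite prime_coprime //; apply/negP => /dvdn_leq-/(_ d0); natlia.
have [u [v uv]] : exists u v, (u * (j - i) = v * p + 1)%N.
  case: (egcdnP p d0) => u v uv _; exists u, v; rewrite uv; congr (_ + _)%N.
  by rewrite gcdnC; apply/eqP.
apply/negP: yM'; rewrite negbK.
have : y ^+ (u * (j - i)) \in M' by rewrite mulnC expgM groupX.
by rewrite uv expgD expg1 mulnC expgM groupMl // groupX.
Qed.

(** The character of M with kernel M'; outside M it takes the junk value 0. *)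
Definition expo x : nat := oapp (@nat_of_ord p) 0%N [pick e : 'I_p | x * (y ^+ e)^-1 \in M'].

Lemma expoE a e : a \in M' -> (e < p)%N -> expo (a * y ^+ e) = e.
Proof.
move=> aM ep; rewrite /expo; case: pickP => [i|/(_ (Ordinal ep))] /=.
  by move=> iM; apply/esym/(ex_uniq aM iM ep) => //; rewrite mulgKV.
by rewrite mulgK aM.
Qed.

Lemma expo1 a : a \in M' -> expo a = 0%N.
Proof. by move=> aM; rewrite -[a]mulg1 -(expg0 y) expoE // prime_gt0. Qed.

Hypothesis yN : y \in 'N(M').

Lemma expoM u v : u \in M -> v \in M ->
  ((expo (u * v))%:R = (expo u)%:R + (expo v)%:R :> 'F_p)%R.
Proof.
move=> /MP[a [i [aM ip ->]]] /MP[b [j [bM jp ->]]].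
rewrite !expoE //.
have -> : a * y ^+ i * (b * y ^+ j) = a * (b ^ (y ^+ i)^-1) * y ^+ (i + j).
  by rewrite /conjg invgK expgD !mulgA mulgKV.
have bM2 : b ^ (y ^+ i)^-1 \in M' by rewrite memJ_norm // groupV groupX.
have [ijp|pij] := ltnP (i + j) p.
  by rewrite (expoE (groupM aM bM2) ijp) natrD.
have -> : a * b ^ (y ^+ i)^-1 * y ^+ (i + j) = a * b ^ (y ^+ i)^-1 * y ^+ p * y ^+ (i + j - p).
  by rewrite -[in RHS]mulgA -expgD subnKC.
have ijp : (i + j - p < p)%N by natlia.
rewrite (expoE (groupM (groupM aM bM2) ypM') ijp) natrB // natrD.
by rewrite (pcharf0 (pchar_Fp p_pr)) subr0.
Qed.

(** The three cases of the relation are the character itself, constants, and functions that vanish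
    on M: a difference turns the character into a constant, which is 0 when its weight exceeds w. *)
Lemma wdeg_expo m : (w < m)%N -> wdeg M m (fun x => (expo x)%:R)%R.
Proof.
move=> wm; pose h0 : gT -> 'F_p := (fun x => (expo x)%:R)%R.
exists (fun k h => [\/ (w < k)%N /\ (forall x, x \in M -> h x = h0 x),
    (0 < k)%N /\ (exists a, forall x, x \in M -> h x = a) |
    forall x, x \in M -> h x = 0%R]); last by apply: Or31.
split=> [h [[]//|[]//|]//|k j h z].
move=> [[wk hh]|[k0 [a ha]]|h00] zM j0 zj.
- have hz x : x \in M -> dif z h x = h0 z.
    by move=> xM; rewrite difE !hh ?groupM // /h0 expoM // addrC addKr.
  have [kj|jk] := leqP k j; last by apply: Or32; split; [rewrite subn_gt0|exists (h0 z)].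
  apply: Or33 => x xM; rewrite hz // /h0 expo1 //.
  apply: (fintype.subsetP zM'); apply: fintype.subsetP zj.
  by apply: zeta_dec; exact: leq_trans kj.
- by apply: Or33 => x xM; rewrite difE !ha ?groupM // subrr.
- by apply: Or33 => x xM; rewrite difE !h00 ?groupM // subrr.
Qed.

Lemma separated_step : separated M' -> separated M.
Proof.
move=> sep m x mn xM xz.
have [a [e [aM ep xE]]] := MP xM.
have [e0|e0] := posnP e; last first.
  (* Outside M' the character separates x from 1; its degree w + 1 is allowed because x lies in
     zeta_w but not in zeta_m. *)
  exists (fun x => (expo x)%:R)%R.
    apply: wdeg_expo; rewrite ltnNge; apply: contra xz => mw.
    by apply: (fintype.subsetP (zeta_dec mw)); exact: (fintype.subsetP Mz).
  rewrite xE expoE // expo1 // => /eqP; rewrite -(dvdn_pcharf (pchar_Fp p_pr)).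
  by move=> /dvdn_leq-/(_ e0); rewrite leqNgt ep.
have xM' : x \in M' by rewrite xE e0 expg0 mulg1.
have [h hw hx] := sep m x mn xM' xz.
(* The extension of h to M that is constant in direction y on the exponents below p, so that its
   first p - 1 differences in that direction vanish on M'. *)
pose H u := h (u * (y ^+ expo u)^-1).
have HE b i : b \in M' -> (i < p)%N -> H (b * y ^+ i) = h b.
  by move=> bM ip; rewrite /H expoE // mulgK.
have H1 b : b \in M' -> H b = h b.
  by move=> bM; rewrite -[RHS](HE b 0%N) ?expg0 ?mulg1 // prime_gt0.
exists H; last by rewrite !H1.
apply: stepdeg_wdeg => -[|i] ip; first by rewrite mul0n subn0; apply: wdeg_ext hw => b /H1.
apply: (wdeg_ext _ (wdeg0 M' _)) => b bM.
have difH k j : (k.+1 + j < p)%N -> iter k.+1 (dif y) H (b * y ^+ j) = 0%R.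
  elim: k j => [|k IH] j kj.
    rewrite /= difE -mulgA -expgSr !HE ?subrr //; natlia.
  by rewrite iterS difE -mulgA -expgSr !IH ?subrr //; natlia.
by have := difH i 0%N; rewrite expg0 mulg1 addn0 => -> //; have := prime_gt0 p_pr; natlia.
Qed.

End Extension.

Hypothesis pG : p.-nat #|gT|.

Definition cyclic_step (w : nat) M' M y := [/\ zeta w.+1 \subset M', M \subset zeta w,
  M' \subset M, y \in M & y \notin M'] /\ (y \in 'N(M') /\ forall x, x \in M ->
    exists (a : gT) (e : nat), [/\ a \in M', (e < p)%N & x = a * y ^+ e]).

(** Elements of zeta_w are adjoined to zeta_(w+1) one at a time. The induction serves Jennings'
    theorem, the count of the steps serves [det_le_zeta]. *)
Lemma layer_ind (w : nat) (P : nat -> {group gT} -> Prop) : (0 < w)%N ->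
  P 0%N (zeta w.+1) ->
  (forall k M' M y, cyclic_step w M' M y -> P k M' -> P k.+1 M) ->
  exists2 k, P k (zeta w) & (p ^ k * #|zeta w.+1| <= #|zeta w|)%N.
Proof.
move=> w0 P0 PS.
suff climb d k (M' : {group gT}) : (#|zeta w| - #|M'| <= d)%N -> zeta w.+1 \subset M' ->
    M' \subset zeta w -> P k M' -> (p ^ k * #|zeta w.+1| <= #|M'|)%N ->
    exists2 k, P k (zeta w) & (p ^ k * #|zeta w.+1| <= #|zeta w|)%N.
  apply: (climb _ 0%N (zeta w.+1) (leqnn _)) => //; first exact: zeta_dec.
  by rewrite mul1n.
elim: d k M' => [|d IH] k M' cd zM' Mz Pk kM.
  have /eqP/val_inj ME : M' == zeta w :> {set gT}.
    by rewrite eqEcard Mz; move: cd; rewrite leqn0 subn_eq0.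
  by exists k; rewrite -ME.
have [/val_inj ME|ne] := eqVneq (M' : {set gT}) (zeta w); first by exists k; rewrite -ME.
have [y yz yM] : exists2 y, y \in zeta w & y \notin M'.
  have : ~~ (zeta w \subset M') by apply: contra ne => zM; rewrite finset.eqEsubset Mz.
  by move=> /fintype.subsetPn[y]; exists y.
have yN : y \in 'N(M').
  rewrite inE; apply/fintype.subsetP => _ /imsetP[a aM ->].
  have -> : a ^ y = a * [~ a, y] by rewrite /commg mulKVg.
  rewrite groupM //; apply: (fintype.subsetP zM').
  apply: (fintype.subsetP (@zeta_dec w.+1 (w + w) _)); first by natlia.
  by apply: zetaR => //; exact: (fintype.subsetP Mz).
have yp : y ^+ p \in M'.
  apply: (fintype.subsetP zM'); apply: (fintype.subsetP (@zeta_dec w.+1 (p * w) _)).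
    by have := prime_gt1 p_pr; nia.
  exact: zetaX.
pose M := (M' <*> <[y]>)%G.
have ME : M = M' * <[y]> :> {set gT} by rewrite /= norm_joinEr // cycle_subG.
have MP x : x \in M -> exists (a : gT) (e : nat), [/\ a \in M', (e < p)%N & x = a * y ^+ e].
  rewrite ME => /mulsgP[a _ aM /cycleP[i ->] ->].
  exists (a * (y ^+ p) ^+ (i %/ p)), (i %% p)%N; split.
  - by rewrite groupM // groupX.
  - by rewrite ltn_mod prime_gt0.
  - by rewrite -mulgA -expgM -expgD mulnC -divn_eq.
have M'M : M' \subset M by exact: joing_subl.
have yM' : y \in M by apply: (fintype.subsetP (joing_subr _ _)); exact: cycle_id.
have MZ : M \subset zeta w by rewrite join_subG Mz cycle_subG.
have iM : (p <= #|M : M'|)%N.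
  have /p_natP[[|e] iE] : p.-nat #|M : M'|.
  - apply: pnat_dvd pG; apply: (dvdn_trans (dvdn_indexg _ _)).
    by rewrite -cardsT cardSg ?finset.subsetT.
  - have MM' : M' = M by exact: val_inj (index1g M'M iE).
    by rewrite -MM' (negbTE yM) in yM'.
  - by rewrite iE expnS leq_pmulr // expn_gt0 prime_gt0.
have MM : (p * #|M'| <= #|M|)%N by rewrite -(Lagrange M'M) mulnC leq_mul2l iM orbT.
apply: (IH k.+1 M) => //.
- by have := subset_leq_card MZ; have := cardG_gt0 M'; have := prime_gt1 p_pr; natnia.
- exact: fintype.subset_trans M'M.
- exact: (PS k M' M y).
- by rewrite expnS -mulnA (leq_trans _ MM) // leq_mul2l kM orbT.
Qed.

Lemma separated_zeta (w : nat) : (0 < w)%N -> separated (zeta w.+1) -> separated (zeta w).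
Proof.
move=> w0 sep1; have [|//] := @layer_ind w (fun _ => separated) w0 sep1.
by move=> k M' M y [[zM' Mz M'M yM yM'] [yN MP]]; exact: (@separated_step M' M w y).
Qed.

Lemma jennings_finite x : x <> 1 -> exists2 h : gT -> 'F_p, polf n h & h x <> h 1.
Proof.
move=> x1.
have n0 : (1 < n)%N.
  rewrite ltnNge; apply/negP => n1; apply: x1; apply: zeta_bot.
  by apply: (fintype.subsetP (zeta_dec n1)).
have sepn : separated (zeta n).
  move=> m y mn yn; case/negP; exact: (fintype.subsetP (zeta_dec mn)).
have sep1 : separated (zeta 1).
  have sepk k : (k < n)%N -> separated (zeta (n - k)).
    elim: k => [|k IH] kn; first by rewrite subn0.
    apply: separated_zeta; first by natlia.
    by rewrite subnSK; [apply: IH; natlia|natlia].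
  by have := sepk n.-1; rewrite (_ : (n - n.-1 = 1)%N); [apply; natlia|natlia].
have [h hw hx] := sep1 n x (leqnn _) (zeta_top x) (introN idP (fun xz => x1 (zeta_bot xz))).
exists h => //.
(* Every element lies in zeta_1, so a weighted degree bounds the ordinary one. *)
have wdeg_polf k (f : gT -> 'F_p) : wdeg (zeta 1) k f -> polf k f.
  elim: k f => [|k IH] f hf; first by apply/funext => u; exact: (wdegP _).1 hf u (zeta_top u).
  move=> g; apply: IH; rewrite -[k]/(k.+1.-1) -subn1.
  exact: (wdegP _).2.
exact: wdeg_polf.
Qed.

End Jennings.

(** * The Zassenhaus series *)

Section ZassenhausBasics.
Variables (p : nat) (E : topGroupType).
Hypothesis p_pr : prime p.
Implicit Types (x y z : E) (i j n m : nat) (W : nat -> set E).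
Notation Z := (zassenhaus p E).

Lemma big_mulset_sub (I : eqType) (r : seq I) (F : I -> set E) (H : set E) :
  is_subgroup H -> (forall k : I, k \in r -> F k `<=` H) ->
  \big[@mulset E/[set 1%g]]_(i <- r) F i `<=` H.
Proof.
move=> sH; elim: r => [|i r IH] FH.
  by rewrite big_nil => _ ->; exact: subgroup1.
rewrite big_cons => _ [x Fx [y ry <-]]; apply: subgroupM => //.
  by apply: FH Fx; rewrite inE eqxx.
by apply: IH ry => j jr; apply: FH; rewrite inE jr orbT.
Qed.

Lemma sub_big_mulset (I : eqType) (r : seq I) (F : I -> set E) (i : I) :
  (forall k, F k 1%g) -> i \in r -> F i `<=` \big[@mulset E/[set 1%g]]_(j <- r) F j.
Proof.
move=> F1; have big1 (s : seq I) : (\big[@mulset E/[set 1%g]]_(j <- s) F j) 1%g.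
  elim: s => [|j s IH]; rewrite ?big_nil // big_cons.
  by exists 1%g => //; exists 1%g => //; rewrite mulg1.
elim: r => // j r IH; rewrite inE big_cons => /predU1P[<-|/IH{}IH] x Fx.
  exact: mulset_subl.
by apply: mulset_subr => //; exact: IH.
Qed.

Lemma ceil_lt i : (2 <= i)%N -> ((i + p).-1 %/ p < i)%N.
Proof. by have := prime_gt1 p_pr => p1 i2; rewrite ltn_divLR ?(ltnW p1)//; nia. Qed.

Lemma ceil_gt0 i : (1 <= i)%N -> (0 < (i + p).-1 %/ p)%N.
Proof.
by move=> i1; rewrite divn_gt0 ?prime_gt0 //; have := prime_gt0 p_pr; lia.
Qed.

Lemma ceil_mul i : ((p * i + p).-1 %/ p = i)%N.
Proof.
have p0 := prime_gt0 p_pr.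
have -> : ((p * i + p).-1 = i * p + p.-1)%N by lia.
by rewrite divnMDl // divn_small ?addn0 // prednK.
Qed.

(** All upper bounds on Z_i come from this universal property, with W the elements that lower
    degrees by i, or a box in a product. *)
Lemma zassenhaus_min W : (forall i, closed_subgroup (W i)) -> W 1%N = setT ->
  (forall i x, (1 <= i)%N -> W ((i + p).-1 %/ p)%N x -> W i (x ^+ p)%g) ->
  (forall i j x y, (0 < i)%N -> (0 < j)%N -> W i x -> W j y -> W (i + j)%N [~ x, y]%g) ->
  forall i, (0 < i)%N -> Z i `<=` W i.
Proof.
move=> cW W1 WX WR; elim/ltn_ind => i IH i0.
have [i1|i2] := leqP i 1.
  have -> : i = 1%N by apply/eqP; rewrite eqn_leq i1.
  by rewrite W1.
rewrite (zassenhausE E p_pr i2) => _ [x Zx [y Zy <-]].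
have sW := (cW i).1; apply: subgroupM => //.
  apply: tgen_min Zx => // _ [z Zz <-]; apply: WX => //.
  by apply: IH Zz; [exact: ceil_lt|exact: ceil_gt0].
apply: big_mulset_sub Zy => // j; rewrite mem_index_iota => /andP[j0 ji].
apply: tgen_min => // _ [a Za [b Zb <-]]; rewrite -(subnKC (ltnW ji)).
apply: WR; rewrite ?subn_gt0 //; first exact: IH.
by apply: IH Zb; rewrite ?subn_gt0 // ltn_subrL j0.
Qed.

Lemma zassenhaus_normal i : normal_subgroup (Z i).
Proof.
elim/ltn_ind: i => i IH; have [i1|i2] := leqP i 1.
  by have -> : Z i = setT; [case: i i1 {IH} => [|[|]]|split].
rewrite (zassenhausE E p_pr i2); apply: mulset_normal.
  apply: tgen_normal => _ y [x Zx <-]; exists (x ^ y)%g; last by rewrite conjXg.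
  by apply: (IH _ _).2 => //; exact: ceil_lt.
have n1 : normal_subgroup [set (1 : E)%g].
  split=> [|x y ->]; last by rewrite conj1g.
  by split=> // x y -> ->; rewrite mulgV.
rewrite big_nat; elim/big_ind : _ => //; first exact: mulset_normal.
move=> j /andP[j0 ji]; apply: tgen_normal => _ y [a Za [b Zb <-]].
rewrite conjRg; exists (a ^ y)%g; first by apply: (IH _ _).2.
by exists (b ^ y)%g => //; apply: (IH _ _).2 => //; rewrite ltn_subrL j0 (ltnW i2).
Qed.

Lemma zassenhaus_sub i : is_subgroup (Z i). Proof. exact: (zassenhaus_normal i).1. Qed.

Lemma zassenhausX i x : (0 < i)%N -> Z ((i + p).-1 %/ p)%N x -> Z i (x ^+ p)%g.
Proof.
move=> i0; have [i1|i2] := leqP i 1; first by case: i i0 i1 => [|[|]].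
move=> Zx; rewrite (zassenhausE E p_pr i2); apply: mulset_subl; last first.
  by apply: tgen_sub; exists x.
have F1 j : tgen (commset (Z j) (Z (i - j)%N)) 1%g by exact: subgroup1 (tgen_closed _).1.
rewrite /index_iota; elim: (iota _ _) => [|j s IH]; rewrite ?big_nil // big_cons.
by exists 1%g => //; exists 1%g => //; rewrite mulg1.
Qed.

Lemma zassenhausXp i x : (0 < i)%N -> Z i x -> Z (p * i)%N (x ^+ p)%g.
Proof. by move=> i0 Zx; apply: zassenhausX; [rewrite muln_gt0 prime_gt0|rewrite ceil_mul]. Qed.

Lemma zassenhausR i j x y : (0 < i)%N -> (0 < j)%N -> Z i x -> Z j y ->
  Z (i + j)%N [~ x, y]%g.
Proof.
move=> i0 j0 Zx Zy; rewrite (zassenhausE E p_pr); last by lia.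
apply: mulset_subr; first by exact: subgroup1 (tgen_closed _).1.
apply: (@sub_big_mulset _ _ (fun k => tgen (commset (Z k) (Z (i + j - k)%N))) i).
- by move=> k; exact: subgroup1 (tgen_closed _).1.
- by rewrite mem_index_iota i0 -[X in (X < _)%N]addn0 ltn_add2l.
- by apply: tgen_sub; exists x => //; exists y => //; rewrite addKn.
Qed.

Lemma zassenhaus_closed i : compact [set: E] -> hausdorff_space E -> closed (Z i).
Proof.
move=> cE hE; elim/ltn_ind: i => i IH; have [i1|i2] := leqP i 1.
  by have -> : Z i = setT; [case: i i1 {IH} => [|[|]]|exact: closedT].
have cT (A : set E) : compact (tgen A).
  exact: (iffLR (compact_closedE _ cE hE) (tgen_closed A).2).
apply: (iffRL (compact_closedE _ cE hE)).
rewrite (zassenhausE E p_pr i2); apply: mulset_compact => //.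
elim/big_ind : _ => //; first exact: compact_set1.
exact: mulset_compact.
Qed.

Hypothesis Ep : pro_p p E.

Lemma zassenhaus_closed_subgroup i : closed_subgroup (Z i).
Proof. by split; [exact: zassenhaus_sub|apply: zassenhaus_closed; case: Ep]. Qed.

Lemma zassenhaus_le i j : (i <= j)%N -> Z j `<=` Z i.
Proof.
have decS n : Z n.+1 `<=` Z n.
  elim/ltn_ind: n => n IH; have [n1|n2] := leqP n 1.
    by have -> : Z n = setT by case: n n1 {IH} => [|[|]].
  have n0 : (0 < n)%N by exact: ltnW.
  have p0 := prime_gt0 p_pr; have sZ := zassenhaus_sub n.
  have cZ := zassenhaus_closed_subgroup n.
  rewrite (zassenhausE E p_pr (leqW n2)) => _ [x Zx [y Zy <-]]; apply: subgroupM => //.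
    apply: tgen_min Zx => // _ [z Zz <-]; apply: zassenhausX => //.
    (* The ceiling of i / p moves by at most one when i does: either the same term is raised to the
       p-th power, or the induction hypothesis applies. *)
    have [<-//|e] := eqVneq ((n.+1 + p).-1 %/ p)%N ((n + p).-1 %/ p)%N.
    apply: IH; first exact: ceil_lt.
    have <- // : ((n.+1 + p).-1 %/ p = ((n + p).-1 %/ p).+1)%N.
    set c := ((n + p).-1 %/ p)%N in e *; set c' := ((n.+1 + p).-1 %/ p)%N in e *.
    have cc' : (c <= c')%N by apply: leq_div2r; rewrite addSn /= leq_pred.
    have c'c : (c' <= c.+1)%N.
      have <- : (((n + p).-1 + p) %/ p = c.+1)%N by rewrite divnDr // divnn p0 addn1.
      by apply: leq_div2r; move: p0; clear; lia.
    by move: e cc' c'c; clear; lia.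
  apply: big_mulset_sub Zy => // k; rewrite mem_index_iota => /andP[k0 kn].
  apply: tgen_min => // _ [a Za [b Zb <-]].
  have [kln|nk] := ltnP k n.
    rewrite -(subnKC (ltnW kln)); apply: zassenhausR; rewrite ?subn_gt0 //.
    have nk1 : (n - k < n)%N by rewrite ltn_subrL k0.
    by apply: (IH _ nk1); rewrite -subSn // ltnW.
  (* The last factor is [Z_n, Z_1], which lies in Z_n by normality. *)
  have kE : k = n by apply/eqP; rewrite eqn_leq nk -ltnS kn.
  rewrite kE in Za; rewrite /commg; apply: subgroupM => //; first exact: subgroupV.
  exact: (zassenhaus_normal n).2.
by move=> /subnK <-; elim: (j - i)%N => // k IH x; rewrite addSn => /decS; exact: IH.
Qed.

Definition lc (f : E -> 'F_p) :=
  exists2 V, open_normal V & forall x v, V v -> f (x * v)%g = f x.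

Lemma lc_dif g f : lc f -> lc (dif g f).
Proof.
move=> [V oV fV]; exists V => // x v Vv; rewrite !difE fV //; congr (_ - _).
by rewrite -mulgA [(v * g)%g]conjgC mulgA fV //; apply: oV.1.2.
Qed.

Lemma lcD f1 f2 : lc f1 -> lc f2 -> lc (f1 + f2).
Proof.
move=> [V oV fV] [W oW fW]; exists (V `&` W); first exact: open_normalI.
by move=> x v [Vv Wv]; rewrite !faddE fV // fW.
Qed.

Lemma lcZ a f : lc f -> lc (a \*o f).
Proof. by move=> [V oV fV]; exists V => // x v Vv; rewrite !fscaleE fV. Qed.

Lemma lcN f : lc f -> lc (- f).
Proof. by move=> [V oV fV]; exists V => // x v Vv; rewrite !foppE fV. Qed.

Lemma open_normalT : open_normal [set: E].
Proof. by split; [split|exact: openT]. Qed.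

Lemma lc_cst (a : 'F_p) : lc (cst a).
Proof. by exists setT; first exact: open_normalT. Qed.

Lemma lc_sum (I : Type) (r : seq I) (P : pred I) (F : I -> E -> 'F_p) :
  (forall k, P k -> lc (F k)) -> lc (\sum_(i <- r | P i) F i).
Proof.
by move=> h; elim/big_ind : _ => //; [exact: (lc_cst 0)|exact: lcD].
Qed.

Lemma lc_rtr g f : lc f -> lc (rtr g f).
Proof. by move=> lf; rewrite rtrE; apply: lcD => //; exact: lc_dif. Qed.

Lemma lc_ltr g f : lc f -> lc (ltr g f).
Proof. by move=> [V oV fV]; exists V => // x v Vv; rewrite /ltr mulgA fV. Qed.

Lemma lc_difl g f : lc f -> lc (difl g f).
Proof.
move=> lf; have -> : difl g f = ltr g f + - f by [].
by apply: lcD; [exact: lc_ltr|exact: lcN].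
Qed.

Definition cpol n f := lc f /\ polf n f.

Lemma cpol_dif n g f : cpol n f -> cpol n.-1 (dif g f).
Proof. by move=> [lf hf]; split; [exact: lc_dif|exact: polf_dif]. Qed.

Lemma cpolD n f1 f2 : cpol n f1 -> cpol n f2 -> cpol n (f1 + f2).
Proof. by move=> [? ?] [? ?]; split; [exact: lcD|exact: polfD]. Qed.

Lemma cpolN n f : cpol n f -> cpol n (- f).
Proof. by move=> [? ?]; split; [exact: lcN|exact: polfN]. Qed.

Lemma cpolZ n a f : cpol n f -> cpol n (a \*o f).
Proof. by move=> [? ?]; split; [exact: lcZ|exact: polfZ]. Qed.

Lemma cpol_rtr n g f : cpol n f -> cpol n (rtr g f).
Proof. by move=> [? ?]; split; [exact: lc_rtr|exact: polf_rtr]. Qed.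

Lemma cpol_ltr n g f : cpol n f -> cpol n (ltr g f).
Proof. by move=> [? ?]; split; [exact: lc_ltr|exact: polf_ltr]. Qed.

Lemma cpol_le n m f : (n <= m)%N -> cpol n f -> cpol m f.
Proof. by move=> nm [? ?]; split=> //; exact: polf_le nm _. Qed.

Lemma cpol0 n : cpol n 0.
Proof. by split; [exact: (lc_cst 0)|exact: polf0]. Qed.

Lemma cpol_cst n a : cpol n.+1 (cst a).
Proof. by split; [exact: lc_cst|exact: polf_cst]. Qed.

Lemma cpol_sum n (I : Type) (r : seq I) (P : pred I) (F : I -> E -> 'F_p) :
  (forall k, P k -> cpol n (F k)) -> cpol n (\sum_(i <- r | P i) F i).
Proof.
by move=> h; elim/big_ind : _ => //; [exact: cpol0|exact: cpolD].
Qed.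

(** The elements of weight at least i as seen by polynomial functions. Applying [zassenhaus_min] to
    this series gives the easy half of the duality. *)
Definition lowers i z := forall n f, cpol n f -> cpol (n - i) (dif z f).

Lemma lowersR i j x y : lowers i x -> lowers j y -> lowers (i + j) [~ x, y]%g.
Proof.
move=> lx ly n f hf.
have -> : dif [~ x, y]%g f = rtr (y * x)^-1%g (dif x (dif y f) - dif y (dif x f)).
  apply/funext => u; rewrite /rtr faddE foppE !difE.
  rewrite /commg /conjg invMg !mulgA !mulgVK; ring.
apply: cpol_rtr; apply: cpolD; last apply: cpolN.
  by rewrite addnC subnDA; apply: lx; exact: ly.
by rewrite subnDA; apply: ly; exact: lx.
Qed.

Lemma lowersX i x : lowers i x -> lowers (p * i) (x ^+ p)%g.
Proof.
move=> lx n f hf; rewrite difXp //.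
suff H k : cpol (n - k * i) (iter k (dif x) f) by exact: H.
elim: k => [|k IH]; first by rewrite mul0n subn0.
by rewrite iterS mulSn addnC subnDA; exact: lx.
Qed.

Lemma lowersV i x : lowers i x -> lowers i x^-1%g.
Proof.
move=> lx n f hf; have -> : dif x^-1%g f = - rtr x^-1%g (dif x f).
  by apply/funext => u; rewrite foppE /rtr !difE mulgVK opprB.
by apply/cpolN/cpol_rtr/lx.
Qed.

Lemma lowersM i x y : lowers i x -> lowers i y -> lowers i (x * y)%g.
Proof.
move=> lx ly n f hf; rewrite difM; apply: cpolD; last exact: ly.
by apply: cpolD; [apply: cpol_le (lx _ _ (ly _ _ hf)); exact: leq_subr|exact: lx].
Qed.

(** Closedness holds because each f is invariant under some open V, so [dif z f] depends only on the
    coset of z. *)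
Lemma lowers_closed_subgroup i : closed_subgroup (lowers i).
Proof.
split.
  split=> [n f hf|x y lx ly]; first by rewrite dif1; exact: cpol0.
  by apply: lowersM => //; exact: lowersV.
move=> z clz n f hf; have [[V [nV oV] fV] _] := hf.
have [w [lw Vw]] : lowers i `&` [set w | V (z^-1 * w)%g] !=set0.
  apply: clz; apply: open_nbhs_nbhs; split; first exact: translate_open.
  by rewrite /= mulVg; exact: subgroup1 nV.1.
have <- : dif w f = dif z f; last exact: lw.
by apply/funext => x; rewrite !difE -(mulKVg z w) mulgA fV.
Qed.

Lemma zassenhaus_lowers i z : (0 < i)%N -> Z i z -> lowers i z.
Proof.
move=> i0; apply: (@zassenhaus_min lowers _ _ _ _ i i0 z) => {i i0 z}.
- move=> i; exact: lowers_closed_subgroup.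
- by apply/seteqP; split=> // x _ n f; rewrite subn1; exact: cpol_dif.
- move=> i x i0 lx n f hf; apply: cpol_le (lowersX lx hf); apply: leq_sub2l.
  have p0 := prime_gt0 p_pr.
  have := ltn_pmod (i + p).-1 p0; have := divn_eq (i + p).-1 p.
  by move: p0 i0; clear; nia.
- by move=> i j x y _ _; exact: lowersR.
Qed.

Definition quotient_map (V : set E) (gT : finGroupType) (pi : E -> gT) :=
  [/\ {morph pi : x y / (x * y)%g}, forall x, pi x = 1%g <-> V x,
      forall t, exists x, pi x = t & p.-nat #|gT|].

Section QuotientMap.
Variables (V : set E) (gT : finGroupType) (pi : E -> gT).
Hypothesis piV : quotient_map V pi.

Lemma quotient_map1 : pi 1%g = 1%g.
Proof. by case: piV => piM _ _ _; apply: (mulgI (pi 1%g)); rewrite -piM !mulg1. Qed.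

Lemma quotient_mapV y : pi y^-1%g = (pi y)^-1%g.
Proof.
case: piV => piM _ _ _; apply/eqP.
by rewrite eq_sym eq_invg_mul -piM mulgV quotient_map1.
Qed.

Lemma quotient_mapR a b : pi [~ a, b]%g = [~ pi a, pi b]%g.
Proof. by case: piV => piM _ _ _; rewrite /commg /conjg !(piM, quotient_mapV). Qed.

Lemma quotient_mapX a k : pi (a ^+ k)%g = (pi a ^+ k)%g.
Proof.
case: piV => piM _ _ _.
by elim: k => [|k IH]; rewrite ?expg0 ?quotient_map1 // !expgS piM IH.
Qed.

Lemma quotient_mapE x y : pi x = pi y <-> V (x^-1 * y)%g.
Proof.
case: (piV) => piM pi1 _ _; rewrite -pi1 piM quotient_mapV; split=> [->|]; first exact: mulVg.
by move/eqP; rewrite -eq_mulVg1 => /eqP.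
Qed.

Lemma fimage_group_set (H : set E) : is_subgroup H -> group_set (fimage pi H).
Proof.
case: (piV) => piM _ _ _ sH; apply/group_setP; split.
  by apply/fimageP; exists 1%g; [exact: subgroup1|exact: quotient_map1].
move=> _ _ /fimageP[a Za <-] /fimageP[b Zb <-]; apply/fimageP.
by exists (a * b)%g => //; exact: subgroupM.
Qed.

Definition quotient_zeta i : {group gT} := Group (fimage_group_set (zassenhaus_sub i)).

Lemma quotient_zeta_dec i j : (i <= j)%N -> quotient_zeta j \subset quotient_zeta i.
Proof. by move=> ij; apply: fimageS; exact: zassenhaus_le. Qed.

Lemma quotient_zetaR i j s t : (0 < i)%N -> (0 < j)%N ->
  s \in quotient_zeta i -> t \in quotient_zeta j -> [~ s, t]%g \in quotient_zeta (i + j).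
Proof.
move=> i0 j0 /fimageP[a Za <-] /fimageP[b Zb <-]; apply/fimageP.
by exists [~ a, b]%g; [exact: zassenhausR|rewrite quotient_mapR].
Qed.

Lemma quotient_zetaX i t : (0 < i)%N -> t \in quotient_zeta i ->
  (t ^+ p)%g \in quotient_zeta (p * i).
Proof.
move=> i0 /fimageP[a Za <-]; apply/fimageP.
by exists (a ^+ p)%g; [exact: zassenhausXp|rewrite quotient_mapX].
Qed.

Lemma quotient_zeta_top t : t \in quotient_zeta 1.
Proof. by case: (piV) => _ _ piS _; have [a <-] := piS t; exact: mem_fimage. Qed.

Lemma quotient_zeta_bot n t : Z n `<=` V -> t \in quotient_zeta n -> t = 1%g.
Proof. by case: (piV) => _ pi1 _ _ ZV /fimageP[a /ZV Va <-]; apply/pi1. Qed.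

Lemma dif_quotient g (h : gT -> 'F_p) : dif g (h \o pi) = dif (pi g) h \o pi.
Proof. by case: (piV) => piM _ _ _; apply/funext => y /=; rewrite !difE /= piM. Qed.

End QuotientMap.

Lemma finite_quotient_map V : open_normal V ->
  exists (gT : finGroupType) (pi : E -> gT), quotient_map V pi.
Proof. by move=> /(finite_quotient p_pr Ep)[gT [pi ?]]; exists gT, pi. Qed.

(** The hard half of the duality. As Z_n is closed, some open normal V contains it and misses x; in
    the finite quotient by V the image of Z_n is trivial, and [jennings_finite] applies. *)
Lemma zassenhaus_sep n x : (0 < n)%N -> ~ Z n x -> exists2 f, cpol n f & f x <> f 1%g.
Proof.
move=> n0 nZx; have [sZ cZ] := zassenhaus_closed_subgroup n.
have [V0 [nV0 oV0] V0P] := closed_sep Ep cZ nZx.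
pose V := mulset (Z n) V0.
have V01 := subgroup1 nV0.1; have Z1 := subgroup1 sZ.
have nV : normal_subgroup V by apply: mulset_normal => //; exact: zassenhaus_normal.
have oV : open V by apply: (supergroup_open nV.1 oV0 nV0.1); exact: mulset_subr.
have nVx : ~ V x.
  move=> [z Zz [v Vv zvx]]; apply: (V0P v^-1%g); first exact: subgroupV nV0.1 Vv.
  by rewrite -zvx mulgK.
have [gT [pi piV]] := finite_quotient_map (conj nV oV).
have [piM pi1 piS pG] := piV.
have [|h hn hx] := @jennings_finite p gT (quotient_zeta piV) n p_pr
  (@quotient_zeta_dec _ _ _ piV) (@quotient_zetaR _ _ _ piV)
  (@quotient_zetaX _ _ _ piV) (@quotient_zeta_top _ _ _ piV)
  (fun t => @quotient_zeta_bot _ _ _ piV n t (@mulset_subl _ _ _ V01)) pG (pi x).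
  by move=> /pi1.
exists (h \o pi); last by rewrite /= (quotient_map1 piV).
split.
  by exists V => // y v Vv /=; rewrite piM (iffRL (pi1 v) Vv) mulg1.
elim: n h hn {hx n0 nZx sZ cZ V0P V Z1 nV oV nVx piV pi1} (dif_quotient piV) => [|k IH] h hn hd.
  by apply/funext => y /=; rewrite hn.
by move=> g; rewrite hd; apply: IH.
Qed.

Lemma zassenhausP n x : (0 < n)%N ->
  Z n x <-> forall f, cpol n f -> f x = f 1%g.
Proof.
move=> n0; split=> [Zx f hf|fx].
  have [_] := zassenhaus_lowers n0 Zx hf; rewrite subnn => /(congr1 (@^~ 1%g)).
  by rewrite difE mul1g => /eqP; rewrite subr_eq0 => /eqP.
by apply: contrapT => /(zassenhaus_sep n0)[f /fx].
Qed.

End ZassenhausBasics.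

(** * Linear algebra in function spaces *)

Section Families.
Variables (F : fieldType) (T : Type).
Implicit Types (s t : seq (T -> F)) (f g : T -> F) (a : nat -> F) (S : set (T -> F)).

Definition fnth s i : T -> F := nth (fun=> 0) s i.

(** Coefficients are indexed by all naturals, so that families of different sizes can be
    concatenated without casts; those from [size s] on are ignored. *)
Definition lin s a : T -> F := fun x => \sum_(i < size s) a i * fnth s i x.

Definition indep s := forall a, lin s a = (fun=> 0) -> forall i, (i < size s)%N -> a i = 0.

Definition linear_set S :=
  S (fun=> 0) /\ forall (c : F) f g, S f -> S g -> S (fun x => c * f x + g x).

Definition family_in s S := forall i, (i < size s)%N -> S (fnth s i).

Lemma lin_rcons s f a x : lin (rcons s f) a x = lin s a x + a (size s) * f x.
Proof.
rewrite /lin size_rcons big_ord_recr /=; congr (_ + _); last by rewrite /fnth nth_rcons ltnn eqxx.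
by apply: eq_bigr => i _; rewrite /fnth nth_rcons ltn_ord.
Qed.

Lemma lin_eq s a b : (forall i, (i < size s)%N -> a i = b i) -> lin s a = lin s b.
Proof. by move=> ab; apply/funext => x; apply: eq_bigr => i _; rewrite ab. Qed.

Lemma family_in_rcons s f S : family_in (rcons s f) S <-> family_in s S /\ S f.
Proof.
split=> [h|[hs hf] i].
  split=> [i si|].
    by have := h i; rewrite size_rcons /fnth nth_rcons si; apply; exact: ltnW.
  by have := h (size s); rewrite size_rcons /fnth nth_rcons ltnn eqxx; exact.
rewrite size_rcons ltnS leq_eqVlt /fnth nth_rcons => /predU1P[->|si].
  by rewrite ltnn eqxx.
by rewrite si; exact: hs.
Qed.

Lemma lin_in s a S : linear_set S -> family_in s S -> S (lin s a).
Proof.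
move=> [S0 SL]; elim/last_ind: s => [|s f IH] hs.
  by have -> : lin [::] a = (fun=> 0) by apply/funext => x; rewrite /lin big_ord0.
have [/IH h hf] := (iffLR (family_in_rcons s f S)) hs.
have -> : lin (rcons s f) a = (fun x => a (size s) * f x + lin s a x).
  by apply/funext => x; rewrite lin_rcons addrC.
exact: SL.
Qed.

Lemma indep_rcons s f : indep s -> (forall a, f <> lin s a) -> indep (rcons s f).
Proof.
move=> si nf a la; have an : a (size s) = 0.
  apply: contrapT => /eqP an; apply: (nf (fun i => - (a (size s))^-1 * a i)).
  apply/funext => x; have := congr1 (@^~ x) la; rewrite lin_rcons /= => /eqP.
  rewrite addrC addr_eq0 => /eqP/(congr1 ( *%R (a (size s))^-1)).
  rewrite mulKf // => ->; rewrite /lin mulrN -mulNr mulr_sumr.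
  by apply: eq_bigr => i _; rewrite mulrA.
move=> i; rewrite size_rcons ltnS leq_eqVlt => /predU1P[-> //|].
apply: si; apply/funext => x; have := congr1 (@^~ x) la.
by rewrite lin_rcons an mul0r addr0.
Qed.

Lemma extend_indep S s m : linear_set S -> family_in s S -> indep s ->
  (forall t, family_in t S -> indep t -> (size t <= m)%N) ->
  exists t, [/\ family_in (s ++ t) S, indep (s ++ t) &
    forall f, S f -> exists a, f = lin (s ++ t) a].
Proof.
move=> lS + + bd; have [k] := ubnP (m - size s); elim: k s => // k IH s mk sS si.
have [sp|nsp] := pselect (forall f, S f -> exists a, f = lin s a).
  by exists [::]; rewrite cats0.
move/existsNP: nsp => [f /not_implyP[Sf nf]].
have si' : indep (rcons s f) by apply: indep_rcons => // a fa; apply: nf; exists a.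
have sS' : family_in (rcons s f) S by apply/family_in_rcons.
have := bd _ sS' si'; rewrite size_rcons => sm.
have [|t [h1 h2 h3]] := IH (rcons s f) _ sS' si'.
  by rewrite size_rcons; move: mk sm; clear; lia.
by exists (f :: t); rewrite -cat_rcons.
Qed.

(** If s were longer than m, the matrix A would have a nonzero left kernel, hence a nontrivial
    vanishing combination. Typically A i k is the k-th of m linear functionals at the i-th
    member. *)
Lemma indep_bound s m (A : nat -> nat -> F) : indep s ->
  (forall a, (forall k, (k < m)%N -> \sum_(i < size s) a i * A i k = 0) ->
    lin s a = (fun=> 0)) -> (size s <= m)%N.
Proof.
move=> si h; rewrite leqNgt; apply/negP => ms.
pose M := \matrix_(i < size s, k < m) A i k.
have : kermx M != 0.
  rewrite kermx_eq0 /row_free neq_ltn; apply/orP; left.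
  by apply: leq_ltn_trans ms; exact: rank_leq_col.
move=> /rowV0Pn[v /sub_kermxP vM v0].
pose a i := if insub i is Some j then v 0 j else 0.
have aE (i : 'I_(size s)) : a i = v 0 i by rewrite /a valK.
apply/negP: v0; rewrite negbK; apply/eqP/rowP => i; rewrite mxE -aE.
apply: (si a) => //; apply: h => k km.
have := congr1 (fun B : 'rV_m => B 0 (Ordinal km)) vM; rewrite !mxE => vk0.
by rewrite -[RHS]vk0; apply: eq_bigr => j _; rewrite aE mxE.
Qed.

Lemma indep_nil : indep [::]. Proof. by []. Qed.

End Families.

(** * Dimension counts *)

Section Words.
Variables (p : nat) (E : groupType).
Implicit Types (f : E -> 'F_p) (v : seq E).

Definition difw v f := foldl (fun f x => dif x f) f v.

Lemma difw_sum v (I : Type) (r : seq I) (a : I -> 'F_p) (F : I -> E -> 'F_p) x :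
  difw v (\sum_(i <- r) a i \*o F i) x = \sum_(i <- r) a i * difw v (F i) x.
Proof.
elim: v F => [|y v IH] F /=.
  elim: r => [|i r IHr]; first by rewrite !big_nil.
  by rewrite !big_cons faddE fscaleE IHr.
rewrite dif_sum -IH; congr (difw v _ x).
by apply: eq_bigr => i _; exact: difZ.
Qed.

End Words.

Section Generation.
Variable G : topGroupType.
Implicit Types (A H : set G).

Definition gen A : set G := smallest (@is_subgroup G) A.

Lemma gen_subgroup A : is_subgroup (gen A).
Proof.
split; first by move=> H [sH _]; exact: subgroup1.
by move=> x y Hx Hy H [sH AH]; apply: (sH.2); [exact: Hx|exact: Hy].
Qed.

Lemma gen_sub A : A `<=` gen A. Proof. by move=> x Ax H [_]; exact. Qed.

Lemma gen_min A H : is_subgroup H -> A `<=` H -> gen A `<=` H.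
Proof. by move=> cH AH x; apply. Qed.

End Generation.

Section Counting.
Variables (p : nat) (E : topGroupType).
Hypotheses (p_pr : prime p) (Ep : pro_p p E).
Notation Z := (zassenhaus p E).
Notation cpol := (@cpol p E).
Implicit Types (M K : set E) (f g : E -> 'F_p) (v : seq E) (ws : seq (seq E)).

(* On M, a polynomial of degree less than n is determined by its iterated
   differences at 1 along the words ws. *)
Definition det n M ws := forall f, cpol n f ->
  (forall v, v \in ws -> difw v f 1%g = 0) -> forall x, M x -> f x = 0.

(** Extension by zero keeps functions on M in the type [E -> 'F_p], where the families live. *)
Definition restr M f : E -> 'F_p := fun x => if `[< M x >] then f x else 0.

Definition polset n M : set (E -> 'F_p) := [set restr M f | f in cpol n].

Lemma restrE M f x : M x -> restr M f x = f x.
Proof. by move=> Mx; rewrite /restr asboolT. Qed.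

Lemma polset_linear n M : linear_set (polset n M).
Proof.
split.
  exists 0; first exact: cpol0.
  by apply/funext => x; rewrite /restr; case: ifP.
move=> a _ _ [f hf <-] [g hg <-]; exists (a \*o f + g).
  by apply: cpolD => //; exact: cpolZ.
by apply/funext => x; rewrite /restr; case: ifP => _; rewrite ?mulr0 ?addr0.
Qed.

Lemma det_bound n M ws s : det n M ws -> family_in s (polset n M) -> indep s ->
  (size s <= size ws)%N.
Proof.
move=> dM sS si.
have [g gP] : exists g : nat -> E -> 'F_p, forall i, (i < size s)%N ->
    cpol n (g i) /\ restr M (g i) = fnth s i.
  have H i : exists g, (i < size s)%N -> cpol n g /\ restr M g = fnth s i.
    have [/sS[g hg gs]|_] := ltnP i (size s); first by exists g.
    by exists 0.
  by have [g gP] := choice H; exists g.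
apply: (indep_bound (A := fun i k => difw (nth [::] ws k) (g i) 1%g) si) => a aP.
pose f := \sum_(i < size s) a i \*o g i.
have hf : cpol n f.
  by apply: cpol_sum => i _; apply: cpolZ; have [] := gP i (ltn_ord i).
have fE x : f x = \sum_(i < size s) a i * g i x.
  by rewrite /f -[LHS]/(difw [::] _ x) difw_sum.
apply/funext => x; rewrite /lin.
have [Mx|nMx] := pselect (M x); last first.
  apply: big1 => i _; have [_ <-] := gP i (ltn_ord i).
  by rewrite /restr asboolF // mulr0.
rewrite -[RHS](dM f hf _ x Mx).
  by rewrite fE; apply: eq_bigr => i _; have [_ <-] := gP i (ltn_ord i); rewrite restrE.
by move=> v vws; rewrite /f difw_sum -(nth_index [::] vws); apply: aP; rewrite index_mem.
Qed.

Lemma polset_basis n M ws : det n M ws -> exists s,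
  [/\ (size s <= size ws)%N, family_in s (polset n M), indep s &
    forall f, polset n M f -> exists a, f = lin s a].
Proof.
move=> dM; have [//|t [h1 h2 h3]] := extend_indep (m := size ws) (polset_linear n M) _
  (@indep_nil _ E) (fun t => @det_bound n M ws t dM).
by exists t; split=> //; exact: det_bound dM h1 h2.
Qed.

(** After a translation by an element of K, two classes of K modulo Z_n are told apart by a
    polynomial restricted to K. These restrictions form a space of dimension at most [size ws], so a
    class is determined by that many values in F_p. *)
Lemma card_fimage_det n K ws (gT : finType) (pi : E -> gT) : (0 < n)%N ->
  (forall x y, Z n (x^-1 * y)%g -> pi x = pi y) -> det n K ws ->
  (#|fimage pi K| <= p ^ size ws)%N.
Proof.
move=> n0 piZ dK; have [s [sws sS _ sp]] := polset_basis dK.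
apply: (@leq_trans (p ^ size s)); last by rewrite leq_exp2l // prime_gt1.
have [k kP] : exists k : gT -> E, forall t, t \in fimage pi K -> K (k t) /\ pi (k t) = t.
  have H t : exists k, t \in fimage pi K -> K k /\ pi k = t.
    have [/fimageP[x Kx xt]|] := boolP (t \in fimage pi K); first by exists x.
    by exists 1%g.
  by have [k kP] := choice H; exists k.
pose h t := [ffun i : 'I_(size s) => fnth s i (k t)].
have -> : (p ^ size s)%N = #|{ffun 'I_(size s) -> 'F_p}|.
  by rewrite card_ffun card_Fp // card_ord.
rewrite -(@card_in_imset _ _ h); first exact: max_card.
move=> t u tK uK htu; have [Kt <-] := kP t tK; have [Ku <-] := kP u uK.
apply: piZ; apply/(zassenhausP p_pr Ep _ n0) => f hf.
pose f' := ltr (k t)^-1%g f.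
have [a fa] := sp (restr K f') (ex_intro2 _ _ f' (cpol_ltr _ hf) erefl).
have f'E x : K x -> f' x = lin s a x by move=> Kx; rewrite -fa restrE.
rewrite -[LHS]/(f' (k u)) -(mulVg (k t)) -[RHS]/(f' (k t)) !f'E //.
apply: eq_bigr => i _; congr (_ * _).
by have := congr1 (fun g : {ffun _} => g i) htu; rewrite !ffunE.
Qed.

Definition generators (X : nat -> seq E) : set E := [set x | exists w, x \in X w].

Definition weighted (X : nat -> seq E) :=
  forall w x, x \in X w -> (0 < w)%N /\ Z w x.

(** The words in X of total weight less than i; k is fuel for the recursion through i - w. *)
Fixpoint words_rec (X : nat -> seq E) (k i : nat) : seq (seq E) :=
  if k is m.+1 then
    if i is 0 then [::] else [::] ::
      flatten [seq [seq x :: v | x <- X w, v <- words_rec X m (i - w)] | w <- index_iota 1 i]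
  else [::].

Definition words X i := words_rec X i i.

Lemma words_recE X k m i : (i <= k)%N -> (i <= m)%N -> words_rec X k i = words_rec X m i.
Proof.
elim: k m i => [|k IH] [|m] [|i] //=.
rewrite !ltnS => ik im; congr (_ :: flatten _); apply/eq_in_map => w.
rewrite mem_index_iota => /andP[w0 wi]; congr (flatten _); apply/eq_in_map => x _.
by rewrite (IH m) //; move: wi ik im w0; clear; lia.
Qed.

Lemma wordsE X i : (0 < i)%N -> words X i = [::] ::
  flatten [seq [seq x :: v | x <- X w, v <- words X (i - w)] | w <- index_iota 1 i].
Proof.
case: i => // i _; rewrite /words /=; congr (_ :: flatten _); apply/eq_in_map => w.
rewrite mem_index_iota => /andP[w0 wi]; congr (flatten _); apply/eq_in_map => x _.
by rewrite (@words_recE _ i (i.+1 - w)) //; move: w0 wi; clear; lia.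
Qed.

(** A difference along a generator of weight w lowers the degree by w, so by induction it vanishes
    on the subgroup. Then f is constant there, with value f(1), which the empty word kills. *)
Lemma det_words X i : weighted X -> det i (gen (generators X)) (words X i).
Proof.
move=> wX; elim/ltn_ind: i => i IH f hf f0; have sG := gen_subgroup (generators X).
have [i0|i0] := posnP i; first by move: hf; rewrite i0 => -[_ /= ->].
have d0 w x : x \in X w -> forall k, gen (generators X) k -> dif x f k = 0.
  move=> xX; have [w0 Zx] := wX w x xX.
  have hd := zassenhaus_lowers p_pr w0 Zx hf.
  apply: (IH (i - w)%N) => //; first by rewrite ltn_subrL w0.
  move=> v vw; rewrite -[LHS]/(difw (x :: v) f 1%g); apply: f0.
  rewrite wordsE // inE; apply/orP; right; apply/flattenP.
  exists [seq y :: u | y <- X w, u <- words X (i - w)].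
    apply/mapP; exists w => //; rewrite mem_index_iota w0 ltnNge; apply/negP => iw.
    by move: vw; rewrite (eqP (iw : i - w == 0)%N).
  by apply/allpairsP; exists (x, v).
pose H : set E := [set k | gen (generators X) k /\
  forall h, gen (generators X) h -> f (h * k)%g = f h].
have sH : is_subgroup H.
  split; first by split=> [|h _]; [exact: subgroup1 sG|rewrite mulg1].
  move=> x y [Gx Hx] [Gy Hy]; split=> [|h Gh]; first exact: sG.2.
  rewrite mulgA -(Hy (h * x * y^-1)%g) ?mulgVK ?Hx //.
  by apply: (sG.2) Gy; exact: subgroupM sG Gh Gx.
have GH : gen (generators X) `<=` H.
  apply: gen_min => // x [w xX]; split; first by apply: gen_sub; exists w.
  by move=> h Gh; have := d0 w x xX h Gh; rewrite difE => /eqP; rewrite subr_eq0 => /eqP.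
move=> x /GH[_ /(_ 1%g (subgroup1 sG))]; rewrite mul1g => ->.
by apply: (f0 [::]); rewrite wordsE // inE eqxx.
Qed.

Lemma lc_family m (g : nat -> E -> 'F_p) : (forall i, (i < m)%N -> lc (g i)) ->
  exists2 V, open_normal V & forall i x u, (i < m)%N -> V u -> g i (x * u)%g = g i x.
Proof.
elim: m => [|m IH] h; first by exists setT => //; exact: open_normalT.
have [V oV VP] := IH (fun i im => h i (ltnW im)).
have [W oW WP] := h m (ltnSn m).
exists (V `&` W); first exact: open_normalI.
move=> i x v; rewrite ltnS leq_eqVlt => /predU1P[->|im] [Vv Wv]; first exact: WP.
exact: VP.
Qed.

(** A locally constant function does not see the difference between the abstract subgroup generated
    by A and its closure. *)
Lemma tgen_lc (A : set E) f : tgen A = setT -> lc f ->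
  (forall x, gen A x -> f x = 0) -> f = 0.
Proof.
move=> gA [V [nV oV] fV] f0; have sG := gen_subgroup A.
have sGV : is_subgroup (mulset (gen A) V) by exact: mulset_subgroup.
have oGV : open (mulset (gen A) V).
  by apply: (supergroup_open sGV oV nV.1); apply: mulset_subr; exact: subgroup1.
apply/funext => x; have : tgen A x by rewrite gA.
move=> /(@tgen_min E A (mulset (gen A) V)) -[|y Ay|k Gk [v Vv <-]].
- by split=> //; exact: open_subgroup_closed.
- by apply: mulset_subl; [exact: subgroup1 nV.1|exact: gen_sub].
- by rewrite fV // f0.
Qed.

Definition weight1 (s : seq E) w := if w == 1%N then s else [::].

Lemma weighted1 s : weighted (weight1 s).
Proof. by move=> w x; rewrite /weight1; case: eqP => // ->. Qed.

Lemma generators1 s : generators (weight1 s) = [set` s].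
Proof.
apply/seteqP; split=> x; last by exists 1%N.
by move=> [w]; rewrite /weight1; case: eqP.
Qed.

Hypothesis Efg : finitely_generated E.

Lemma det_full n : exists ws, det n setT ws.
Proof.
have [s gs] := Efg; exists (words (weight1 s) n) => f hf f0 x _.
rewrite (tgen_lc gs hf.1) // => y; rewrite -generators1 => Gy.
exact: (@det_words _ n (@weighted1 s) f hf f0 y Gy).
Qed.

Lemma restrT f : restr setT f = f.
Proof. by apply/funext => x; rewrite restrE. Qed.

(** By [zassenhausP], Z_n contains any subgroup under which all members of a finite basis of the
    polynomials of degree less than n are invariant. *)
Lemma zassenhaus_open n : open (Z n).
Proof.
have [->|n0] := posnP n; first exact: openT.
have [ws dws] := det_full n; have [s [_ sS _ sp]] := polset_basis dws.
have [|V [nV oV] VP] := @lc_family (size s) (fnth s).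
  by move=> i /sS[f [lf _] <-]; rewrite restrT.
apply: (supergroup_open _ oV nV.1) => [|v Vv]; first exact: zassenhaus_sub.
apply/(zassenhausP p_pr Ep _ n0) => f hf.
have [a] := sp f (ex_intro2 _ _ f hf (restrT f)) => ->.
by apply: eq_bigr => i _; congr (_ * _); rewrite -{1}(mul1g v) VP.
Qed.

Lemma zassenhaus_open_normal n : open_normal (Z n).
Proof. by split; [exact: zassenhaus_normal|exact: zassenhaus_open]. Qed.

End Counting.

(** * The Golod-Shafarevich inequality *)

Section MoreFamilies.
Variables (F : fieldType) (T : Type).
Implicit Types (s t u : seq (T -> F)) (f g : T -> F) (S : set (T -> F)).

Lemma lin_cat s t (a : nat -> F) x :
  lin (s ++ t) a x = lin s a x + lin t (fun i => a (size s + i)%N) x.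
Proof.
rewrite /lin size_cat big_split_ord /=; congr (_ + _); apply: eq_bigr => i _.
  by rewrite /fnth nth_cat ltn_ord.
by rewrite /fnth nth_cat ltnNge leq_addr /= addKn.
Qed.

Lemma indep_cat s t : indep t ->
  (forall a, lin (s ++ t) a = (fun=> 0) -> forall i, (i < size s)%N -> a i = 0) ->
  indep (s ++ t).
Proof.
move=> ti h a la i; rewrite size_cat => ist.
have [/(h a la) //|si] := ltnP i (size s).
rewrite -(subnKC si); apply: (ti (fun i => a (size s + i)%N)); last first.
  by move: ist si; clear; lia.
apply/funext => x; have := congr1 (@^~ x) la; rewrite lin_cat => <-.
rewrite [X in _ = X + _](_ : _ = 0) ?add0r //.
by apply: big1 => j _; rewrite (h a la) ?mul0r.
Qed.

Lemma indepl s t : indep (s ++ t) -> indep s.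
Proof.
move=> sti a la i si; pose b i := if (i < size s)%N then a i else 0.
have <- : b i = a i by rewrite /b si.
apply: sti; last by rewrite size_cat ltn_addr.
apply/funext => x; rewrite lin_cat.
have -> : lin s b = lin s a by apply: lin_eq => j sj; rewrite /b sj.
rewrite la add0r; apply: big1 => j _.
by rewrite /b ltnNge leq_addr /= mul0r.
Qed.

Lemma span_bound s u : indep s ->
  (forall i, (i < size s)%N -> exists a, fnth s i = lin u a) -> (size s <= size u)%N.
Proof.
move=> si sp.
have [A AP] : exists A : nat -> nat -> F, forall i, (i < size s)%N -> fnth s i = lin u (A i).
  have H i : exists a, (i < size s)%N -> fnth s i = lin u a.
    have [/sp[a sa]|_] := ltnP i (size s); first by exists a.
    by exists (fun=> 0).
  by have [A AP] := choice H; exists A.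
apply: (indep_bound (A := A) si) => a aA; apply/funext => x.
rewrite /lin; under eq_bigr => i _ do rewrite AP // /lin mulr_sumr.
rewrite exchange_big big1 //= => k _.
under eq_bigr => i _ do rewrite mulrA.
by rewrite -mulr_suml aA // mul0r.
Qed.

Lemma lin_linear s : linear_set [set f | exists a, f = lin s a].
Proof.
split.
  by exists (fun=> 0); apply/funext => x; rewrite /lin big1 // => i _; rewrite mul0r.
move=> c _ _ [a ->] [b ->]; exists (fun i => c * a i + b i); apply/funext => x.
rewrite /lin mulr_sumr -big_split; apply: eq_bigr => i _ /=.
by rewrite mulrDl mulrA.
Qed.

Lemma fnth_lin s i : (i < size s)%N -> exists a, fnth s i = lin s a.
Proof.
move=> si; exists (fun j => (j == i)%:R); apply/funext => x.
rewrite /lin (bigD1 (Ordinal si)) //= eqxx mul1r big1 ?addr0 // => j ji.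
by rewrite (_ : (j == i :> nat) = false) ?mul0r //; apply: negbTE.
Qed.

Lemma kernel_family S s (theta : (T -> F) -> F) : linear_set S ->
  (forall c f g, S f -> S g -> theta (fun x => c * f x + g x) = c * theta f + theta g) ->
  family_in s S -> indep s ->
  exists t, [/\ family_in t [set f | S f /\ theta f = 0], indep t & (size s <= (size t).+1)%N].
Proof.
move=> lS thL sS si.
pose W := [set f | (exists a, f = lin s a) /\ theta f = 0].
have sW a : S (lin s a) by exact: lin_in.
have th0 : theta (fun=> 0) = 0.
  have := thL (-1) _ _ lS.1 lS.1.
  rewrite (_ : (fun x => _) = (fun=> 0) :> (T -> F)); last first.
    by apply/funext => x; rewrite mulr0 addr0.
  by rewrite mulN1r addNr.
have lW : linear_set W.
  split; first by split; [exact: (lin_linear s).1|].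
  move=> c f g [fs f0] [gs g0]; split; first exact: (lin_linear s).2.
  by case: fs gs f0 g0 => a -> [b ->] f0 g0; rewrite thL // f0 g0 mulr0 addr0.
have bW t : family_in t W -> indep t -> (size t <= size s)%N.
  by move=> tW ti; apply: span_bound => // i /tW[].
have [//|t [tW ti tsp]] := extend_indep lW _ (@indep_nil F T) bW.
exists t; split=> // [i /tW[[a ->]]//|].
have [al0|] := pselect (forall i, (i < size s)%N -> theta (fnth s i) = 0).
  by apply/leqW/span_bound => // i si'; apply: tsp; split; [exact: fnth_lin|exact: al0].
move=> /existsNP[i0 /not_implyP[si0 th1]].
rewrite -(size_rcons t (fnth s i0)); apply: span_bound => // i si'.
pose c := - (theta (fnth s i) / theta (fnth s i0)).
have [a fa] : exists a, (fun x => c * fnth s i0 x + fnth s i x) = lin t a.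
  apply: tsp; split; first by apply: (lin_linear s).2; exact: fnth_lin.
  rewrite thL; [|exact: sS|exact: sS].
  by rewrite mulNr mulfVK ?addNr //; apply/eqP.
exists (fun j => if (j < size t)%N then a j else - c); apply/funext => x.
rewrite lin_rcons ltnn (@lin_eq _ _ t _ a) => [|j ->//].
by rewrite -fa /= (mulNr c) addrAC subrr add0r.
Qed.

End MoreFamilies.

Section Cohomology2.
Variables (p : nat) (E : topGroupType).
Hypotheses (p_pr : prime p) (Ep : pro_p p E).
Implicit Types (c d : E -> E -> 'F_p) (g h x y z : E).

Definition hom1 (chi : E -> 'F_p) := lc chi /\ forall x y, chi (x * y)%g = chi x + chi y.

Definition lc2 c := exists2 V : set E, open_normal V &
  forall x y v w, V v -> V w -> c (x * v)%g (y * w)%g = c x y.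

Definition cocycle2 c := lc2 c /\
  forall x y z, c y z - c (x * y)%g z + c x (y * z)%g - c x y = 0.

Definition trivial2 c := exists2 h : E -> 'F_p, lc h &
  forall x y, c x y = h x + h y - h (x * y)%g.

Definition class_map (cl : (E -> E -> 'F_p) -> 'F_p) :=
  (forall c d, cocycle2 c -> cocycle2 d ->
    cl (fun x y => c x y + d x y) = cl c + cl d) /\
  forall c, cocycle2 c -> (cl c = 0 <-> trivial2 c).

Lemma cocycle2D c d : cocycle2 c -> cocycle2 d -> cocycle2 (fun x y => c x y + d x y).
Proof.
move=> [[V oV cV] hc] [[W oW dW] hd]; split.
  exists (V `&` W); first exact: open_normalI.
  by move=> x y v w [Vv Wv] [Vw Ww]; rewrite cV // dW.
by move=> x y z; rewrite -[RHS](addr0 0) -{1}(hc x y z) -(hd x y z); ring.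
Qed.

Lemma cocycle2Z (a : 'F_p) c : cocycle2 c -> cocycle2 (fun x y => a * c x y).
Proof.
move=> [[V oV cV] hc]; split; first by exists V => // x y v w Vv Vw; rewrite cV.
by move=> x y z; rewrite -(mulr0 a) -(hc x y z); ring.
Qed.

Lemma cocycle20 : cocycle2 (fun _ _ => 0).
Proof.
split; first by exists setT; [exact: open_normalT|].
by move=> x y z; rewrite !subr0 addr0.
Qed.

Variable cl : (E -> E -> 'F_p) -> 'F_p.
Hypothesis clP : class_map cl.

Lemma class_map0 : cl (fun _ _ => 0) = 0.
Proof.
apply/(clP.2 _ cocycle20); exists (fun=> 0); first exact: lc_cst.
by move=> x y; rewrite subr0 addr0.
Qed.

Lemma class_mapZ a c : cocycle2 c -> cl (fun x y => a * c x y) = a * cl c.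
Proof.
move=> hc; rewrite -(natr_Zp a); elim: (a : nat) => [|n IH].
  rewrite mul0r -class_map0; congr cl; apply/funext => x; apply/funext => y.
  by rewrite mul0r.
have -> : (fun x y => n.+1%:R * c x y) = (fun x y => c x y + n%:R * c x y).
  by apply/funext => x; apply/funext => y; rewrite mulrS mulrDl mul1r.
by rewrite clP.1 ?IH ?mulrS ?mulrDl ?mul1r //; exact: cocycle2Z.
Qed.

Lemma class_map_sum n (F : nat -> E -> E -> 'F_p) : (forall i, cocycle2 (F i)) ->
  cl (fun x y => \sum_(i < n) F i x y) = \sum_(i < n) cl (F i) /\
  cocycle2 (fun x y => \sum_(i < n) F i x y).
Proof.
move=> hF; elim: n => [|n [IH1 IH2]].
  rewrite big_ord0 -[X in _ = X /\ _]class_map0.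
  have -> : (fun x y => \sum_(i < 0) F i x y) = (fun _ _ => 0).
    by apply/funext => x; apply/funext => y; rewrite big_ord0.
  by split=> //; exact: cocycle20.
have -> : (fun x y => \sum_(i < n.+1) F i x y) =
    (fun x y => \sum_(i < n) F i x y + F n x y).
  by apply/funext => x; apply/funext => y; rewrite big_ord_recr.
by split; [rewrite clP.1 // IH1 big_ord_recr|exact: cocycle2D].
Qed.

End Cohomology2.

Section GolodShafarevich.
Variables (p : nat) (E : topGroupType).
Hypotheses (p_pr : prime p) (Ep : pro_p p E) (Efg : finitely_generated E).
Notation cpol := (@cpol p E).
Implicit Types (s t u : seq (E -> 'F_p)) (g h x y z : E).

(** The last clause says that E acts on this basis by unitriangular matrices. *)
Definition adapted_basis n s := [/\ family_in s (cpol n), indep s,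
  forall f, cpol n f -> exists a, f = lin s a &
  forall l g, (l < size s)%N -> exists a, dif g (fnth s l) = lin (take l s) a].

Lemma cpol_linear n : linear_set (cpol n).
Proof.
split; first exact: cpol0.
by move=> c f g hf hg; apply: (@cpolD _ _ _ (c \*o f) g) => //; exact: cpolZ.
Qed.

Lemma lin_take l s (a : nat -> 'F_p) : (l <= size s)%N ->
  lin (take l s) a = lin s (fun i => if (i < l)%N then a i else 0).
Proof.
move=> ls; apply/funext => x; rewrite -{2}(cat_take_drop l s) lin_cat size_takel //.
rewrite [X in _ = _ + X]big1 ?addr0 => [|i _].
  by congr (_ x); apply: lin_eq => i; rewrite size_takel // => ->.
by rewrite ltnNge leq_addr mul0r.
Qed.

Lemma adapted_basis0 : adapted_basis 0 [::].
Proof.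
split=> // f [_ /= ->].
by exists (fun=> 0); apply/funext => x; rewrite /lin big_ord0.
Qed.

Lemma adapted_basis_step n s : adapted_basis n s ->
  exists t, adapted_basis n.+1 (s ++ t).
Proof.
move=> [sS si sp sd]; have [ws dws] := det_full p_pr Efg n.+1.
have sS1 : family_in s (cpol n.+1) by move=> i /sS; exact: cpol_le.
have [u uS ui|t [stS sti stp]] := extend_indep (m := size ws) (cpol_linear n.+1) sS1 si.
  by apply: det_bound dws _ ui => i /uS hf; exists (fnth u i) => //; exact: restrT.
exists t; split=> // l g lst; have [ls|sl] := ltnP l (size s).
  have [a al] := sd l g ls; exists a; rewrite takel_cat ?(ltnW ls) //.
  by rewrite /fnth nth_cat ls.
have [a al] := sp _ (cpol_dif g (stS l lst)); rewrite al.
exists (fun i => if (i < size s)%N then a i else 0); apply/funext => x.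
rewrite take_cat ltnNge sl /= lin_cat [X in _ = _ + X]big1 ?addr0 => [|i _].
  by congr (_ x); apply: lin_eq => i ->.
by rewrite ltnNge leq_addr mul0r.
Qed.

Section Step.
Variables (cl : (E -> E -> 'F_p) -> 'F_p) (rho : bool).
Hypothesis clP : class_map cl.
Hypothesis cl0 : ~~ rho -> forall c, cocycle2 c -> cl c = 0.
Variable chis : seq (E -> 'F_p).
Hypotheses (chiS : family_in chis (@hom1 p E)) (chi_i : indep chis).
Variables (n : nat) (s t : seq (E -> 'F_p)).
Hypothesis bst : adapted_basis n.+1 (s ++ t).
Let B := s ++ t.
Let m := size B.

(** The matrix of [dif g] in the basis B. For f of degree less than n + 2, the map sending g to
    [dif g f] is a 1-cocycle with values in the span of B, and every cocycle arises so. The section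
    bounds the space of cocycles from below by filling in their components from the last to the
    first. *)
Variable R : nat -> nat -> E -> 'F_p.
Hypothesis RE : forall l g x, (l < m)%N ->
  dif g (fnth B l) x = \sum_(k < m) R k l g * fnth B k x.
Hypothesis Rtri : forall k l g, (l <= k)%N -> R k l g = 0.
Hypothesis Rtop : forall k l g, (size s <= k)%N -> R k l g = 0.
Hypothesis Rout : forall k l g, (m <= l)%N -> R k l g = 0.

Let Bi : indep B. Proof. by case: bst. Qed.

Lemma coefM k l g h : (k < m)%N ->
  R k l (g * h)%g = R k l g + R k l h + \sum_(j < m) R k j g * R j l h.
Proof.
move=> km; have [lm|ml] := ltnP l m; last first.
  by rewrite !(Rout _ _ ml) !add0r big1 // => j _; rewrite (Rout _ _ ml) mulr0.
apply/eqP; rewrite -subr_eq0; apply/eqP.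
apply: (Bi (a := fun k => R k l (g * h)%g -
  (R k l g + R k l h + \sum_(j < m) R k j g * R j l h))) => //.
apply/funext => x; rewrite /lin.
under eq_bigr => i _ do rewrite mulrBl !mulrDl.
rewrite sumrB !big_split /= -!RE // difM !faddE.
rewrite (_ : dif g (dif h (fnth B l)) x =
  \sum_(i < m) (\sum_(j < m) R i j g * R j l h) * fnth B i x); first by rewrite /m; ring.
rewrite difE !RE // -sumrB.
under eq_bigr => j _ do rewrite -mulrBr -difE RE // mulr_sumr.
rewrite exchange_big; apply: eq_bigr => i _ /=.
by rewrite mulr_suml; apply: eq_bigr => j _; rewrite mulrA [R j l h * _]mulrC.
Qed.

Lemma lc_fnth i : (i < m)%N -> lc (fnth B i).
Proof. by case: bst => /(_ i) + _ _ _ im => /(_ im)[]. Qed.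

Lemma lc_coef k l : (k < m)%N -> lc (R k l).
Proof.
move=> km; have [lm|ml] := ltnP l m; last first.
  have -> : R k l = cst 0 by apply/funext => g; rewrite Rout.
  exact: lc_cst.
have [V oV fV] := lc_fnth lm; exists V => // g v Vv.
apply/eqP; rewrite -subr_eq0; apply/eqP.
apply: (Bi (a := fun k => R k l (g * v)%g - R k l g)) => //.
apply/funext => x; rewrite /lin.
under eq_bigr => i _ do rewrite mulrBl.
by rewrite sumrB -!RE // !difE mulgA fV // subrr.
Qed.

(* The components of index at least k of a 1-cocycle with values in the span
   of B, that is, a cocycle with values in a quotient of it. *)
Definition partial_cocycle k (D : nat * E -> 'F_p) :=
  [/\ forall i, lc (fun g => D (i, g)),
      forall i g, ((i < k) || (m <= i))%N -> D (i, g) = 0 &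
      forall i g h, (k <= i < m)%N -> D (i, (g * h)%g) =
        D (i, g) + D (i, h) + \sum_(l < m) R i l g * D (nat_of_ord l, h)].

Lemma partial_cocycle_linear k : linear_set (partial_cocycle k).
Proof.
split.
  split=> // [i|i g h _]; first exact: (lc_cst _ 0).
  by rewrite !add0r big1 // => l _; rewrite mulr0.
move=> c D D' [l1 z1 h1] [l2 z2 h2]; split.
- by move=> i; apply: (@lcD _ _ (c \*o fun g => D (i, g))) => //; exact: lcZ.
- by move=> i g ki; rewrite z1 // z2 // mulr0 addr0.
- move=> i g h ki; rewrite h1 // h2 //.
  under [in RHS]eq_bigr => l _ do rewrite mulrDr mulrCA.
  by rewrite big_split /= -mulr_sumr; ring.
Qed.

(** Component k of a cocycle must have this 2-cocycle as its coboundary, up to sign; by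
    triangularity only later components enter. *)
Definition obstruction k (D : nat * E -> 'F_p) g h :=
  \sum_(l < m) R k l g * D (nat_of_ord l, h).

Lemma obstruction_cocycle k D : (k < m)%N -> partial_cocycle k.+1 D ->
  cocycle2 (obstruction k D).
Proof.
move=> km [lD zD hD]; split.
  have [V oV VP] := @lc_family p E m (R k) (fun l _ => lc_coef l km).
  have [W oW WP] := @lc_family p E m (fun l g => D (l, g)) (fun l _ => lD l).
  exists (V `&` W); first exact: open_normalI.
  move=> x y v w [Vv Wv] [Vw Ww]; apply: eq_bigr => l _.
  by rewrite VP // WP.
move=> x y z; rewrite /obstruction.
have E1 : \sum_(l < m) R k l (x * y)%g * D (nat_of_ord l, z) =
    \sum_(l < m) R k l x * D (nat_of_ord l, z) + \sum_(l < m) R k l y * D (nat_of_ord l, z)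
    + \sum_(l < m) \sum_(j < m) R k j x * R j l y * D (nat_of_ord l, z).
  rewrite -!big_split; apply: eq_bigr => l _ /=.
  by rewrite coefM // !mulrDl mulr_suml.
have E2 : \sum_(l < m) R k l x * D (nat_of_ord l, (y * z)%g) =
    \sum_(l < m) R k l x * D (nat_of_ord l, y) + \sum_(l < m) R k l x * D (nat_of_ord l, z)
    + \sum_(l < m) \sum_(j < m) R k j x * R j l y * D (nat_of_ord l, z).
  rewrite exchange_big -!big_split; apply: eq_bigr => l _ /=.
  have [lk|kl] := leqP l k.
    by rewrite Rtri // !mul0r !add0r big1 // => j _; rewrite !mul0r.
  rewrite hD ?kl ?ltn_ord // !mulrDr mulr_sumr; congr (_ + _).
  by apply: eq_bigr => j _; rewrite mulrA.
by rewrite E1 E2; ring.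
Qed.

Lemma obstruction_linear k (c : 'F_p) D D' :
  obstruction k (fun ig => c * D ig + D' ig) =
  (fun x y => c * obstruction k D x y + obstruction k D' x y).
Proof.
apply/funext => x; apply/funext => y; rewrite /obstruction mulr_sumr -big_split.
by apply: eq_bigr => l _ /=; rewrite mulrDr mulrCA.
Qed.

Lemma lift_partial_cocycle k D : (k < m)%N -> partial_cocycle k.+1 D ->
  cl (obstruction k D) = 0 -> exists2 D', partial_cocycle k D' &
    forall i g, i != k -> D' (i, g) = D (i, g).
Proof.
move=> km hD; have oD := obstruction_cocycle km hD; case: (hD) => lD zD cD.
move=> /(clP.2 _ oD)[h lh hE].
exists (fun ig => if ig.1 == k then - h ig.2 else D ig); last by move=> i g /negbTE /= ->.
have sumE i g x : (k <= i)%N ->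
    \sum_(l < m) R i l g * (if (nat_of_ord l, x).1 == k then - h (nat_of_ord l, x).2
                            else D (nat_of_ord l, x)) =
    \sum_(l < m) R i l g * D (nat_of_ord l, x).
  move=> ki; apply: eq_bigr => l _ /=; case: eqP => // lk.
  by rewrite Rtri ?mul0r // lk.
split=> /=.
- move=> i; have [_|ik] := eqVneq i k; first exact: lcN.
  exact: lD.
- move=> i g iP; have [ik|ik] := eqVneq i k.
    by move: iP km; rewrite ik ltnn /=; clear; lia.
  by rewrite zD // ltnS leq_eqVlt (negbTE ik).
- move=> i g x /andP[ki im]; rewrite sumE //; have [ik|ik] := eqVneq i k.
    by rewrite ik -/(obstruction k D g x) hE; ring.
  by rewrite cD // im ltn_neqAle eq_sym ik ki.
Qed.

Lemma partial_cocycle_hom k chi : (k < m)%N -> hom1 chi ->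
  partial_cocycle k (fun ig => if ig.1 == k then chi ig.2 else 0).
Proof.
move=> km [lchi hchi]; split=> /=.
- by move=> i; case: eqP => _ //; exact: (lc_cst _ 0).
- move=> i g iP; case: eqP => // ik.
  by move: iP km; rewrite ik ltnn /=; clear; lia.
- move=> i g x /andP[ki im]; rewrite big1 ?addr0 => [|l _].
    by case: eqP => _; rewrite ?addr0.
  by case: eqP => lk; rewrite ?mulr0 // Rtri ?mul0r // lk.
Qed.

(** Filling in component k loses at most one dimension, to the class of the obstruction in H^2, and
    gains one for each homomorphism put into that component. Nothing is lost for k >= size s, since
    differences of members of B lie in the span of s; hence the truncated difference. *)
Lemma partial_cocycle_family j : (j <= m)%N -> exists S : seq (nat * E -> 'F_p),
  [/\ family_in S (partial_cocycle (m - j)), indep S &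
      (j * size chis <= size S + rho * (size s - (m - j)))%N].
Proof.
elim: j => [|j IH] jm; first by exists [::].
have [S [SS Si Ssz]] := IH (ltnW jm).
set k := (m - j.+1)%N; have kE : (m - j = k.+1)%N by rewrite /k subnSK.
rewrite kE in SS Ssz; have km : (k < m)%N by move: jm; rewrite /k; clear; lia.
have [S1 [S1S S1i S1sz]] : exists S1, [/\ family_in S1 [set D | partial_cocycle k.+1 D /\
    cl (obstruction k D) = 0], indep S1 & (size S <= size S1 + (rho && (k < size s)))%N].
  have [/andP[r1 ks]|nr] := boolP (rho && (k < size s)%N).
    have [c D D' hD hD'|S1 [h1 h2 h3]] :=
      kernel_family (theta := fun D => cl (obstruction k D)) (partial_cocycle_linear k.+1) _ SS Si.
      have h1 := obstruction_cocycle km hD; have h2 := obstruction_cocycle km hD'.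
      rewrite obstruction_linear (clP.1 (fun x y => c * obstruction k D x y)) //.
        by rewrite (class_mapZ clP).
      exact: cocycle2Z.
    by exists S1; split=> //; rewrite addn1.
  exists S; split=> //; last by rewrite addn0.
  move=> i iS; split; first exact: SS.
  move: nr; rewrite negb_and => /orP[nr|]; last rewrite -leqNgt => sk.
    by apply: cl0 => //; apply: obstruction_cocycle => //; exact: SS.
  rewrite -[RHS](class_map0 clP); congr cl; apply/funext => x; apply/funext => y.
  by rewrite /obstruction big1 // => l _; rewrite Rtop ?mul0r.
(* Lifts are merely chosen, not linear. Independence survives because they change only component k,
   where the given cocycles vanish. *)
have [lift liftP] : exists lift : (nat * E -> 'F_p) -> (nat * E -> 'F_p), forall D,
    partial_cocycle k.+1 D /\ cl (obstruction k D) = 0 ->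
    partial_cocycle k (lift D) /\ forall i g, i != k -> lift D (i, g) = D (i, g).
  have H D : exists D', partial_cocycle k.+1 D /\ cl (obstruction k D) = 0 ->
      partial_cocycle k D' /\ forall i g, i != k -> D' (i, g) = D (i, g).
    have [[hD oD]|nD] := pselect (partial_cocycle k.+1 D /\ cl (obstruction k D) = 0).
      by have [D' ? ?] := lift_partial_cocycle km hD oD; exists D'.
    by exists D.
  by have [lift liftP] := choice H; exists lift.
pose emb (chi : E -> 'F_p) : nat * E -> 'F_p := fun ig => if ig.1 == k then chi ig.2 else 0.
pose S2 := [seq lift D | D <- S1] ++ [seq emb chi | chi <- chis].
have S2l i : (i < size S1)%N -> fnth [seq lift D | D <- S1] i = lift (fnth S1 i).
  by move=> iS; rewrite /fnth (nth_map (fun=> 0)).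
have S2r i : (i < size chis)%N -> fnth [seq emb chi | chi <- chis] i = emb (fnth chis i).
  by move=> iS; rewrite /fnth (nth_map (fun=> 0)).
exists S2; split.
- move=> i; rewrite size_cat !size_map /fnth nth_cat size_map => iS.
  case: ltnP => i1; rewrite -/(fnth _ _).
    by rewrite S2l //; exact: (liftP _ (S1S _ i1)).1.
  have i2 : (i - size S1 < size chis)%N by rewrite ltn_subLR.
  by rewrite S2r //; apply: partial_cocycle_hom => //; exact: chiS.
- have embi : indep [seq emb chi | chi <- chis].
    move=> a la i; rewrite size_map => ic; apply: chi_i ic.
    apply/funext => x; transitivity (lin [seq emb chi | chi <- chis] a (k, x)); last by rewrite la.
    rewrite /lin size_map; apply: eq_bigr => l _.
    by rewrite S2r // /emb /= eqxx.
  apply: indep_cat => // a la; have : lin S1 a = (fun=> 0).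
    apply/funext => -[i g]; have [ik|ik] := eqVneq i k.
      rewrite ik /lin big1 // => l _; have [_ z _] := (S1S l (ltn_ord l)).1.
      by rewrite z ?mulr0 // ltnSn.
    transitivity (lin S2 a (i, g)); last by rewrite la.
    rewrite lin_cat [X in _ = _ + X]big1 ?addr0 => [|l _].
      rewrite /lin size_map; apply: eq_bigr => l _.
      by rewrite S2l // (liftP _ (S1S _ (ltn_ord l))).2.
    have lc : (l < size chis)%N by rewrite -(size_map emb).
    by rewrite S2r // /emb /= (negbTE ik) mulr0.
  by move=> /S1i h i; rewrite size_map; exact: h.
- rewrite size_cat !size_map; move: Ssz S1sz.
  by case: rho => /=; case: (ltnP k (size s)) => /=; move: (size S) (size S1) (size s) (size chis);
    clear; nia.
Qed.

Lemma golod_shafarevich_step : exists u, [/\ family_in u (cpol n.+2), indep u &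
  (1 + size chis * size (s ++ t) <= size u + rho * size s)%N].
Proof.
have [S [SS Si Ssz]] := partial_cocycle_family (leqnn m).
rewrite subnn subn0 in SS Ssz.
(* The primitive of D that vanishes at 1, since [dif g f] at 1 is f(g) - f(1). The constants supply
   the one remaining dimension. *)
pose fD (D : nat * E -> 'F_p) : E -> 'F_p := fun g =>
  \sum_(k < m) fnth B k 1%g * D (nat_of_ord k, g).
have difD D g : partial_cocycle 0 D -> dif g (fD D) = lin B (fun k => D (k, g)).
  move=> [_ _ hD]; apply/funext => x; rewrite /lin difE /fD -sumrB.
  transitivity (\sum_(k < m) (fnth B k 1%g * D (nat_of_ord k, g) +
      \sum_(l < m) fnth B k 1%g * (R k l x * D (nat_of_ord l, g)))).
    by apply: eq_bigr => k _; rewrite hD ?ltn_ord // -mulr_sumr; ring.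
  rewrite big_split /= exchange_big -big_split; apply: eq_bigr => k _ /=.
  have -> : fnth B k x = fnth B k 1%g + dif x (fnth B k) 1%g.
    by rewrite difE mul1g addrC subrK.
  rewrite RE // mulrDr mulrC; congr (_ + _); rewrite mulr_sumr.
  by apply: eq_bigr => l _; rewrite [RHS]mulrC mulrA [_ * R l k x]mulrC mulrAC.
have fD_pol D : partial_cocycle 0 D -> cpol n.+2 (fD D).
  move=> hD; have [lD _ _] := hD; split.
    have -> : fD D = \sum_(k < m) fnth B k 1%g \*o (fun g => D (nat_of_ord k, g)).
      by apply/funext => g; rewrite -[RHS]/(difw [::] _ g) difw_sum.
    by apply: lc_sum => k _; exact: lcZ.
  move=> g; rewrite difD //.
  have [hB _ _ _] := bst; exact: (lin_in _ (cpol_linear n.+1) hB).2.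
pose u := [:: cst 1] ++ [seq fD D | D <- S].
have fDnth i : (i < size S)%N -> fnth [seq fD D | D <- S] i = fD (fnth S i).
  by move=> iS; rewrite /fnth (nth_map (fun=> 0)).
exists u; split.
- move=> [|i]; first by move=> _; exact: cpol_cst.
  rewrite /u /= size_map ltnS => iS; rewrite -[fnth _ _]/(fnth [seq fD D | D <- S] i).
  by rewrite fDnth //; apply: fD_pol; exact: SS.
- have fD1 D : partial_cocycle 0 D -> fD D 1%g = 0.
    move=> hD; apply: big1 => k _.
    rewrite (Bi (a := fun k => D (k, 1%g)) _ (ltn_ord k)) ?mulr0 //.
    by rewrite -difD // dif1.
  have mapi : indep [seq fD D | D <- S].
    move=> a la i; rewrite size_map; apply: Si; pose D := lin S a.
    have hD : partial_cocycle 0 D by exact: lin_in (partial_cocycle_linear 0) SS.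
    have fD0 : fD D = 0.
      apply/funext => g; transitivity (lin [seq fD D | D <- S] a g); last by rewrite la.
      rewrite /lin size_map /fD; under [LHS]eq_bigr => k _ do rewrite /D /lin mulr_sumr.
      rewrite exchange_big; apply: eq_bigr => l _ /=; rewrite fDnth // mulr_sumr.
      by apply: eq_bigr => k _; rewrite mulrCA.
    apply/funext => -[k g]; rewrite -/D; have [km|mk] := ltnP k m; last first.
      by have [_ z _] := hD; rewrite z // mk orbT.
    apply: (Bi (a := fun k => D (k, g))) km.
    by rewrite -difD // fD0 dif0.
  apply: indep_cat => // a la [|//] _.
  have := congr1 (@^~ 1%g) la; rewrite lin_cat /lin big_ord1 /fnth /= mulr1 => <-.
  rewrite [X in _ = _ + X]big1 ?addr0 // => l _.
  have lS : (l < size S)%N by rewrite -(size_map fD).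
  by rewrite -/(fnth _ _) fDnth // fD1 ?mulr0 //; exact: SS.
- have -> : size u = (size S).+1 by rewrite /u /= size_map.
  by rewrite add1n addSn ltnS mulnC; exact: Ssz.
Qed.

End Step.

(** In terms of the dimension b_n of the polynomials of degree less than n and the number d of
    characters, this is the recursion b_(n+2) >= 1 + d b_(n+1) - rho b_n. *)
Lemma golod_shafarevich (cl : (E -> E -> 'F_p) -> 'F_p) (rho : bool) chis n s t :
  class_map cl -> (~~ rho -> forall c, cocycle2 c -> cl c = 0) ->
  family_in chis (@hom1 p E) -> indep chis ->
  adapted_basis n s -> adapted_basis n.+1 (s ++ t) ->
  forall u, adapted_basis n.+2 u ->
  (1 + size chis * size (s ++ t) <= size u + rho * size s)%N.
Proof.
move=> clP cl0 chiS chi_i bs bst u bu.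
pose B := s ++ t.
have [a aP] : exists a : nat * E -> nat -> 'F_p, forall lg, (lg.1 < size B)%N ->
    dif lg.2 (fnth B lg.1) = lin s (a lg) /\ forall k, ((lg.1 <= k) || (size s <= k))%N -> a lg k = 0.
  have H (lg : nat * E) : exists a : nat -> 'F_p, (lg.1 < size B)%N ->
      dif lg.2 (fnth B lg.1) = lin s a /\ forall k, ((lg.1 <= k) || (size s <= k))%N -> a k = 0.
    case: lg => l g /=; have [lB|_] := ltnP l (size B); last by exists (fun=> 0).
    have [_ _ sp sd] := bs; have [ls|sl] := ltnP l (size s).
      have [a al] := sd l g ls; exists (fun i => if (i < l)%N then a i else 0) => _.
      rewrite -lin_take ?(ltnW ls) // -al /fnth nth_cat ls; split=> // k.
      case: (ltnP k l) => //= kl sk.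
      by move: ls kl sk; clear; lia.
    have [hB _ _ _] := bst; have [a al] := sp _ (cpol_dif g (hB l lB)).
    exists (fun i => if (i < size s)%N then a i else 0) => _; split.
      by rewrite al; apply: lin_eq => i ->.
    by move=> k; case: (ltnP k (size s)) => // ks /orP[lk|//]; move: sl lk ks; clear; lia.
  by have [a aP] := choice H; exists a.
pose R k l g := if (l < size B)%N then a (l, g) k else 0.
have [||||v [vS vi vsz]] := @golod_shafarevich_step cl rho clP cl0 chis chiS chi_i n s t bst R.
- move=> l g x lB; have [dl az] := aP (l, g) lB; rewrite dl /R lB.
  rewrite /B size_cat big_split_ord /= [X in _ + X]big1 ?addr0 => [|k _].
    by apply: eq_bigr => k _; rewrite /fnth nth_cat ltn_ord.
  by rewrite az ?mul0r // leq_addr orbT.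
- by move=> k l g lk; rewrite /R; case: ifP => // lB; rewrite (aP (l, g) lB).2 //= lk.
- by move=> k l g sk; rewrite /R; case: ifP => // lB; rewrite (aP (l, g) lB).2 //= sk orbT.
- by move=> k l g Bl; rewrite /R ltnNge Bl.
apply: leq_trans vsz _; rewrite leq_add2r; apply: span_bound => // i iv.
by have [_ _ + _] := bu; apply; exact: vS.
Qed.

End GolodShafarevich.

(** * Second cohomology of Demushkin and free groups *)

Section Cochains.
Variables (p : nat) (E : topGroupType).
Hypotheses (p_pr : prime p) (Ep : pro_p p E).
Implicit Types (c : E -> E -> 'F_p).

(** Uniformity in x comes from compactness, through [invariance_subgroup]. *)
Lemma lcP (f : E -> 'F_p) : lc f <-> forall x, nbhs x [set y | f y = f x].
Proof.
split=> [[V [nV oV] fV] x|cf].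
  apply: filterS (open_nbhs_nbhs (conj (translate_open x^-1%g oV) _)).
    by move=> y /= Vy; rewrite /= -(mulKVg x y) fV.
  by rewrite /= mulVg; exact: subgroup1 nV.1.
have [nN oN] := invariance_subgroup (pro_p_compact Ep) cf.
eexists; first by split; [exact: nN|exact: oN].
by move=> x v /= /(_ x 1%g); rewrite !mulg1.
Qed.

Definition cochain2 c : ('I_2 -> E) -> 'F_p := fun v => c (v ord0) (v (lift ord0 ord0)).

Definition cochain1 (h : E -> 'F_p) : ('I_1 -> E) -> 'F_p := fun v => h (v ord0).

Lemma eval_continuous n (i : 'I_n) : continuous (fun v : {ptws 'I_n -> E} => v i).
Proof. exact: (@proj_continuous 'I_n (fun=> E) i). Qed.

Lemma cochain_nbhs n (f : ('I_n -> E) -> 'F_p) :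
  (forall v : {ptws 'I_n -> E}, nbhs v [set w | f w = f v]) -> cochain f.
Proof.
move=> h v A; rewrite /= nbhs_principalE => /principal_filterP Afv.
apply: (@filterS {ptws 'I_n -> E} _ (nbhs_filter v) _ _ _ (h v)) => w /=.
by rewrite /preimage /= => ->.
Qed.

Lemma cochain_cochain1 h : lc h -> cochain (cochain1 h).
Proof.
move=> /lcP lh; apply: cochain_nbhs => v.
exact: (@eval_continuous 1 ord0 v _ (lh (v ord0))).
Qed.

Lemma cochain_cochain2 c : lc2 c -> cochain (cochain2 c).
Proof.
move=> [V [nV oV] cV]; apply: cochain_nbhs => v.
have nb (i : 'I_2) : nbhs v [set w : {ptws 'I_2 -> E} | V ((v i)^-1 * w i)%g].
  apply: (@eval_continuous 2 i v [set x | V ((v i)^-1 * x)%g]).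
  apply: open_nbhs_nbhs; split; first exact: translate_open.
  by rewrite /= mulVg; exact: subgroup1 nV.1.
have nv := nbhs_filter v.
apply: filterS (filterI (nb ord0) (nb (lift ord0 ord0))) => w [/= w0 w1].
by rewrite /cochain2 -(mulKVg (v ord0) (w ord0)) -(mulKVg (v (lift ord0 ord0)) (w (lift ord0 ord0))) cV.
Qed.

Lemma cobd1 (h : ('I_1 -> E) -> 'F_p) (v : 'I_2 -> E) :
  cobd (@triv p E) h v = h (fun=> v (lift ord0 ord0)) + h (fun=> v ord0)
    - h (fun=> (v ord0 * v (lift ord0 ord0))%g).
Proof.
rewrite /cobd big_ord_recl big_ord0 addr0 /triv expr1 sqrrN expr1n mulr1z mulrN1z.
rewrite addrAC; congr (h _ + h _ - h _); apply/funext => i; rewrite ?ord1 //.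
  by congr (v _); apply: val_inj.
by rewrite /Defs.contract /=; congr (v _ * v _)%g; apply: val_inj.
Qed.

Lemma cobd2 c (v : 'I_3 -> E) :
  let x := v ord0 in let y := v (lift ord0 ord0) in let z := v (lift ord0 (lift ord0 ord0)) in
  cobd (@triv p E) (cochain2 c) v = c y z - c (x * y)%g z + c x (y * z)%g - c x y.
Proof.
move=> x y z; rewrite /cobd !big_ord_recl big_ord0 addr0 /triv.
have -> : (-1) ^+ (@ord0 1).+1 = -1 :> int by [].
have -> : (-1) ^+ (lift ord0 (@ord0 0)).+1 = 1 :> int by [].
have -> : (-1) ^+ 3 = -1 :> int by [].
rewrite !mulrN1z mulr1z addrA /cochain2.
have w0 : v (widen_ord (leqnSn 2) ord0) = x by congr (v _); apply: val_inj.
have w1 : v (widen_ord (leqnSn 2) (lift ord0 ord0)) = y by congr (v _); apply: val_inj.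
by rewrite /Defs.contract /= w0 w1.
Qed.

Lemma cocycle_cochain2 c : cocycle2 c -> cocycle (@triv p E) (cochain2 c).
Proof.
by move=> [lc hc]; split; [exact: cochain_cochain2|apply/funext => v; rewrite cobd2 hc].
Qed.

Lemma cochain1_lc (f : ('I_1 -> E) -> 'F_p) : cochain f -> lc (fun x => f (fun=> x)).
Proof.
move=> ch; apply/lcP => x.
have dc : continuous (fun x : E => (fun=> x) : {ptws 'I_1 -> E}).
  move=> y; apply/cvg_sup => i U [W [[A oA <-] /= Ay] sWU].
  by apply: filterS sWU _; exact: open_nbhs_nbhs.
apply: (dc x [set w | f w = f (fun=> x)]).
apply: (ch (fun=> x) [set a | a = f (fun=> x)]).
by rewrite /= nbhs_principalE; apply/principal_filterP.
Qed.

Lemma coboundary_cochain2 c :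
  coboundary (@triv p E) (cochain2 c) <-> trivial2 c.
Proof.
split=> [[h ch cE]|[h lh cE]].
  exists (fun x => h (fun=> x)); first exact: cochain1_lc.
  move=> x y; pose v (i : 'I_2) := if i == ord0 then x else y.
  have := congr1 (@^~ v) cE; rewrite cobd1 /cochain2 /v /= => ->.
  by rewrite [h (fun=> y) + _]addrC.
exists (cochain1 h); first exact: cochain_cochain1.
by apply/funext => v; rewrite cobd1 /cochain2 cE /cochain1 [h (v ord0) + _]addrC.
Qed.

Lemma trivial2D c d : trivial2 c -> trivial2 d -> trivial2 (fun x y => c x y + d x y).
Proof.
move=> [h lh hE] [k lk kE]; exists (h + k); first exact: lcD.
by move=> x y; rewrite hE kE !faddE; ring.
Qed.

Lemma cochain2_of (f : ('I_2 -> E) -> 'F_p) :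
  f = cochain2 (fun x y => f (fun i => if i == ord0 then x else y)).
Proof.
apply/funext => v; rewrite /cochain2; congr f; apply/funext => i.
by have [->//|] := eqVneq i ord0; case: (unliftP ord0 i) => [j ->|->]; rewrite ?ord1 ?eqxx.
Qed.

(** The map is the coordinate of a class with respect to the given basis of H^2. *)
Lemma demushkin_class_map : coh_dim p E 2 1 ->
  exists cl : (E -> E -> 'F_p) -> 'F_p, class_map cl.
Proof.
move=> [c0 c0c c0P]; pose d x y := c0 ord0 (fun i => if i == ord0 then x else y).
have [cl clP] : exists cl : (E -> E -> 'F_p) -> 'F_p, forall c, cocycle2 c -> forall a,
    trivial2 (fun x y => c x y - a * d x y) <-> a = cl c.
  have H c : exists b : 'F_p, cocycle2 c -> forall a,
      trivial2 (fun x y => c x y - a * d x y) <-> a = b.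
    have [hc|nc] := pselect (cocycle2 c); last by exists 0.
    have cE (a : 'rV['F_p]_1) : (fun v => cochain2 c v - \sum_i a 0 i * c0 i v) =
        cochain2 (fun x y => c x y - a 0 0 * d x y).
      by apply/funext => v; rewrite big_ord1 [c0 ord0]cochain2_of.
    have [a [ha ua]] := c0P _ (cocycle_cochain2 hc); exists (a 0 0) => _ b.
    split=> [tb|->]; last by apply/coboundary_cochain2; rewrite -cE.
    by rewrite (ua (\row__ b)) ?mxE // cE mxE; apply/coboundary_cochain2.
  by have [cl clP] := choice H; exists cl.
exists cl; split.
  move=> c e hc he; apply/esym/(clP _ (cocycle2D hc he)).
  have := trivial2D ((clP _ hc _).2 erefl) ((clP _ he _).2 erefl).
  congr trivial2; apply/funext => x; apply/funext => y; ring.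
move=> c hc; have := clP c hc 0.
have -> : (fun x y => c x y - 0 * d x y) = c.
  by apply/funext => x; apply/funext => y; rewrite mul0r subr0.
by move=> h; split=> [/esym/h//|/h].
Qed.

Lemma hom1_cocycle (chi : E -> 'F_p) : hom1 chi -> cocycle (@triv p E) (cochain1 chi).
Proof.
move=> [lchi hchi]; split; first exact: cochain_cochain1.
by apply/funext => v; rewrite cobd1 /cochain1 hchi; ring.
Qed.

Lemma cup_nondegenerate_hom (chi : E -> 'F_p) : cup11_nondegenerate p E ->
  hom1 chi -> chi <> (fun=> 0) ->
  exists2 psi, hom1 psi & ~ trivial2 (fun x y => chi x * psi y).
Proof.
move=> [nd _] hchi chi0; apply: contrapT => npsi; apply: chi0.
have [b bc|h _ hE] := nd _ (hom1_cocycle hchi).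
  have hpsi : hom1 (fun x => b (fun=> x)).
    case: bc => ch bE; split; first exact: cochain1_lc.
    move=> x y; pose v (i : 'I_2) := if i == ord0 then x else y.
    have := congr1 (@^~ v) bE; rewrite cobd1 /v /= => /eqP.
    by rewrite subr_eq0 addrC => /eqP.
  have : trivial2 (fun x y => chi x * b (fun=> y)).
    by apply: contrapT => nt; apply: npsi; exists (fun x => b (fun=> x)).
  move=> /coboundary_cochain2; congr (coboundary _ _); apply/funext => v.
  rewrite /cup /cochain2 /cochain1; congr (chi (v _) * b _); first exact: val_inj.
  by apply/funext => i; congr (v _); apply: val_inj; rewrite /= ord1.
apply/funext => x; have := congr1 (@^~ (fun=> x)) hE; rewrite /cochain1 /= => ->.
rewrite /cobd big_ord0 addr0 /triv expr1 mulrN1z; apply/eqP; rewrite subr_eq0; apply/eqP.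
by congr h; apply/funext => -[].
Qed.

End Cochains.

(** An alias that carries the discrete topology, so that finite p-groups become targets for the
    universal property of a free pro-p group. *)
Definition discrete_group (Q : finGroupType) : Type := Q.

Section DiscreteGroup.
Variable Q : finGroupType.

HB.instance Definition _ := Group.copy (discrete_group Q) Q.
HB.instance Definition _ := Topological.copy (discrete_group Q) (discrete_topology Q).

Lemma discrete_group_nbhs (x : discrete_group Q) : nbhs x [set x].
Proof. exact: (@discrete_set1 (discrete_topology Q) x). Qed.

Lemma discrete_group_mul_continuous :
  continuous (fun xy : discrete_group Q * discrete_group Q => (xy.1 * xy.2)%g).
Proof.
move=> [x y] A /= /nbhs_singleton Axy.
exists ([set x], [set y]); first by split; exact: discrete_group_nbhs.
by move=> [a b] [/= -> ->].
Qed.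

Lemma discrete_group_inv_continuous : continuous (fun x : discrete_group Q => (x^-1)%g).
Proof.
move=> x A /= /nbhs_singleton Ax.
exact: (iffRL (principal_filterP x [set y : Q | A (y^-1)%g]) Ax).
Qed.

HB.instance Definition _ := isTopGroup.Build (discrete_group Q)
  discrete_group_mul_continuous discrete_group_inv_continuous.

Lemma discrete_group_pro_p p : prime p -> p.-nat #|Q| -> pro_p p (discrete_group Q).
Proof.
move=> p_pr pQ; split.
- apply: finite_compact; apply: (@sub_finite_set _ _ [set` enum Q]); last exact: finite_seq.
  by move=> x _; rewrite /= mem_enum.
- move=> x y cl; have [z [/= zx zy]] := cl _ _ (@discrete_group_nbhs x) (@discrete_group_nbhs y).
  by rewrite -zx -zy.
- exact: (@zero_dimension_totally_disconnected (discrete_topology Q)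
    (@discrete_zero_dimension (discrete_topology Q))).
- move=> N [sN nN] _.
  pose NQ : {set Q} := fimage (id : discrete_group Q -> Q) N.
  have NP x : (x \in NQ) <-> N x.
    by split=> [/fimageP[y Ny <-]//|Nx]; apply/fimageP; exists x.
  have gN : group_set NQ.
    apply/group_setP; split; first by apply/NP; exact: (subgroup1 sN).
    by move=> x y /NP Nx /NP Ny; apply/NP; exact: (subgroupM sN Nx Ny).
  pose NG := Group gN.
  have piP (x y : discrete_group Q) : (x *: NG = y *: NG)%g <-> N (x^-1 * y)%g.
    split=> [xy|Nxy].
      by apply/NP; rewrite -[_ \in _](@mem_lcoset Q NG) xy lcoset_refl.
    by apply/esym/lcoset_eqP; rewrite mem_lcoset; apply/NP.
  have /p_natP[k kE] : p.-nat (indexg (setT_group Q) NG).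
    apply: pnat_dvd pQ; apply: (dvdn_trans (dvdn_indexg _ _)).
    by rewrite cardsT.
  exists k; rewrite -kE -card_lcosets (gindexE piP); apply: eq_card => C.
  apply/idP/lcosetsP => [/fimageP[x _ <-]|[x _ ->]]; first by exists x; rewrite ?inE.
  by apply/fimageP; exists x.
Qed.

End DiscreteGroup.

Section Extension.
Variables (p : nat) (gT : finGroupType) (c : gT -> gT -> 'F_p).
Hypothesis cP : forall x y z, c y z - c (x * y)%g z + c x (y * z)%g - c x y = 0.
Hypothesis c11 : c 1%g 1%g = 0.

(* The extension of gT by F_p with factor set c. *)
Definition extension (_ : forall x y z, c y z - c (x * y)%g z + c x (y * z)%g - c x y = 0)
  (_ : c 1%g 1%g = 0) : Type := ('F_p * gT)%type.

Let T := extension cP c11.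

HB.instance Definition _ := Finite.copy T ('F_p * gT)%type.

Definition extension_mul (a b : T) : T := (a.1 + b.1 + c a.2 b.2, (a.2 * b.2)%g).
Definition extension_one : T := (0, 1%g).
Definition extension_inv (a : T) : T := (- a.1 - c a.2^-1%g a.2, a.2^-1%g).

Lemma extension_mulA : associative extension_mul.
Proof.
move=> [a x] [b y] [d z]; congr (_, _) => /=; last exact: mulgA.
by apply/eqP; rewrite -subr_eq0 -(cP x y z); apply/eqP; ring.
Qed.

Lemma extension_mul1 : left_id extension_one extension_mul.
Proof.
move=> [a x]; congr (_, _) => /=; last exact: mul1g.
have := cP 1%g 1%g x; rewrite !mul1g c11 subr0 subrr add0r => ->.
by rewrite add0r addr0.
Qed.

Lemma extension_mulV : left_inverse extension_one extension_inv extension_mul.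
Proof.
move=> [a x]; congr (_, _) => /=; last exact: mulVg. by ring.
Qed.

HB.instance Definition _ := Finite_isGroup.Build T
  extension_mulA extension_mul1 extension_mulV.

End Extension.

Section FreeCohomology.
Variables (p : nat) (E : topGroupType).
Hypotheses (p_pr : prime p) (Ep : pro_p p E).

Lemma open_normal_lc (V : set E) (gT : finType) (pi : E -> gT) : open_normal V ->
  (forall x y, pi x = pi y <-> V (x^-1 * y)%g) -> forall x, nbhs x [set y | pi y = pi x].
Proof.
move=> [nV oV] piV x; apply: filterS (open_nbhs_nbhs (conj (translate_open x^-1%g oV) _)).
  by move=> y /= Vy; apply/esym/piV.
by rewrite /= mulVg; exact: subgroup1 nV.1.
Qed.

(** A 2-cocycle factors through a finite quotient gT and defines an extension of gT by F_p, again a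
    finite p-group. Freeness lifts the projection to this extension, and the F_p-component of the
    lift is, up to sign, the required cochain. *)
Lemma free_trivial2 : free_pro_p p E -> forall c, @cocycle2 p E c -> trivial2 c.
Proof.
move=> [X [b [_ cb uP]]] c0 hc0.
(* Normalized so that (0, 1) is the unit of the extension; the constant k is itself a coboundary. *)
pose k := c0 1%g 1%g; pose c x y := c0 x y - k.
suff [h lh hE] : trivial2 c.
  exists (h + cst k); first by apply: lcD => //; exact: lc_cst.
  move=> x y; have := hE x y; rewrite /c => /eqP; rewrite subr_eq => /eqP ->.
  clearbody k; rewrite !faddE /cst; ring.
have hc : cocycle2 c.
  apply: (cocycle2D hc0 (d := fun _ _ => - k)); split.
    by exists setT; first exact: open_normalT.
  by move=> *; ring.
case: (hc) => [[V oV cV] cE].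
have [gT [pi piV]] := finite_quotient_map p_pr Ep oV.
have [piM pi1 piS pG] := piV.
have [sg sgK] := choice piS.
have piE := quotient_mapE piV.
pose cb' (s t : gT) := c (sg s) (sg t).
have cbE x y : c x y = cb' (pi x) (pi y).
  have vP z : V ((sg (pi z))^-1 * z)%g by apply/piE; rewrite sgK.
  by rewrite /cb' -{1}(mulKVg (sg (pi x)) x) -{1}(mulKVg (sg (pi y)) y) cV.
have cbP s t u : cb' t u - cb' (s * t)%g u + cb' s (t * u)%g - cb' s t = 0.
  by rewrite -(sgK s) -(sgK t) -(sgK u) -!piM -!cbE cE.
have cb11 : cb' 1%g 1%g = 0.
  by rewrite -(quotient_map1 piV) -cbE /c /k subrr.
pose Q := extension cbP cb11.
have QP : pro_p p (discrete_group Q).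
  apply: discrete_group_pro_p => //.
  rewrite (_ : #|_| = (#|'F_p| * #|gT|)%N); last exact: card_prod.
  by rewrite pnatM card_Fp // pnat_id.
have GP : pro_p p (discrete_group gT) by exact: discrete_group_pro_p.
pose f x : discrete_group Q := (0, pi (b x)).
have fin x : V (b x) -> pi (b x) = 1%g by move/pi1.
have cf : converges_to_1 f.
  move=> U sU oU; apply: sub_finite_set (cb V oV.1.1 oV.2) => x nUx Vx; apply: nUx.
  by rewrite /f fin //; exact: subgroup1 sU.
have cfg : converges_to_1 (fun x => pi (b x) : discrete_group gT).
  move=> U sU oU; apply: sub_finite_set (cb V oV.1.1 oV.2) => x nUx Vx; apply: nUx.
  by rewrite fin //; exact: subgroup1 sU.
have dcont (R : finGroupType) (g : E -> R) : (forall x, nbhs x [set y | g y = g x]) ->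
    continuous (g : E -> discrete_group R).
  move=> gn x A /= /nbhs_singleton Ax.
  by apply: filterS (gn x) => y /= yx; rewrite /preimage /= yx.
have [h [[ch hM hb] _]] := uP _ _ QP cf.
have hn x : nbhs x [set y | h y = h x] by exact: (ch x _ (@discrete_group_nbhs _ (h x))).
(* Uniqueness for maps to gT shows that the lift h projects to [pi], as both agree on the basis
   b. *)
have [g [_ ug]] := uP _ _ GP cfg.
have hpi x : (h x).2 = pi x.
  rewrite -(_ : g x = pi x); first rewrite -(_ : g x = (h x).2) //.
    rewrite (ug (fun x => (h x).2 : discrete_group gT)) //; split.
    - apply: dcont => y; apply: filterS (hn y) => z /= -> //.
    - by move=> y z; rewrite hM.
    - by move=> y; rewrite hb.
  rewrite (ug (pi : E -> discrete_group gT)) //; split=> //.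
  by apply: dcont; exact: open_normal_lc oV piE.
exists (fun x => - (h x).1).
  by apply/(lcP Ep) => x; apply: filterS (hn x) => y /= ->.
move=> x y; rewrite hM cbE -!hpi /=; ring.
Qed.

End FreeCohomology.

(** * Growth of the Zassenhaus series *)

Section Kappa.
Variables (p : nat) (E : topGroupType).
Hypotheses (p_pr : prime p) (Ep : pro_p p E) (Efg : finitely_generated E).
Notation Z := (zassenhaus p E).
Implicit Types (K H : set E).

(** This is log_p |K Z_i : Z_i|: for a subgroup K the index is a power of p, so [logn] loses nothing
    ([card_fimage_kappa]). *)
Definition kappa K i := logn p (gindex (mulset K (Z i)) (Z i)).

Lemma zassenhaus_quotient i : exists (gT : finGroupType) (pi : E -> gT),
  quotient_map p (Z i) pi.
Proof. exact/(finite_quotient_map p_pr Ep)/(zassenhaus_open_normal p_pr Ep Efg). Qed.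

Section Quotient.
Variables (i : nat) (gT : finGroupType) (pi : E -> gT).
Hypothesis piV : quotient_map p (Z i) pi.

Lemma gindex_quotient K : gindex (mulset K (Z i)) (Z i) = #|fimage pi K|.
Proof.
rewrite (gindexE (quotient_mapE piV)) (fimage_mulset (quotient_mapE piV)) //.
exact: subgroup1 (zassenhaus_sub E p_pr i).
Qed.

Lemma card_fimage_kappa K : is_subgroup K -> #|fimage pi K| = (p ^ kappa K i)%N.
Proof.
move=> sK; rewrite /kappa gindex_quotient.
have [_ _ _ pG] := piV.
have /p_natP[k ->] : p.-nat #|Group (fimage_group_set piV sK)|.
  by apply: pnat_dvd pG; rewrite -cardsT cardSg ?finset.subsetT.
by rewrite pfactorK.
Qed.

Lemma fimageT : fimage pi setT = finset.setTfor gT.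
Proof.
have [_ _ piS _] := piV; apply/setP => t; rewrite [RHS]inE; apply/fimageP.
by have [x <-] := piS t; exists x.
Qed.

Lemma card_quotient_kappa : #|gT| = (p ^ kappa setT i)%N.
Proof. by rewrite -card_fimage_kappa // fimageT cardsT. Qed.

End Quotient.

Lemma kappaS K H i : is_subgroup K -> is_subgroup H -> K `<=` H ->
  (kappa K i <= kappa H i)%N.
Proof.
have [gT [pi piV]] := zassenhaus_quotient i => sK sH KH.
rewrite -(@leq_exp2l p) ?prime_gt1 // -!(card_fimage_kappa piV) //.
by apply/subset_leq_card/fimageS.
Qed.

Lemma eq_kappa K H i : mulset K (Z i) = mulset H (Z i) -> kappa K i = kappa H i.
Proof. by rewrite /kappa => ->. Qed.

Lemma kappa_words (X : nat -> seq E) i : (0 < i)%N -> weighted p X ->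
  (kappa (gen (generators X)) i <= size (words X i))%N.
Proof.
have [gT [pi piV]] := zassenhaus_quotient i => i0 wX.
rewrite -(@leq_exp2l p) ?prime_gt1 // -(card_fimage_kappa piV); last exact: gen_subgroup.
apply: (card_fimage_det p_pr Ep i0 _ (det_words p_pr wX)).
by move=> x y; apply: (quotient_mapE piV _ _).2.
Qed.

(** Such functions factor through E / Z_i; the 1 added accounts for the empty word, which isolates
    f(1). *)
Lemma dim_kappa i u : (0 < i)%N -> family_in u (@cpol p E i) -> indep u ->
  (size u <= (p ^ kappa setT i).+1)%N.
Proof.
have [gT [pi piV]] := zassenhaus_quotient i => i0 uS ui.
have [_ _ piS _] := piV; have [sg sgK] := choice piS.
rewrite -(card_quotient_kappa piV) cardE -(size_map (fun t => [:: sg t])).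
rewrite -[X in (_ <= X)%N]/(size ([::] :: [seq [:: sg t] | t <- enum gT])).
apply: (@det_bound p E i setT) => //.
  move=> f hf f0 x _; have f1 : f 1%g = 0 by apply: (f0 [::]); rewrite inE.
  have fE y : dif y f 1%g = f y by rewrite difE mul1g f1 subr0.
  have /(zassenhausP p_pr Ep _ i0)/(_ _ (cpol_ltr (sg (pi x)) hf)) :
      Z i ((sg (pi x))^-1 * x)%g by apply/(quotient_mapE piV); rewrite sgK.
  rewrite /ltr mulKVg mulg1 => ->; rewrite -fE.
  by apply: (f0 [:: sg (pi x)]); rewrite inE map_f ?orbT // mem_enum.
by move=> k ku; exists (fnth u k); [exact: uS|exact: restrT].
Qed.

Lemma kappa_T0 : kappa (setT : set E) 0 = 0%N.
Proof.
have [gT [pi piV]] := zassenhaus_quotient 0%N.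
have [_ pi1 piS _] := piV; apply/eqP; rewrite -leqn0.
rewrite -(@leq_exp2l p) ?prime_gt1 // -(card_quotient_kappa piV) expn0.
rewrite -[leqRHS](cards1 (1%g : gT)) -cardsT; apply/subset_leq_card/fintype.subsetP => g _.
by have [x <-] := piS g; rewrite inE; apply/eqP/pi1.
Qed.

End Kappa.

(** * Upper bounds for spaces of polynomials in terms of the indices *)

Section GrowthBound.
Variables (R : realType) (p : nat) (E : topGroupType).
Hypotheses (p_pr : prime p) (Ep : pro_p p E) (Efg : finitely_generated E).
Notation Z := (zassenhaus p E).
Variable tau : R.
Hypothesis tau1 : 1 < tau.

Lemma difw_cat v w (f : E -> 'F_p) : difw (v ++ w) f = difw w (difw v f).
Proof. by rewrite /difw foldl_cat. Qed.

Lemma difw_nseq e y (f : E -> 'F_p) : difw (nseq e y) f = iter e (dif y) f.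
Proof. by elim: e f => //= e IH f; rewrite IH -iterSr. Qed.

(** The bound is 0 in degree 0, so that a degree truncated to 0 by differences contributes no
    words. *)
Definition det_le n (M : set E) (B : R) := forall j, (j <= n)%N ->
  exists ws, det p j M ws /\ (size ws)%:R <= (if j == 0%N then 0 else B * tau ^+ j).

(** On M a function is determined by its differences of orders 0, ..., p - 1 in direction y,
    restricted to M'. Each positive order costs at most tau^-w times the bound, and 1 + p tau^-w <=
    exp(p tau^-w); exponentials turn the product over all steps into a sum. *)
Lemma det_le_step n w (M M' : set E) y B : 0 <= B -> (0 < w)%N -> Z w y ->
  (forall x, M x -> exists a e, [/\ M' a, (e < p)%N & x = (a * y ^+ e)%g]) ->
  det_le n M' B -> det_le n M (B * expR (p%:R * tau ^- w)).
Proof.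
move=> B0 w0 Zy MP dM j jn.
have [->|j0] := eqVneq j 0%N.
  by exists [::]; split=> // f [_ /= ->].
have [ws wsP] : exists ws : nat -> seq (seq E), forall k, (k <= n)%N ->
    det p k M' (ws k) /\ (size (ws k))%:R <= (if k == 0%N then 0 else B * tau ^+ k).
  have H k : exists ws, (k <= n)%N -> det p k M' ws /\
      (size ws)%:R <= (if k == 0%N then 0 else B * tau ^+ k).
    by have [/dM[ws ?]|_] := leqP k n; [exists ws|exists [::]].
  by have [ws wsP] := choice H; exists ws.
have jle e : (j - e * w <= n)%N by rewrite (leq_trans (leq_subr _ _)).
exists (flatten [seq [seq nseq e y ++ v | v <- ws (j - e * w)%N] | e <- iota 0 p]); split.
  move=> f hf f0 x /MP[a [e [M'a ep ->]]].
  rewrite -[LHS]/(rtr (y ^+ e)%g f a) rtrX.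
  have iz i : (i < p)%N -> iter i (dif y) f a = 0.
    move=> ip; apply: (wsP _ (jle i)).1 => //.
      elim: i {ip} => [|i IH]; first by rewrite mul0n subn0.
      by rewrite iterS mulSn addnC subnDA; exact: (zassenhaus_lowers p_pr w0 Zy IH).
    move=> v vw; rewrite -difw_nseq -difw_cat; apply: f0; apply/flattenP.
    exists [seq nseq i y ++ v | v <- ws (j - i * w)%N]; last exact: map_f.
    by apply/mapP; exists i => //; rewrite mem_iota.
  rewrite fct_sumE big1 // => i _.
  have fMn (g : E -> 'F_p) m : (g *+ m) a = g a *+ m.
    by elim: m => [|m IH]; rewrite ?mulr0n// !mulrS faddE IH.
  by rewrite fMn iz ?mul0rn // (leq_trans (ltn_ord i)).
rewrite size_flatten /shape -map_comp.
have tau0 : 0 < tau by exact: lt_trans ltr01 tau1.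
have szle e : (size (ws (j - e * w)%N))%:R <= B * tau ^+ j * (if e == 0%N then 1 else tau ^- w).
  apply: le_trans (wsP _ (jle e)).2 _.
  have h0 : 0 <= B * tau ^+ j * (if e == 0%N then 1 else tau ^- w).
    have ht k : 0 <= tau ^+ k by rewrite exprn_ge0 // ltW.
    by apply: mulr_ge0; [exact: mulr_ge0|case: ifP => _; rewrite ?invr_ge0].
  case: ifP => // /eqP/eqP je; rewrite -mulrA; apply: ler_wpM2l => //.
  case: (eqVneq e 0%N) => [->|e0]; first by rewrite mul0n subn0 mulr1.
  rewrite -expfB_cond ?gt_eqF //=; last by rewrite -lt0n in e0; move: je e0; clear; nia.
  rewrite ler_weXn2l ?ltW // leq_sub2l // leq_pmull // lt0n //.
have sumE (es : seq nat) : {in es, forall e, e != 0%N} ->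
    (sumn [seq size [seq nseq e y ++ v | v <- ws (j - e * w)%N] | e <- es])%:R
    <= B * tau ^+ j * ((size es)%:R * tau ^- w) :> R.
  elim: es => [|e es IH] ez /=; first by rewrite mulr0n mul0r mulr0.
  rewrite natrD -natr1 addrC mulrDl mul1r mulrDr; apply: lerD.
    by apply: IH => k ks; apply: ez; rewrite inE ks orbT.
  by rewrite size_map; have := szle e; rewrite (negbTE (ez e (mem_head _ _))).
have Bt : 0 <= B * tau ^+ j by rewrite mulr_ge0 // exprn_ge0 ?ltW.
apply: (@le_trans _ _ (B * tau ^+ j * (1 + p%:R * tau ^- w))); last first.
  by rewrite mulrAC; apply: ler_wpM2r; [rewrite exprn_ge0 ?ltW|apply: ler_wpM2l => //;
    exact: expR_ge1Dx].
have -> : iota 0 p = 0%N :: iota 1 p.-1 by case: (p) (prime_gt0 p_pr).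
rewrite /= natrD mulrDr mulr1; apply: lerD.
  by rewrite size_map; have := szle 0%N; rewrite eqxx mulr1.
apply: le_trans (sumE _ _) _; first by move=> e; rewrite mem_iota; case: e.
apply: ler_wpM2l => //; apply: ler_wpM2r; first by rewrite invr_ge0 exprn_ge0 ?ltW.
by rewrite size_iota ler_nat leq_pred.
Qed.

Lemma card_quotient_zeta n i (gT : finGroupType) (pi : E -> gT)
    (piV : quotient_map p (Z n) pi) :
  (#|gT| <= p ^ kappa p (setT : set E) i * #|quotient_zeta p_pr piV i|)%N.
Proof.
have [gT' [pi' piV']] := zassenhaus_quotient p_pr Ep Efg i.
have [_ _ piS _] := piV; have [sg sgK] := choice piS.
have [_ _ piS' _] := piV'; have [sg' sgK'] := choice piS'.
pose f t : gT' * gT := (pi' (sg t), ((pi (sg' (pi' (sg t))))^-1 * t)%g).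
have f_inj : injective f.
  by move=> t t' [e]; rewrite e => /mulgI.
rewrite -(card_quotient_kappa p_pr piV') -[X in (_ <= X * _)%N]cardsT -[X in (_ <= X)%N]cardsX.
rewrite -cardsT -(card_imset _ f_inj); apply: subset_leq_card;
  apply/fintype.subsetP => _ /imsetP[t _ ->].
rewrite inE /= inE /=; apply/fimageP.
exists ((sg' (pi' (sg t)))^-1 * sg t)%g; first by apply/(quotient_mapE piV'); rewrite sgK'.
by have [piM _ _ _] := piV; rewrite piM (quotient_mapV piV) sgK.
Qed.

(** Layer v of the series takes at most kappa (v + 1) applications of [det_le_step], each with
    factor exp(p tau^-v). *)
Lemma det_le_zeta n w (gT : finGroupType) (pi : E -> gT) (piV : quotient_map p (Z n) pi) :
  (0 < n)%N -> (w < n)%N ->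
  det_le n (fun x => pi x \in quotient_zeta p_pr piV (n - w)%N)
    (expR (p%:R * \sum_(n - w <= v < n) (kappa p (setT : set E) v.+1)%:R * tau ^- v)).
Proof.
move=> n0; elim: w => [_|w IH wn].
  rewrite subn0 big_geq // mulr0 expR0 => j jn; have [->|j0] := eqVneq j 0%N.
    by exists [::]; split=> // f [_ /= ->].
  exists [:: [::]]; split; last by rewrite /= mul1r exprn_ege1 // ltW.
  move=> f hf f0 x /fimageP[x' Zx' xx'].
  have Zx : Z n x.
    apply/(let: And4 _ k _ _ := piV in k x); rewrite -xx'; exact/(let: And4 _ k _ _ := piV in k x').
  have /zassenhausP -> // : Z j x by apply: zassenhaus_le jn _ Zx.
    exact: (f0 [::]).
  by rewrite lt0n.
have {IH} := IH (ltnW wn).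
set w' := (n - w.+1)%N; have w'E : (n - w = w'.+1)%N by rewrite /w' subnSK //; exact: ltnW.
rewrite w'E; set B := expR _ => IH; have w'0 : (0 < w')%N by rewrite /w' subn_gt0.
have tau0 : 0 < tau by exact: lt_trans ltr01 tau1.
have [|k M' M y [[zM' Mz M'M yM yM'] [yN MP]] PM|k Pk kc] := @layer_ind p gT
    (quotient_zeta p_pr piV) p_pr
    (@quotient_zeta_dec _ _ p_pr Ep _ _ _ piV) (@quotient_zetaR _ _ p_pr _ _ _ piV)
    (@quotient_zetaX _ _ p_pr _ _ _ piV)
    (let: And4 _ _ _ k := piV in k) w'
    (fun k M => det_le n (fun x => pi x \in M) (B * expR (p%:R * k%:R * tau ^- w'))) w'0.
- by rewrite mulr0 mul0r expR0 mulr1.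
- have /fimageP[y0 Zy0 yE] := fintype.subsetP Mz _ yM.
  have -> : B * expR (p%:R * k.+1%:R * tau ^- w')
      = B * expR (p%:R * k%:R * tau ^- w') * expR (p%:R * tau ^- w').
    by rewrite -natr1 mulrDr mulr1 mulrDl expRD mulrA.
  apply: (det_le_step _ w'0 Zy0 _ PM); first by rewrite mulr_ge0 ?expR_ge0.
  move=> x /MP[a [e [aM ep xE]]]; exists (x * (y0 ^+ e)^-1)%g, e; split; rewrite ?mulgVK //.
  have [piM _ _ _] := piV.
  by rewrite piM (quotient_mapV piV) (quotient_mapX piV) yE xE mulgK.
move=> j jn; have [ws [dws sws]] := Pk j jn; exists ws; split => //.
apply: le_trans sws _; case: ifP => // _; apply: ler_wpM2r; first by rewrite exprn_ge0 ?ltW.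
rewrite big_ltn; last by rewrite /w' ltn_subrL n0.
rewrite addrC mulrDr expRD; apply: ler_wpM2l; first exact: expR_ge0.
rewrite ler_expR -mulrA; apply: ler_wpM2l => //; apply: ler_wpM2r.
  by rewrite invr_ge0 exprn_ge0 ?ltW.
rewrite ler_nat -(@leq_exp2l p) ?prime_gt1 //.
have := leq_trans kc (leq_trans (max_card _) (card_quotient_zeta w'.+1 piV)).
by rewrite leq_pmul2r // cardG_gt0.
Qed.

(** The bridge from indices to polynomials: if kappa is O(nu^i) for some nu < tau, the exponent is
    bounded and the dimension is O(tau^n). *)
Lemma indep_growth n u : family_in u (@cpol p E n) -> indep u ->
  (size u)%:R <= tau ^+ n *
    expR (p%:R * \sum_(1 <= v < n) (kappa p (setT : set E) v.+1)%:R * tau ^- v).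
Proof.
move=> uS ui; have [n0|n0] := posnP n.
  move: uS; rewrite n0; case: u ui => [|f u] ui uS.
    by rewrite mulr_ge0 ?expR_ge0.
  have [_ f0] := uS 0%N isT; have := ui (fun i => (i == 0%N)%:R) _ 0%N isT.
  rewrite eqxx => /(_ _)/eqP; rewrite oner_eq0 => h; exfalso; suff: false by []; apply: h.
  apply/funext => x; rewrite /lin big_ord_recl /= big1 => [|i _]; last by rewrite mul0r.
  have fz : f = 0 by [].
  by rewrite /fnth /= fz mulr0 addr0.
have [gT [pi piV]] := zassenhaus_quotient p_pr Ep Efg n.
have [|ws []] := @det_le_zeta n n.-1 gT pi piV n0 _ n (leqnn n); first by rewrite ltn_predL.
have -> : (n - n.-1 = 1)%N by move: n0; clear; lia.
move=> dws; rewrite gtn_eqF // mulrC => sws; apply: le_trans sws; rewrite ler_nat.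
have dT : det p n setT ws.
  by move=> f hf f0 x _; apply: dws => //; exact: quotient_zeta_top.
apply: (det_bound dT) => // k ku; exists (fnth u k); [exact: uS|exact: restrT].
Qed.

End GrowthBound.

(** * Lower bounds for the growth *)

Section RealLemmas.
Variable R : realType.
Implicit Types (x q C lam : R) (n m : nat) (a : nat -> nat).

Lemma bernoulli x n : 0 <= x -> 1 + n%:R * x <= (1 + x) ^+ n.
Proof.
move=> x0; elim: n => [|n IH]; first by rewrite mul0r addr0.
rewrite exprS; apply: (@le_trans _ _ ((1 + x) * (1 + n%:R * x))); last first.
  by apply: ler_wpM2l; [rewrite addr_ge0|].
rewrite -natr1 -subr_ge0; have -> : (1 + x) * (1 + n%:R * x) - (1 + (n%:R + 1) * x) = n%:R * (x * x) by ring.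
by rewrite !mulr_ge0.
Qed.

Lemma exp_unbounded x C : 1 < x -> exists n, C < x ^+ n.
Proof.
move=> x1; have x0 : 0 < x - 1 by rewrite subr_gt0.
have [c0|c0] := ltP C 0; first by exists 0%N; rewrite (lt_le_trans c0).
have := archi_boundP (divr_ge0 c0 (ltW x0)); set n := Num.bound _ => h.
exists n; apply: lt_le_trans (_ : 1 + n%:R * (x - 1) <= _).
  by rewrite -ltrBlDl; apply: lt_trans (_ : C < _); rewrite ?ltrBlDl ?ltrDr // -ltr_pdivrMr.
by have := bernoulli n (ltW x0); rewrite [1 + (x - 1)]addrC subrK.
Qed.

Lemma geometric_sum_le q n : 0 <= q -> q < 1 -> \sum_(0 <= i < n) q ^+ i <= (1 - q)^-1.
Proof.
move=> q0 q1; have q1' : 0 < 1 - q by rewrite subr_gt0.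
rewrite -[leRHS]mul1r ler_pdivlMr //.
have -> : (\sum_(0 <= i < n) q ^+ i) * (1 - q) = 1 - q ^+ n.
  elim: n => [|n IH]; first by rewrite big_geq // mul0r subrr.
  by rewrite big_nat_recr //= mulrDl IH exprS; ring.
by rewrite gerBl exprn_ge0.
Qed.

(** For 1 < lam this says limsup a_i^(1/i) >= lam, without roots. *)
Definition big lam a := forall mu C, 1 < mu -> mu < lam ->
  ~ forall i, (a i)%:R <= C * mu ^+ i.

Lemma big_le lam a b k : big lam a -> 1 < lam -> (forall i, (a i <= b i + k * i)%N) -> big lam b.
Proof.
move=> ba l1 ab mu C mu1 mul bC.
pose e := mu - 1; have e0 : 0 < e by rewrite subr_gt0.
apply: (ba mu (C + k%:R / e) mu1 mul) => i; have := ab i; rewrite -(ler_nat R) => /le_trans; apply.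
rewrite natrD mulrDl; apply: lerD => //; rewrite natrM -mulrA; apply: ler_wpM2l => //.
rewrite -ler_pdivrMl ?invr_gt0 // invrK mulrC.
have := bernoulli i (ltW e0); rewrite /e [1 + (mu - 1)]addrC subrK; apply: le_trans.
by rewrite lerDr.
Qed.

End RealLemmas.

Section LowerGrowth.
Variables (R : realType) (p : nat) (E : topGroupType).
Hypotheses (p_pr : prime p) (Ep : pro_p p E) (Efg : finitely_generated E).
Variables (cl : (E -> E -> 'F_p) -> 'F_p) (rho : bool).
Hypothesis clP : class_map cl.
Hypothesis cl0 : ~~ rho -> forall c, cocycle2 c -> cl c = 0.
Variable chis : seq (E -> 'F_p).
Hypotheses (chiS : family_in chis (@hom1 p E)) (chi_i : indep chis).
Variables (lam mu : R).
Hypotheses (lam1 : 1 < lam) (mu0 : 0 <= mu).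
Hypotheses (lamD : (size chis)%:R = lam + mu) (lamM : rho%:R = lam * mu).

(** The recursion of [golod_shafarevich] factors over the roots lam and mu: c_n = b_(n+1) - mu b_n
    satisfies c_(n+1) >= lam c_n + 1, whence c_n >= lam^n. *)
Lemma adapted_growth n : exists s t, [/\ @adapted_basis p E n s, @adapted_basis p E n.+1 (s ++ t) &
  lam ^+ n + mu * (size s)%:R <= (size (s ++ t))%:R].
Proof.
elim: n => [|n [s [t [bs bst st]]]].
  have b0 := adapted_basis0 p E; have [t bt] := adapted_basis_step p_pr Efg b0.
  exists [::], t; split=> //; rewrite mulr0 addr0 ler1n.
  have [_ _ sp _] := bt; have [a] := sp _ (@cpol_cst p E 0 1).
  case: (t) => // /(congr1 (@^~ 1%g)) /eqP; rewrite /lin big_ord0 /=.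
  by rewrite oner_eq0.
have [t' bt'] := adapted_basis_step p_pr Efg bst.
exists (s ++ t), t'; split=> //.
have := golod_shafarevich clP cl0 chiS chi_i bs bst bt'.
rewrite -(ler_nat R) !natrD !natrM lamD lamM => h.
have := ler_wpM2l (ltW (lt_trans ltr01 lam1)) st.
by rewrite exprS; move: h; lra.
Qed.

Lemma lower_growth n : exists u : seq (E -> 'F_p),
  [/\ family_in u (@cpol p E n.+1), indep u & lam ^+ n <= (size u)%:R].
Proof.
have [s [t [_ [fu iu _ _] st]]] := adapted_growth n; exists (s ++ t); split=> //.
by apply: le_trans st; rewrite lerDl mulr_ge0.
Qed.

(** Only linear, because a group of order p^k carries up to p^k independent functions. It makes
    errors of size O(log n) negligible. *)
Lemma kappa_lower n : n%:R * ln lam <= (kappa p (setT : set E) n.+1).+1%:R * ln p%:R.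
Proof.
have [u [fu iu nu]] := lower_growth n.
have := dim_kappa p_pr Ep Efg (ltn0Sn n) fu iu; set k := kappa _ _ _ => ku.
have lam0 : 0 < lam by exact: lt_trans ltr01 lam1.
have p0 : 0 < p%:R :> R by rewrite ltr0n prime_gt0.
rewrite !mulr_natl -!lnXn // ler_ln ?posrE ?exprn_gt0 //.
apply: le_trans nu _; rewrite -natrX ler_nat (leq_trans ku) // expnS.
have := prime_gt1 p_pr; have : (0 < p ^ k)%N by rewrite expn_gt0 prime_gt0.
move: (p ^ k)%N; clear; nia.
Qed.

(** Were kappa O(nu^i) with nu < lam, [indep_growth] at the midpoint tau of nu and lam would bound
    the dimension by O(tau^n), against [lower_growth]. *)
Lemma kappa_big : big lam (kappa p (setT : set E)).
Proof.
move=> nu C nu1 nul kC.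
pose tau := (nu + lam) / 2.
have nut : nu < tau by rewrite /tau; lra.
have taul : tau < lam by rewrite /tau; lra.
have tau1 : 1 < tau by exact: lt_trans nut.
have tau0 : 0 < tau by exact: lt_trans ltr01 tau1.
have C0 : 0 <= C by have := kC 0%N; rewrite expr0 mulr1; exact: le_trans.
pose q := nu / tau; have q0 : 0 <= q by rewrite divr_ge0 ?ltW // (lt_trans ltr01).
have q1 : q < 1 by rewrite ltr_pdivrMr // mul1r.
pose D := p%:R * (C * nu * (1 - q)^-1).
have lt1 : 1 < lam / tau by rewrite ltr_pdivlMr // mul1r.
have [n] := exp_unbounded (tau * expR D) lt1; apply/negP; rewrite -leNgt.
rewrite expr_div_n ler_pdivrMr ?exprn_gt0 //.
have [u [fu iu nu']] := lower_growth n.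
apply: le_trans nu' _; apply: le_trans (indep_growth p_pr Ep Efg tau1 fu iu) _.
rewrite exprS mulrAC; apply: ler_wpM2r; first by rewrite exprn_ge0 ?ltW.
apply: ler_wpM2l; first exact: ltW.
rewrite ler_expR; apply: ler_wpM2l => //.
have nu0 : 0 <= nu by rewrite ltW // (lt_trans ltr01).
apply: le_trans (_ : \sum_(0 <= v < n.+1) C * nu * q ^+ v <= _).
  rewrite [leRHS]big_nat_recl // -[leLHS]add0r; apply: lerD; first by rewrite !mulr_ge0.
  rewrite big_add1 /= !big_nat; apply: ler_sum => v _.
  rewrite /q [(nu / tau) ^+ _]expr_div_n [leRHS]mulrA; apply: ler_wpM2r;
    first by rewrite invr_ge0 exprn_ge0 ?ltW.
  by apply: le_trans (kC _) _; rewrite exprS mulrA.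
rewrite -mulr_sumr; apply: ler_wpM2l; first by rewrite mulr_ge0.
exact: geometric_sum_le.
Qed.

End LowerGrowth.

(** * Dual bases of homomorphisms *)

Section Duality.
Variables (p : nat) (E : topGroupType).
Hypotheses (p_pr : prime p) (Ep : pro_p p E) (Efg : finitely_generated E).
Notation cpol := (@cpol p E).
Notation hom1 := (@hom1 p E).
Notation Z := (zassenhaus p E).
Implicit Types (chis : seq (E -> 'F_p)) (chi psi f : E -> 'F_p) (xs : nat -> E) (x y g : E).

Lemma hom1_linear : linear_set hom1.
Proof.
split; first by split; [exact: (lc_cst _ 0)|move=> *; rewrite addr0].
move=> c f g [lf hf] [lg hg]; split; last by move=> x y; rewrite hf hg; ring.
by have := lcD (lcZ c lf) lg.
Qed.

Lemma hom1_1 chi : hom1 chi -> chi 1%g = 0.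
Proof. by move=> [_ h]; apply: (@addrI _ (chi 1%g)); rewrite -h mulg1 addr0. Qed.

Lemma hom1V chi x : hom1 chi -> chi x^-1%g = - chi x.
Proof.
by move=> hh; apply: (@addrI _ (chi x)); rewrite -hh.2 mulgV subrr hom1_1.
Qed.

Lemma hom1X chi x n : hom1 chi -> chi (x ^+ n)%g = n%:R * chi x.
Proof.
move=> hh; elim: n => [|n IH]; first by rewrite expg0 hom1_1 // mul0r.
by rewrite expgSr hh.2 IH -natr1 mulrDl mul1r.
Qed.

Lemma natr_valFp (a : 'F_p) : (nat_of_ord a)%:R = a.
Proof. exact: natr_Zp. Qed.

Lemma hom1_family_bound : exists m, forall s, family_in s hom1 -> indep s ->
  (size s <= m)%N.
Proof.
have [X gX] := Efg; exists (size X) => s sS si.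
apply: (@indep_bound _ _ s (size X) (fun i k => fnth s i (nth 1%g X k)) si) => a h.
have hl : hom1 (lin s a) by exact: lin_in hom1_linear sS.
apply: (tgen_lc gX hl.1) => x; move: x; apply: (@gen_min _ _ [set x | lin s a x = 0]).
  split; first exact: hom1_1.
  by move=> x y /= hx hy; rewrite hl.2 (hom1V _ hl) hx hy subrr.
by move=> x /= xX; have := h (index x X); rewrite index_mem xX nth_index // => /(_ isT).
Qed.

Lemma hom1_basis s : family_in s hom1 -> indep s -> exists t,
  [/\ family_in (s ++ t) hom1, indep (s ++ t) &
    forall f, hom1 f -> exists a, f = lin (s ++ t) a].
Proof. have [m h] := hom1_family_bound => sS si; exact: extend_indep hom1_linear sS si h. Qed.

Fixpoint prodX xs (a : nat -> 'F_p) n : E :=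
  if n is m.+1 then (prodX xs a m * xs m ^+ (a m : nat))%g else 1%g.

Lemma hom1_prodX chi xs a n : hom1 chi ->
  chi (prodX xs a n) = \sum_(i < n) a i * chi (xs i).
Proof.
move=> hh; elim: n => [|n IH]; first by rewrite big_ord0 /= hom1_1.
by rewrite big_ord_recr /= hh.2 IH hom1X // natr_valFp.
Qed.

Definition dual chis xs := forall i j, (i < size chis)%N -> (j < size chis)%N ->
  fnth chis i (xs j) = (i == j)%:R.

Lemma sum_delta n (F : nat -> 'F_p) i : (i < n)%N ->
  \sum_(k < n) F k * (i == k)%:R = F i.
Proof.
move=> ik; rewrite (bigD1 (Ordinal ik)) //= eqxx mulr1 big1 ?addr0 // => k.
by rewrite -val_eqE /= eq_sym => /negbTE ->; rewrite mulr0.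
Qed.

(** Gram-Schmidt: f is corrected to g, which vanishes on the dual elements found so far. An element
    where g is nonzero is moved into the common kernel of s and scaled, and the earlier elements are
    corrected by powers of it. *)
Lemma ex_dual chis : family_in chis hom1 -> indep chis -> exists xs, dual chis xs.
Proof.
elim/last_ind: chis => [_ _|s f IH]; first by exists (fun=> 1%g).
rewrite family_in_rcons => -[sS hf] si.
have [|xs dx] := IH sS; first by apply: (@indepl _ _ s [:: f]); rewrite cats1.
pose m := size s; pose g := lin (rcons s f) (fun i => if (i < m)%N then - f (xs i) else 1).
have gE x : g x = f x - \sum_(i < m) f (xs i) * fnth s i x.
  rewrite /g lin_rcons ltnn mul1r addrC; congr (_ + _); rewrite -sumrN.
  by apply: eq_bigr => i _; rewrite ltn_ord mulNr.
have hg : hom1 g by apply: (lin_in _ hom1_linear); apply/family_in_rcons.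
have [y gy] : exists y, g y != 0.
  apply: contrapT => ny; have := si (fun i => if (i < m)%N then - f (xs i) else 1) _ m.
  rewrite size_rcons ltnn ltnS leqnn => h; have/eqP : (1 : 'F_p) = 0.
    apply: h => //; apply/funext => x; apply/eqP; apply: contrapT => /negP gx.
    by apply: ny; exists x.
  by rewrite oner_eq0.
have gx i : (i < m)%N -> g (xs i) = 0.
  move=> im; rewrite gE (eq_bigr (fun k : 'I_m => f (xs k) * (i == k)%:R)).
    by rewrite (sum_delta (fun k => f (xs k)) im) subrr.
  by move=> k _; rewrite dx // eq_sym.
pose y1 := (y * (prodX xs (fun i => fnth s i y) m)^-1)%g.
have sy1 i : (i < m)%N -> fnth s i y1 = 0.
  move=> im; rewrite (sS i im).2 (hom1V _ (sS i im)) hom1_prodX; last exact: sS.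
  rewrite (eq_bigr (fun k : 'I_m => fnth s k y * (i == k)%:R)).
    by rewrite (sum_delta (fun k => fnth s k y)) // subrr.
  by move=> k _; rewrite dx.
have gy1 : g y1 = g y.
  rewrite hg.2 (hom1V _ hg) hom1_prodX // big1 ?subr0 // => k _.
  by rewrite gx ?mulr0.
have fy1 : f y1 = g y.
  by rewrite -gy1 gE big1 ?subr0 // => k _; rewrite sy1 ?mulr0.
have [c cE] : exists c : 'F_p, c * g y = 1 by exists (g y)^-1; rewrite mulVf.
pose y2 := (y1 ^+ c)%g.
have fy2 : f y2 = 1 by rewrite hom1X // natr_valFp fy1.
have sy2 i : (i < m)%N -> fnth s i y2 = 0.
  by move=> im; rewrite (hom1X _ _ (sS i im)) sy1 // mulr0.
exists (fun i => if (i < m)%N then (xs i * y2 ^+ (- f (xs i) : 'F_p))%g else y2).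
have rE i : fnth (rcons s f) i = if (i < m)%N then fnth s i else if i == m then f else (fun=> 0).
  by rewrite /fnth nth_rcons.
move=> i j; rewrite size_rcons !ltnS -/m => im jm; rewrite rE.
case: ifP => [iltm|/negbT]; last rewrite -leqNgt => mi.
  case: ifP => jlt; last first.
    rewrite sy2 //; suff -> : (i == j) = false by [].
    by apply/negbTE; rewrite neq_ltn (leq_trans iltm) // leqNgt jlt.
  rewrite (sS i iltm).2 (hom1X _ _ (sS i iltm)) sy2 // mulr0 addr0; exact: dx.
have -> : i = m by apply/eqP; rewrite eqn_leq im.
rewrite eqxx; case: ifP => [jlt|/negbT].
  by rewrite hf.2 hom1X // natr_valFp fy2 mulr1 subrr gtn_eqF.
by rewrite -leqNgt => mj; rewrite fy2 eqn_leq mj jm.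
Qed.

Lemma cpol2_hom f : cpol 2 f -> hom1 (fun x => f x - f 1%g).
Proof.
move=> hf; have := cpolD hf (cpolN (cpol_cst E 1 (f 1%g))) => -[l q].
split=> // x y; have /polf1/(congr1 (@^~ x)) := hf.2 y.
rewrite difE /= difE mul1g => /eqP; rewrite subr_eq => /eqP ->;
  rewrite -[cst _ x]/(f y - f 1%g); move: (f y) (f x) (f 1%g) => u v w; ring.
Qed.

Variables (chis : seq (E -> 'F_p)) (xs : nat -> E).
Hypotheses (chiS : family_in chis hom1) (chi_i : indep chis).
Hypothesis chi_span : forall f, hom1 f -> exists a, f = lin chis a.
Hypothesis dx : dual chis xs.
Let d := size chis.

Lemma hom1_expand f x : hom1 f -> f x = \sum_(i < d) f (xs i) * fnth chis i x.
Proof.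
move=> /chi_span[a ->]; apply: eq_bigr => i _; congr (_ * _).
rewrite /lin (eq_bigr (fun k : 'I_d => a k * (nat_of_ord i == k)%:R));
  first by rewrite (sum_delta a).
by move=> k _; rewrite dx // eq_sym.
Qed.

Lemma zassenhaus2 x : (forall i, (i < d)%N -> fnth chis i x = 0) -> Z 2 x.
Proof.
move=> h; apply/(zassenhausP p_pr Ep) => // f /cpol2_hom/(hom1_expand x) /eqP.
rewrite big1 => [|i _]; last by rewrite h ?mulr0.
by rewrite subr_eq0 => /eqP.
Qed.

(** Modulo degree n - 2 the operator [dif g] is additive in g and vanishes on Z_2, so g may be
    replaced by a product of powers of the xs on which all chis take the same values. *)
Lemma dif_expand n f g : cpol n f ->
  cpol (n - 2) (dif g f - \sum_(i < d) fnth chis i g \*o dif (xs i) f).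
Proof.
move=> hf.
have MM a b : cpol (n - 2) (dif (a * b)%g f - dif a f - dif b f).
  rewrite difM; have -> : forall u v w : E -> 'F_p, u + v + w - v - w = u.
    by move=> u v w; rewrite addrAC addrK addrK.
  by have := cpol_dif a (cpol_dif b hf); rewrite subn2.
have MX a k : cpol (n - 2) (dif (a ^+ k)%g f - (k%:R : 'F_p) \*o dif a f).
  elim: k => [|k IH].
    have -> : dif (a ^+ 0)%g f - (0%:R : 'F_p) \*o dif a f = 0; last exact: cpol0.
    by apply/funext => x; rewrite expg0 dif1 faddE foppE fscaleE mul0r subrr.
  have := cpolD (MM (a ^+ k)%g a) IH; congr (cpol _ _); apply/funext => x.
  by rewrite expgSr !(faddE, foppE, fscaleE) -natr1; ring.
pose a i := fnth chis i g.
have MP k : cpol (n - 2) (dif (prodX xs a k) f - \sum_(i < k) a i \*o dif (xs i) f).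
  elim: k => [|k IH]; first by rewrite big_ord0 subr0 dif1; exact: cpol0.
  have := cpolD (cpolD (MM (prodX xs a k) (xs k ^+ (a k : nat))%g) IH) (MX (xs k) (a k)).
  congr (cpol _ _); apply/funext => x.
  by rewrite big_ord_recr /= natr_valFp !(faddE, foppE, fscaleE); ring.
pose z := ((prodX xs a d)^-1 * g)%g.
have Zz : Z 2 z.
  apply: zassenhaus2 => i id; rewrite (chiS id).2 (hom1V _ (chiS id)).
  rewrite hom1_prodX; last exact: chiS.
  rewrite (eq_bigr (fun k : 'I_d => a k * (i == k)%:R)) ?(sum_delta a id) ?addNr //.
  by move=> k _; rewrite dx.
have lz : cpol (n - 2) (dif z f) by exact: zassenhaus_lowers Zz _ _ hf.
have := cpolD (cpolD (MM (prodX xs a d) z) (MP d)) lz.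
congr (cpol _ _); apply/funext => x.
by rewrite /z mulKVg !(faddE, foppE, fscaleE); ring.
Qed.

Lemma cpol_of_generators n f : cpol n.+2 f ->
  (forall i, (i < d)%N -> cpol n (dif (xs i) f)) -> cpol n.+1 f.
Proof.
move=> hf hx; split=> [|g]; first exact: hf.1.
have := dif_expand g hf; rewrite subn2 /= => h.
have hs : cpol n (\sum_(i < d) fnth chis i g \*o dif (xs i) f).
  by apply: cpol_sum => i _; apply: cpolZ; exact: hx.
by have := (cpolD h hs).2; rewrite subrK.
Qed.

Variable cl : (E -> E -> 'F_p) -> 'F_p.
Hypothesis clP : class_map cl.

Lemma tensor_cocycle chi psi : hom1 chi -> hom1 psi -> cocycle2 (fun x y => chi x * psi y).
Proof.
move=> h1 h2; split; last by move=> x y z; rewrite h1.2 h2.2; ring.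
have [[V oV cV] [W oW cW]] := (h1.1, h2.1).
exists (V `&` W); first exact: open_normalI.
by move=> x y v w [Vv _] [_ Ww]; rewrite cV // cW.
Qed.

(** The matrix of the cup product on H^1 in the basis chis. *)
Definition gram i j := cl (fun x y => fnth chis i x * fnth chis j y).

(** The second difference m(x, y) of F at 1 is bilinear, hence a combination of products of the
    chis, and it is a coboundary; the left side is its class. *)
Lemma relation_cpol3 F : cpol 3 F ->
  \sum_(i < d) \sum_(j < d) gram i j * dif (xs i) (dif (xs j) F) 1%g = 0.
Proof.
move=> hF; pose m x y := dif x (dif y F) 1%g.
have mE x y : m x y = F (x * y)%g - F x - F y + F 1%g.
  by rewrite /m !difE !mul1g; ring.
have hl y : hom1 (m^~ y).
  by have := cpol2_hom (cpol_dif y hF); congr hom1; apply/funext => x; rewrite mE !difE mul1g; ring.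
have hr x : hom1 (m x).
  have h2 : cpol 2 (difl x F) by split; [exact: lc_difl hF.1|exact: polf_difl hF.2].
  by have := cpol2_hom h2; congr hom1; apply/funext => y; rewrite mE /difl mulg1; ring.
have mexp : m = fun x y => \sum_(i < d) \sum_(j < d)
    m (xs i) (xs j) * (fnth chis i x * fnth chis j y).
  apply/funext => x; apply/funext => y; rewrite (hom1_expand x (hl y)).
  apply: eq_bigr => i _; rewrite (hom1_expand y (hr (xs i))) mulr_suml.
  by apply: eq_bigr => j _; ring.
have cocn i j : cocycle2 (fun x y => fnth chis i x * fnth chis j y).
  have hn k : hom1 (fnth chis k).
    have [kd|dk] := ltnP k d; first exact: chiS.
    by rewrite /fnth nth_default //; exact: hom1_linear.1.
  by apply: tensor_cocycle.
have cocm i j : cocycle2 (fun x y => m (xs i) (xs j) * (fnth chis i x * fnth chis j y)).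
  exact: cocycle2Z.
have S1 i := class_map_sum clP d (cocm i).
have [S2 cm] := class_map_sum clP d (fun i => (S1 i).2).
have m0 : cl m = 0.
  apply/clP.2; first by rewrite mexp.
  exists (cst (F 1%g) - F); first by apply: lcD; [exact: lc_cst|exact: lcN hF.1].
  by move=> x y; rewrite mE !faddE !foppE /cst; move: (F 1%g) (F x) (F y) => u v w; ring.
transitivity (cl m) => //; rewrite mexp S2; apply: eq_bigr => i _; rewrite (S1 i).1.
by apply: eq_bigr => j _; rewrite class_mapZ // mulrC.
Qed.

(* The relation of a Demushkin group, seen as a differential operator: its
   principal part sends degree n to degree n - 3 instead of n - 2. *)
Lemma relation_cpol n f : cpol n f ->
  cpol (n - 3) (\sum_(i < d) \sum_(j < d) gram i j \*o dif (xs i) (dif (xs j) f)).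
Proof.
have [n3|] := ltnP n 3.
  move=> hf; have -> : (n - 3 = n.-1.-1)%N by move: n3; clear; lia.
  by do 2![apply: cpol_sum => ? _]; apply: cpolZ; exact: cpol_dif (cpol_dif _ hf).
move=> /subnK {1}<-; elim: (n - 3)%N f => {n} [|k IH] f hf.
  pose r i := \sum_(j < d) gram i j \*o dif (xs i) (dif (xs j) f).
  have h1 : cpol 1 (\sum_(i < d) r i).
    by apply: cpol_sum => i _; rewrite /r; apply: cpol_sum => j _; apply: cpolZ;
      exact: cpol_dif (cpol_dif _ hf).
  split; first exact: h1.1.
  have /polf1 e := h1.2; apply/funext => x;
    rewrite [LHS](congr1 (@^~ x) e) /r -[RHS](relation_cpol3 hf) fct_sumE.
  by apply: eq_bigr => i _; rewrite fct_sumE.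
split.
  do 2![apply: lc_sum => ? _]; apply: lcZ; do 2![apply: lc_dif]; exact: hf.1.
(* Left differences commute with the operator and lower the degree, so the induction descends to
   degree 3, where the operator yields a constant and [relation_cpol3] gives its value. *)
apply: difl_polf => y.
have hy : cpol (k + 3) (difl y f) by split; [exact: lc_difl hf.1|exact: polf_difl hf.2].
have := (IH _ hy).2; congr (polf _ _); apply/funext => x.
rewrite /difl !fct_sumE -sumrB; apply: eq_bigr => i _; rewrite !fct_sumE -sumrB.
apply: eq_bigr => j _; rewrite !fscaleE -mulrBr !difE !mulgA.
by congr (_ * _); ring.
Qed.

End Duality.

(** * A subgroup of small codimension *)

Section PolynomialFunctions.
Variables (p : nat) (gT : finGroupType).
Hypotheses (p_pr : prime p) (pG : p.-nat #|gT|).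
Implicit Types (M : {group gT}) (h : gT -> 'F_p).
Local Notation G := [set: gT]%G.

Definition invariant M h := forall x u, u \in M -> h (x * u)%g = h x.

Definition polynomial_mod M := exists m, forall h, invariant M h -> polf m h.

(** A normal subgroup of order p of a p-group is central; applied to M / M' this gives the
    commutator condition. *)
Lemma central_step M : (M <| G)%g -> (0 < logn p #|M|)%N -> exists (M' : {group gT}) y,
  [/\ (M' <| G)%g && (M' \subset M), (logn p #|M'|).+1 = logn p #|M|, (y ^+ p)%g \in M',
    forall u g, u \in M -> [~ u, g]%g \in M' &
    forall x, x \in M -> exists a e, [/\ a \in M', y \in M & x = (a * y ^+ e)%g]].
Proof.
move=> nM lM; have pGG : (p.-group G)%g by rewrite /pgroup cardsT.
have pM : (p.-group M)%g by exact: pgroupS (normal_sub nM) pGG.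
have [M' [sM' nM' cM']] := normal_pgroup pGG nM (leq_pred (logn p #|M|)).
have lM' : logn p #|M'| = (logn p #|M|).-1 by rewrite cM' pfactorK.
have nMM' : (M \subset 'N(M'))%g by exact: fintype.subset_trans (normal_sub nM) (normal_norm nM').
have cQ : #|(M / M')%g| = p.
  rewrite card_quotient // -divgS // cM' {1}(card_pgroup pM) -{1}(prednK lM) expnS mulnK //.
  by rewrite expn_gt0 prime_gt0.
have pQ : prime #|(M / M')%g| by rewrite cQ.
have cent : (M / M' \subset 'Z(G / M'))%g.
  apply: prime_meetG => //; apply: meet_center_nil.
  - by apply: (pgroup_nil (p := p)); exact: quotient_pgroup.
  - exact: quotient_normal.
  - by apply: contraTneq pQ => ->; rewrite cards1.
have [y yM yM'] : exists2 y, y \in M & y \notin M'.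
  apply/subsetPn; apply: contraL pQ => MM'.
  by rewrite quotientS1 // cards1.
have oy : #[coset M' y]%g = p.
  apply: nt_prime_order => //.
    by apply/eqP; rewrite -order_dvdn -cQ; apply: order_dvdG; exact: mem_quotient.
  by apply: contra yM' => /eqP; apply: coset_idr; exact: fintype.subsetP yM.
exists M', y; split=> //.
- by rewrite nM'.
- by rewrite lM' prednK.
- apply: coset_idr; first by rewrite groupX // (fintype.subsetP nMM').
  by rewrite morphX ?(fintype.subsetP nMM') // -oy expg_order.
- move=> u g uM; have nG : (G \subset 'N(M'))%g by exact: normal_norm.
  have : ([~: M, G] \subset M')%g.
    rewrite -quotient_cents2 //; apply: fintype.subset_trans cent (subsetIr _ _).
  by move/fintype.subsetP; apply; rewrite mem_commg // inE.
move=> x xM; have : coset M' x \in <[coset M' y]>%g.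
  suff -> : <[coset M' y]>%g = (M / M')%g by exact: mem_quotient.
  by apply/eqP; rewrite eqEcard cycle_subG mem_quotient // cQ -oy orderE leqnn.
move=> /cycleP[e xe]; exists (x * (y ^+ e)^-1)%g, e; split; rewrite ?mulgVK //.
have xN := fintype.subsetP nMM' _ xM; have yN := fintype.subsetP nMM' _ yM.
rewrite -mem_rcoset; apply/rcoset_kercosetP; rewrite ?groupX //.
by rewrite xe morphX.
Qed.

(** Induction down a central series. On functions invariant under M' the operator [dif y] commutes
    with all differences, and its p-th power is the difference along y^p, that is 0; so the degree
    grows at most by a factor p. *)
Lemma function_polynomial : exists m, forall h : gT -> 'F_p, polf m h.
Proof.
suff [M MQ M1] : exists2 M : {group gT}, polynomial_mod M & #|M| = 1%N.
  have [m hm] := MQ; exists m => h; apply: hm => x u.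
  by rewrite (card1_trivg M1) => /set1P ->; rewrite mulg1.
suff main k : (k <= logn p #|gT|)%N -> exists M : {group gT},
    [/\ (M <| G)%g, (logn p #|M| + k = logn p #|gT|)%N & polynomial_mod M].
  have [M [nM lM MQ]] := main _ (leqnn _); exists M => //.
  have /card_pgroup -> : (p.-group M)%g by apply: pgroupS (normal_sub nM) _; rewrite /pgroup cardsT.
  by move: lM; rewrite -[RHS]add0n => /addIn ->.
elim: k => [_|k IH kl].
  exists G; split; rewrite ?normal_refl ?addn0 ?cardsT //.
  exists 1%N => h hI; apply/polf1/funext => x /=.
  by rewrite -[x]mul1g hI // inE.
have [M [nM lM [m hm]]] := IH (ltnW kl).
have [|M' [y [/andP[nM' M'M] lM' yp cM MP]]] := central_step nM.
  by move: lM kl; clear; lia.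
exists M'; split=> //; first by rewrite addnS -addSn lM'.
exists (m * p)%N.
have inv_dif h g : invariant M' h -> invariant M' (dif g h).
  move=> hI x u uM; rewrite !difE (hI x u uM) -[(x * u * g)%g]mulgA (commgC u g) mulgA.
  by rewrite (hI (x * (g * u))%g) ?cM ?(fintype.subsetP M'M) // mulgA (hI _ u).
have yM : y \in M by have [a [e []]] := MP 1%g (group1 M).
have dif_y h g : invariant M' h -> dif y (dif g h) = dif g (dif y h).
  move=> hI; apply/funext => x; rewrite !difE -[(x * y * g)%g]mulgA (commgC y g) mulgA.
  rewrite (hI (x * (g * y))%g) ?cM // mulgA.
  by move: (h _) (h _) (h _) (h _) => a b c e; ring.
have iter_inv h k' : invariant M' h -> invariant M' (iter k' (dif y) h).
  by move=> hI; elim: k' => //= k' IH'; exact: inv_dif.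
have iter_y h g k' : invariant M' h -> iter k' (dif y) (dif g h) = dif g (iter k' (dif y) h).
  by move=> hI; elim: k' => //= k' ->; rewrite dif_y //; exact: iter_inv.
(* If k' + 1 differences in direction y kill h, then k' of them make it invariant under M, hence of
   degree less than m; so m arbitrary differences save one difference in direction y. *)
have main k' h : invariant M' h -> iter k' (dif y) h = 0 -> polf (m * k') h.
  elim: k' h => [|k' IH'] h hI h0; first by rewrite muln0.
  have step m' h' : invariant M' h' -> polf m' (iter k' (dif y) h') -> polf (m' + m * k') h'.
    elim: m' h' => [|m' IHm] h' hI' hp; first by rewrite add0n; exact: IH'.
    by move=> g; apply: IHm; [exact: inv_dif|rewrite iter_y].
  rewrite mulnS; apply: step => //; apply: hm => x u /MP[a [e [aM' _ ->]]].
  rewrite mulgA; elim: e => [|e IHe]; first by rewrite expg0 mulg1; exact: iter_inv.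
  have := congr1 (@^~ (x * a * y ^+ e)%g) h0; rewrite iterS difE.
  by rewrite expgSr mulgA => /eqP; rewrite subr_eq0 => /eqP ->.
move=> h hI; apply: main => //; rewrite -difXp //; apply/funext => x; rewrite difE.
by rewrite hI ?subrr.
Qed.

End PolynomialFunctions.

Section LocallyConstant.
Variables (p : nat) (E : topGroupType).
Hypotheses (p_pr : prime p) (Ep : pro_p p E).

Lemma zassenhaus_pX i e (x : E) : (i <= p ^ e)%N -> zassenhaus p E i (x ^+ (p ^ e))%g.
Proof.
move=> ie; apply: (zassenhaus_le p_pr Ep ie); elim: e {ie} => [//|e IH].
by rewrite expnSr expgM mulnC; apply: zassenhausXp => //; rewrite expn_gt0 prime_gt0.
Qed.

Lemma lc_cpol (f : E -> 'F_p) : lc f -> exists m, cpol m f.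
Proof.
move=> lf; have [V oV fV] := lf; have [gT [pi piV]] := finite_quotient_map p_pr Ep oV.
have [_ _ piS pG] := piV; have [sg sgK] := choice piS.
have [m hm] := function_polynomial p_pr pG; exists m; split=> //.
have : polf m ((fun t => f (sg t)) \o pi).
  move: (hm (fun t => f (sg t))) => {hm}; elim: m (fun t => f (sg t)) => [|m IH] h /=;
    first by move=> ->.
  by move=> hh g; rewrite (dif_quotient piV); exact: IH.
congr (polf _ _); apply/funext => x /=.
rewrite -[in RHS](mulKVg (sg (pi x)) x) fV //.
by apply/(quotient_mapE piV); rewrite sgK.
Qed.

(** Membership in an open normal subgroup is decided by a polynomial of some degree, so the subgroup
    contains Z_i for large i. *)
Lemma zassenhaus_separated x : (forall i, (0 < i)%N -> zassenhaus p E i x) -> x = 1%g.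
Proof.
move=> Zx; apply: contrapT => x1.
have [_ hE _ _] := Ep.
have [V [nV oV] xV] : exists2 V, open_normal V & ~ V x.
  have cx : closed [set x] by apply: accessible_closed_set1; exact: hausdorff_accessible.
  have [|V oV xV] := closed_sep Ep cx (x := 1%g).
    by move=> e; apply: x1.
  by exists V => // Vx; apply: (xV x Vx); rewrite mul1g.
pose f y : 'F_p := if `[< V y >] then 0 else 1.
have [m hf] : exists m, cpol m f.
  apply: lc_cpol; exists V => // y v Vv; rewrite /f.
  suff -> : `[< V (y * v)%g >] = `[< V y >] by [].
  apply: asbool_equiv_eq; split=> [Vyv|Vy]; last exact: (subgroupM nV.1).
  by rewrite -(mulgK v y); apply: (subgroupM nV.1) => //; exact: (subgroupV nV.1).
have := (zassenhausP p_pr Ep x (ltn0Sn m)).1 (Zx m.+1 isT) f (cpol_le (leqnSn m) hf).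
rewrite /f; case: asboolP => // _; case: asboolP => [_ /eqP|[]]; last exact: subgroup1 nV.1.
by rewrite oner_eq0.
Qed.

End LocallyConstant.

Definition rcomm (G : groupType) (t x : G) w : G := iter w (fun y => [~ y, t]%g) x.

(** * Generators left after omitting one of them *)

Section Cover.
Variables (p : nat) (E : topGroupType).
Hypotheses (p_pr : prime p) (Ep : pro_p p E) (Efg : finitely_generated E).
Notation Z := (zassenhaus p E).
Notation cpol := (@cpol p E).
Implicit Types (f : E -> 'F_p) (x y g : E).
Variables (d k : nat) (xs : nat -> E).
Hypothesis k0 : (0 < k)%N.
Let t := xs 0%N.

(* [t] is left out, and only the generators [xs j] with [k <= j] come with
   their iterated commutators with [t]. *)
Definition cover_gens w : seq E :=
  if w is v.+1 then
    (if v == 0%N then [seq xs j | j <- iota 1 (minn d k).-1] else [::]) ++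
    [seq rcomm t (xs j) v | j <- iota k (d - k)]
  else [::].

Lemma cover_gens_weighted : weighted p cover_gens.
Proof.
move=> [|w] x //= xX; split=> //; move: xX; rewrite mem_cat => /orP[|/mapP[j _ ->]].
  by case: w.
elim: w => [//|w IH] /=; rewrite -addn1; exact: zassenhausR.
Qed.

Hypothesis gens : forall n f, cpol n.+2 f ->
  (forall i, (i < d)%N -> cpol n (dif (xs i) f)) -> cpol n.+1 f.
(** What the defining relation contributes: for the generators xs j with 0 < j < k it makes up for
    the missing commutators with t. Free groups have k = 1, where it is vacuous, and Demushkin
    groups of rank at least 2 have k = 2. *)
Hypothesis rel : forall j n f, (0 < j < k)%N -> (j < d)%N -> cpol n f ->
  (forall i, (k <= i < d)%N -> dif (xs i) f = 0 /\ dif (xs i) (dif t f) = 0) ->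
  (forall i, (0 < i < k)%N -> (i < d)%N -> cpol (n - 2) (dif (xs i) f)) ->
  cpol (n - 3) (dif (xs j) (dif t f)).

Definition cover_inv f := forall w i, (k <= i < d)%N -> dif (rcomm t (xs i) w) f = 0.

Lemma cover_inv_dif f : cover_inv f -> cover_inv (dif t f).
Proof.
move=> fI w i ki; apply/funext => x; rewrite !difE.
have fE v y : f (y * rcomm t (xs i) v)%g = f y.
  by have /(congr1 (@^~ y))/eqP := fI v i ki; rewrite difE subr_eq0 => /eqP.
by rewrite -mulgA (commgC (rcomm t (xs i) w)) mulgA (fE w.+1) mulgA !fE subrr.
Qed.

(** Let F_e be the e-th difference of f in direction t. Its differences along the other generators
    have degree lowered by two: they vanish for k <= i and are controlled by [rel] below k. Climbing
    back from F_n, a constant that vanishes on the powers of t, [gens] improves each degree by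
    one. *)
Lemma cover_zero n f : cpol n f -> (forall w x, x \in cover_gens w -> dif x f = 0) ->
  (forall e, f (t ^+ e)%g = 0) -> f = 0.
Proof.
move=> hf fX ft; elim: n hf => [[_ ->]//|n IH] hf; apply: IH.
pose F e := iter e (dif t) f.
have Fp e : cpol (n.+1 - e) (F e).
  by elim: e => [|e IHe]; [rewrite subn0|rewrite subnS; exact: cpol_dif].
have FI e : cover_inv (F e).
  elim: e => [|e IHe]; last exact: cover_inv_dif.
  move=> w i ki; apply: (fX w.+1); rewrite mem_cat; apply/orP; right; apply: map_f.
  by rewrite mem_iota; move: ki; clear; lia.
have F0 e i : (0 < i < d)%N -> cpol (n.+1 - e - 2) (dif (xs i) (F e)).
  move=> /andP[i0 id]; have [ik|ki] := ltnP i k; last first.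
    have -> : dif (xs i) (F e) = 0 by apply: (FI e 0%N); rewrite ki.
    exact: cpol0.
  elim: e i i0 ik id => [|e IHe] i i0 ik id.
    have -> : dif (xs i) (F 0%N) = 0; last exact: cpol0.
    apply: (fX 1%N); rewrite mem_cat; apply/orP; left; apply: map_f.
    by rewrite mem_iota; move: ik i0 id; clear; lia.
  have -> : (n.+1 - e.+1 - 2 = n.+1 - e - 3)%N by clear; lia.
  apply: rel => //; first by rewrite i0.
    by move=> j kj; split; [exact: (FI e 0%N)|exact: (FI e.+1 0%N)].
  by move=> j /andP[j0 jk] jd; exact: IHe.
have Ft e m : F e (t ^+ m)%g = 0.
  by elim: e m => [|e IHe] m //; rewrite -[F e.+1]/(dif t (F e)) difE -expgSr !IHe subrr.
have main i : (i <= n)%N -> cpol i (F (n - i)%N).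
  elim: i => [_|i IHi iln].
    rewrite subn0; have := Fp n; rewrite subSnn => -[l /polf1 e].
    by split=> //=; rewrite e (Ft n 0%N).
  have {}IHi := IHi (ltnW iln).
  have hF := Fp (n - i.+1)%N.
  have e1 : (n.+1 - (n - i.+1) = i.+2)%N by move: iln; clear; lia.
  rewrite e1 in hF; apply: gens => // -[|j] jd.
    by move: IHi; have -> : (n - i = (n - i.+1).+1)%N by move: iln; clear; lia.
  by have := F0 (n - i.+1)%N j.+1 jd; rewrite e1 subn2.
by have := main n (leqnn n); rewrite subnn.
Qed.

(** The function that is 0 on the elements of the required form and 1 elsewhere is locally constant,
    hence a polynomial, and [cover_zero] kills it. This gives a product decomposition although the
    subgroup is not known to be normal. *)
Lemma cover_gens_span i x : (0 < i)%N -> exists e a z,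
  [/\ gen (generators cover_gens) a, Z i z & x = (t ^+ e * a * z)%g].
Proof.
move=> i0; pose N := gen (generators cover_gens).
have sN : is_subgroup N by exact: gen_subgroup.
have [sZ nZ] := zassenhaus_normal E p_pr i.
pose C y := exists e a z, [/\ N a, Z i z & y = (t ^+ e * a * z)%g].
have CZ y z : Z i z -> C y -> C (y * z)%g.
  move=> Zz [e [a [z' [Na Zz' ->]]]]; exists e, a, (z' * z)%g; rewrite mulgA.
  by split=> //; exact: subgroupM.
have CN y s : N s -> C y -> C (y * s)%g.
  move=> Ns [e [a [z' [Na Zz' ->]]]]; exists e, (a * s)%g, (z' ^ s)%g.
  by split; [exact: (subgroupM sN)|exact: nZ|rewrite /conjg !mulgA mulgK].
have CE (P : set E) y z : is_subgroup P -> P z -> (forall u v, P v -> C u -> C (u * v)%g) ->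
    `[< C (y * z)%g >] = `[< C y >].
  move=> sP Pz h; apply: asbool_equiv_eq; split; last exact: h Pz.
  by move=> /(h _ _ (subgroupV sP Pz)); rewrite mulgK.
pose f y : 'F_p := if `[< C y >] then 0 else 1.
have [m hf] : exists m, cpol m f.
  apply: (lc_cpol p_pr Ep); exists (Z i) => [|y z Zz]; first exact: zassenhaus_open_normal.
  by rewrite /f (CE (Z i) _ _ sZ Zz) // => u v Zv; exact: CZ.
have f0 : f = 0.
  apply: (cover_zero hf) => [w s sX|e].
    apply/funext => y; rewrite difE /f (CE N _ _ sN) ?subrr //.
    by apply: gen_sub; exists w.
  suff Ct : C (t ^+ e)%g by rewrite /f; case: asboolP.
  by exists e, 1%g, 1%g; rewrite !mulg1; split=> //; exact: subgroup1.
by have := congr1 (@^~ x) f0; rewrite /f; case: asboolP.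
Qed.

(** The element t^(p^e) has weight p^e, so t has order at most p^e modulo Z_i, and leaving it out
    costs O(log i) only. *)
Lemma kappa_cover i e : (0 < i)%N -> (i <= p ^ e)%N ->
  (kappa p (setT : set E) i <= kappa p (gen (generators cover_gens)) i + e)%N.
Proof.
move=> i0 ie; have [gT [pi piV]] := zassenhaus_quotient p_pr Ep Efg i.
pose N := gen (generators cover_gens); have sN : is_subgroup N by exact: gen_subgroup.
have [piM pi1 piS _] := piV.
rewrite -(@leq_exp2l p) ?prime_gt1 // addnC expnD.
rewrite -(card_quotient_kappa p_pr piV) -(card_fimage_kappa p_pr piV sN).
have Zt : Z i (t ^+ (p ^ e))%g by exact: (zassenhaus_pX p_pr Ep).
have pe0 : (0 < p ^ e)%N by rewrite expn_gt0 prime_gt0.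
pose h (u : 'I_(p ^ e) * gT) := (pi t ^+ u.1 * u.2)%g.
pose A := finset.setX (finset.setTfor 'I_(p ^ e)) (fimage pi N).
apply: leq_trans (_ : #|h @: A| <= _)%N; last first.
  by apply: leq_trans (leq_imset_card _ _) _; rewrite cardsX cardsT card_ord.
rewrite -cardsT; apply/subset_leq_card/fintype.subsetP => s _.
have [x <-] := piS s; have [m [a [z [Na Zz ->]]]] := cover_gens_span x i0.
rewrite !piM (_ : pi z = 1%g) ?mulg1; last exact/pi1.
apply/imsetP; exists (Ordinal (ltn_pmod m pe0), pi a).
  by rewrite inE /= inE /= mem_fimage.
rewrite /h /=; congr (_ * _)%g.
have pt : (pi t ^+ (p ^ e) = 1)%g by rewrite -(quotient_mapX piV); exact/pi1.
by rewrite (quotient_mapX piV) {1}(divn_eq m (p ^ e)) expgD mulnC expgM pt expg1n mul1g.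
Qed.

End Cover.

(** * Weighted generators of small growth, and elimination of a generator *)

Section WeightedSum.
Variables (R : realType) (T : Type).
Implicit Types (X Y : nat -> seq T) (q : R).

Definition wsum q X m : R := \sum_(1 <= w < m) (size (X w))%:R * q ^+ w.

Lemma wsum_le q X m n : 0 <= q -> (m <= n)%N -> wsum q X m <= wsum q X n.
Proof.
move=> q0 mn; have [m1|m1] := leqP m 1.
  rewrite /wsum big_geq //; apply: sumr_ge0 => i _; by rewrite mulr_ge0 ?exprn_ge0.
rewrite /wsum [leRHS](big_cat_nat (ltnW m1) mn) /=.
by rewrite lerDl; apply: sumr_ge0 => i _; rewrite mulr_ge0 ?exprn_ge0.
Qed.

Lemma wsum_cat q X Y m : wsum q (fun w => X w ++ Y w) m = wsum q X m + wsum q Y m.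
Proof.
rewrite /wsum -big_split /=; apply: eq_bigr => w _.
by rewrite size_cat natrD mulrDl.
Qed.

Lemma wsum_single q (x : T) v m : (0 < v)%N -> (v < m)%N ->
  wsum q (fun w => if w == v then [:: x] else [::]) m = q ^+ v.
Proof.
move=> v0 vm; rewrite /wsum (bigD1_seq v) ?iota_uniq ?mem_index_iota ?v0 //=.
by rewrite eqxx mul1r big1 ?addr0 // => i /negbTE ->; rewrite mul0r.
Qed.

Lemma convex_pow (x y a : R) n : 0 <= x -> x <= y -> 0 <= a -> a <= 1 ->
  ((1 - a) * x + a * y) ^+ n <= (1 - a) * x ^+ n + a * y ^+ n.
Proof.
move=> x0 xy a0 a1; have y0 := le_trans x0 xy; have a1' : 0 <= 1 - a by rewrite subr_ge0.
elim: n => [|n IH]; first by rewrite !expr0; lra.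
rewrite exprS; apply: le_trans (ler_wpM2l _ IH) _.
  by rewrite addr_ge0 ?mulr_ge0.
rewrite -subr_ge0 !exprS.
have -> : (1 - a) * (x * x ^+ n) + a * (y * y ^+ n) -
   ((1 - a) * x + a * y) * ((1 - a) * x ^+ n + a * y ^+ n) =
   a * (1 - a) * ((y - x) * (y ^+ n - x ^+ n)) by ring.
by rewrite !mulr_ge0 // subr_ge0 // lerXn2r.
Qed.

(** Sizes are bounded, so the sums are bounded at q' = (1 + q) / 2 as well; convexity of q^w then
    keeps them below 1 at a point slightly above q = lam^-1. *)
Lemma wsum_interpolate (lam s C : R) X : 1 < lam -> s < 1 ->
  (forall w, (size (X w))%:R <= C) -> (forall m, wsum lam^-1 X m <= s) ->
  exists tau, [/\ 1 < tau, tau < lam & exists2 s', s' < 1 & forall m, wsum tau^-1 X m <= s'].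
Proof.
move=> l1 s1 XC Xs.
have l0 : 0 < lam by exact: lt_trans ltr01 l1.
pose q := lam^-1; have q0 : 0 < q by rewrite invr_gt0.
have q1 : q < 1 by rewrite invf_lt1.
pose q' := (1 + q) / 2; have qq' : q < q' by rewrite /q'; lra.
have q'1 : q' < 1 by rewrite /q'; lra.
have C0 : 0 <= C by apply: le_trans (XC 0%N).
pose B := C * (1 - q')^-1 + 1.
have B1 : 1 <= B by rewrite lerDr mulr_ge0 // invr_ge0; lra.
have s0 : 0 <= s by have := Xs 0%N; rewrite /wsum big_geq.
have Bm m : wsum q' X m <= B.
  have := @wsum_le q' X m m.+1 _ (leqnSn m); rewrite (le_trans (ltW q0) (ltW qq')) => /(_ isT) h.
  apply: le_trans (_ : C * \sum_(0 <= i < m) q' ^+ i <= _); last first.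
    apply: le_trans (ler_wpM2l C0 (geometric_sum_le _ _ q'1)) _;
      first by rewrite (le_trans (ltW q0)) ?ltW.
    by rewrite /B lerDl.
  have q'0 : 0 <= q' by rewrite (le_trans (ltW q0)) ?ltW.
  rewrite /wsum mulr_sumr; case: m {h} => [|m]; first by rewrite !big_geq.
  rewrite [leRHS]big_nat_recl // -[leLHS]add0r; apply: lerD; first by rewrite mulr_ge0.
  rewrite big_add1 /=; apply: ler_sum => w _; apply: ler_wpM2r; first exact: exprn_ge0.
  exact: XC.
(* Chosen with a B = (1 - s) / 2, half of the available gap. *)
pose a := (1 - s) / (2 * B).
have a0 : 0 < a by rewrite divr_gt0 ?subr_gt0 // mulr_gt0 // (lt_le_trans ltr01).
have aB : a * B = (1 - s) / 2 by rewrite /a; field; rewrite gt_eqF // (lt_le_trans ltr01).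
have a1 : a < 1 by nra.
pose r := (1 - a) * q + a * q'.
have qr : q < r by rewrite /r; nra.
have r1 : r < 1 by rewrite /r; nra.
have r0 : 0 < r by exact: lt_trans qr.
exists r^-1; split.
- by rewrite invf_gt1.
- by rewrite invf_plt ?posrE //.
exists (s + (1 - s) / 2); first lra.
move=> m; rewrite invrK.
apply: le_trans (_ : (1 - a) * wsum q X m + a * wsum q' X m <= _).
  rewrite /wsum !mulr_sumr -big_split /=; apply: ler_sum => w _.
  have := convex_pow w (ltW q0) (ltW qq') (ltW a0) (ltW a1).
  move/(ler_wpM2l (ler0n R (size (X w)))); rewrite -/r => /le_trans; apply.
  by rewrite le_eqVlt; apply/orP; left; apply/eqP; ring.
have h1 := Xs m; have h2 := Bm m.
apply: lerD; last by rewrite -aB; apply: ler_wpM2l => //; exact: ltW.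
apply: le_trans (_ : (1 - a) * s <= _); first by apply: ler_wpM2l => //; rewrite subr_ge0 ltW.
by rewrite ler_piMl // gerBl ltW.
Qed.

End WeightedSum.

Section SmallGrowth.
Variables (R : realType) (p : nat) (E : topGroupType).
Hypotheses (p_pr : prime p) (Ep : pro_p p E) (Efg : finitely_generated E).
Notation Z := (zassenhaus p E).
Implicit Types (X : nat -> seq E).

(** The number N_i of words satisfies N_i = 1 + sum_w |X_w| N_(i-w), and (1 - s)^-1 tau^i is a
    supersolution of this recursion. *)
Lemma words_growth X (tau s : R) i : 0 < tau -> s < 1 -> 
  (forall m, wsum tau^-1 X m <= s) -> 1 <= tau ->
  (size (words X i))%:R <= (1 - s)^-1 * tau ^+ i.
Proof.
move=> t0 s1 Xs t1; pose A := (1 - s)^-1.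
have s1' : 0 < 1 - s by rewrite subr_gt0.
have A0 : 0 < A by rewrite invr_gt0.
elim/ltn_ind: i => i IH; have [->|i0] := posnP i.
  by rewrite /= mulr_ge0 ?exprn_ge0 ?ltW.
have sumE (ws : seq nat) : {in ws, forall w, (0 < w < i)%N} ->
    (sumn [seq size [seq x :: v | x <- X w, v <- words X (i - w)] | w <- ws])%:R
    <= A * tau ^+ i * \sum_(w <- ws) (size (X w))%:R * tau^-1 ^+ w.
  elim: ws => [|w ws IHw] wi; first by rewrite big_nil mulr0.
  have /andP[w0 wlt] := wi w (mem_head _ _).
  rewrite big_cons /= natrD mulrDr; apply: lerD; last first.
    by apply: IHw => v vw; apply: wi; rewrite inE vw orbT.
  rewrite size_allpairs natrM.
  apply: le_trans (_ : (size (X w))%:R * (A * tau ^+ (i - w)) <= _).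
    by apply: ler_wpM2l => //; apply: IH; rewrite ltn_subrL w0.
  rewrite expfB // exprVn le_eqVlt; apply/orP; left; apply/eqP; ring.
rewrite wordsE // /= size_flatten /shape -map_comp -natr1.
have h : (sumn [seq size [seq x :: v | x <- X w, v <- words X (i - w)] | w <- index_iota 1 i])%:R
    <= A * tau ^+ i * s.
  apply: le_trans (sumE _ _) _; first by move=> w; rewrite mem_index_iota.
  by apply: ler_wpM2l (Xs i); rewrite mulr_ge0 ?exprn_ge0 ?ltW.
apply: le_trans (lerD h (lexx 1)) _; rewrite -lerBrDl.
have -> : A * tau ^+ i - A * tau ^+ i * s = A * (1 - s) * tau ^+ i by ring.
by rewrite mulVf ?gt_eqF // mul1r exprn_ege1.
Qed.

Definition slow (lam : R) (a : nat -> nat) := exists mu C : R,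
  [/\ 1 < mu, mu < lam & forall i, (0 < i)%N -> (a i)%:R <= C * mu ^+ i].

Lemma kappa_slow X (lam s C : R) : 1 < lam -> s < 1 -> weighted p X ->
  (forall w, (size (X w))%:R <= C) -> (forall m, wsum lam^-1 X m <= s) ->
  slow lam (kappa p (gen (generators X))).
Proof.
move=> l1 s1 wX XC Xs; have [tau [t1 tl [s' s'1 Xs']]] := wsum_interpolate l1 s1 XC Xs.
have t0 : 0 < tau by exact: lt_trans ltr01 t1.
exists tau, (1 - s')^-1; split=> // i i0.
apply: le_trans (words_growth i t0 s'1 Xs' (ltW t1)).
by rewrite ler_nat; exact: kappa_words.
Qed.

Lemma slow_not_big lam a : slow lam a -> ~ big lam a.
Proof.
move=> [mu [C [m1 ml aC]]] ab; apply: (ab mu (`|C| + (a 0%N)%:R) m1 ml) => -[|i].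
  by rewrite expr0 mulr1 lerDr.
apply: le_trans (aC i.+1 isT) _; apply: ler_wpM2r.
  by rewrite exprn_ge0 // ltW // (lt_trans ltr01).
by apply: le_trans (ler_norm C) _; rewrite lerDl.
Qed.

End SmallGrowth.

Section ConjugatesCommutators.
Variable G : topGroupType.
Implicit Types (H : set G) (x y : G).

(** Together with [rcomm_of_conj]: the conjugates of y by the first powers of x and the iterated
    commutators [y, x, ..., x] generate the same subgroup. Commutators carry the weights, conjugates
    make the step to x^p easy. *)
Lemma conj_of_rcomm H x n y : is_subgroup H ->
  (forall j, (j <= n)%N -> H (rcomm x y j)) -> forall j, (j <= n)%N -> H (y ^ (x ^+ j))%g.
Proof.
move=> sH; elim: n y => [|n IH] y hy [|j] jn //.
- by rewrite expg0 conjg1; exact: (hy 0%N).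
- by rewrite expg0 conjg1; exact: (hy 0%N).
rewrite expgS conjgM -[(y ^ x)%g](mulKVg y) -commgEl.
rewrite conjMg; apply: (subgroupM sH).
  by apply: IH => // i ii; apply: hy; rewrite (leq_trans ii).
by apply: IH => // i ii; have := hy i.+1 ii; rewrite /rcomm iterSr.
Qed.

Lemma rcomm_of_conj H x n y : is_subgroup H ->
  (forall j, (j <= n)%N -> H (y ^ (x ^+ j))%g) -> forall j, (j <= n)%N -> H (rcomm x y j).
Proof.
move=> sH; elim: n y => [|n IH] y hy [|j] jn //.
- by have := hy 0%N isT; rewrite expg0 conjg1.
- by have := hy 0%N isT; rewrite expg0 conjg1.
rewrite /rcomm iterSr; apply: IH => // i ii.
rewrite /commg conjMg conjVg -conjgM -expgS; apply: (subgroupM sH).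
  by apply: (subgroupV sH); apply: hy; rewrite (leq_trans ii).
exact: hy.
Qed.

End ConjugatesCommutators.

(** * Elimination of a generator from a weighted system *)

Section Elimination.
Variables (R : realType) (p : nat) (E : topGroupType).
Hypotheses (p_pr : prime p) (Ep : pro_p p E) (Efg : finitely_generated E).
Notation Z := (zassenhaus p E).
Variables (X : nat -> seq E) (u : nat) (x : E).
Hypotheses (wX : weighted p X) (Xux : x \in X u).

Let p1 : (1 < p)%N. Proof. exact: prime_gt1. Qed.
Let u0 : (0 < u)%N. Proof. by have [] := wX Xux. Qed.
Let Zx : Z u x. Proof. by have [] := wX Xux. Qed.

Definition others w := if w == u then rem x (X u) else X w.

(** The generators that Schreier's method gives for the kernel of a map to Z/p with x going to 1 and
    the other generators to 0, with commutators in place of conjugates so that weights are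
    visible. *)
Definition eliminate w := others w ++ ((if w == (p * u)%N then [:: (x ^+ p)%g] else [::]) ++
  flatten [seq [seq rcomm x y j | y <- if (j * u < w)%N then others (w - j * u)%N else [::]]
    | j <- iota 1 p.-1]).

Let K := gen (generators X).
Let K' := gen (generators eliminate).
Let sK : is_subgroup K. Proof. exact: gen_subgroup. Qed.
Let sK' : is_subgroup K'. Proof. exact: gen_subgroup. Qed.

Lemma othersP w y : y \in others w -> y \in X w.
Proof. by rewrite /others; case: eqP => [->|//]; exact: mem_rem. Qed.

Lemma mem_X w y : y \in X w -> y \in others w \/ (w = u /\ y = x).
Proof.
rewrite /others; case: eqP => [->|]; last by left.
have [->|yx] := eqVneq y x; first by right.
by move=> yX; left; move: yX; rewrite (perm_mem (perm_to_rem Xux)) inE (negbTE yx).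
Qed.

Lemma eliminateP w y : y \in eliminate w -> [\/ y \in others w,
  w = (p * u)%N /\ y = (x ^+ p)%g | exists j v y', [/\ (0 < j < p)%N, y' \in others v,
    w = (v + j * u)%N, (0 < v)%N & y = rcomm x y' j]].
Proof.
rewrite !mem_cat => /or3P[->|yp|/flattenP[s /mapP[j]]].
- by constructor 1.
- by constructor 2; move: yp; case: eqP => // -> ; rewrite inE => /eqP.
rewrite mem_iota => jp -> /mapP[y']; case: ifP => // jw y'o ->; constructor 3.
exists j, (w - j * u)%N, y'; split=> //; rewrite ?subnK ?subn_gt0 //; last exact: ltnW.
by move: jp p1; clear; lia.
Qed.

Lemma rcomm_zassenhaus v y j : (0 < v)%N -> Z v y -> Z (v + j * u)%N (rcomm x y j).
Proof.
move=> v0 Zy; elim: j => [|j IH]; first by rewrite addn0.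
by rewrite mulSn addnCA addnC; apply: zassenhausR => //; rewrite addn_gt0 v0.
Qed.

Lemma eliminate_weighted : weighted p eliminate.
Proof.
move=> w y /eliminateP[/othersP/wX//|[-> ->]|[j [v [y' [jp /othersP/wX[_ Zy'] -> v0 ->]]]]].
  by split; [rewrite muln_gt0 prime_gt0|exact: zassenhausXp].
by split; [rewrite addn_gt0 v0|exact: rcomm_zassenhaus].
Qed.

Lemma eliminate_shift_nil w : (w <= u)%N ->
  flatten [seq [seq rcomm x y j | y <- if (j * u < w)%N then others (w - j * u)%N else [::]]
    | j <- iota 1 p.-1] = [::].
Proof.
move=> wu; apply: (@etrans _ _ (flatten [seq ([::] : seq E) | j <- iota 1 p.-1]));
  last by elim: iota.
congr flatten; apply/eq_in_map => j; rewrite mem_iota => /andP[j0 _].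
by rewrite ltnNge (_ : (w <= j * u)%N) //; move: wu j0; clear; nia.
Qed.

Lemma eliminate_lt w : (w < u)%N -> eliminate w = X w.
Proof.
move=> wu; rewrite /eliminate /others ltn_eqF // ltn_eqF; last by move: wu p1; clear; nia.
by rewrite cat0s eliminate_shift_nil ?cats0 // ltnW.
Qed.

Lemma eliminate_eq : eliminate u = rem x (X u).
Proof.
rewrite /eliminate /others eqxx ltn_eqF; last by move: u0 p1; clear; nia.
by rewrite cat0s eliminate_shift_nil ?cats0.
Qed.

Lemma eliminate_gt w : (u < w)%N -> {subset X w <= eliminate w}.
Proof. by move=> uw y yX; rewrite mem_cat /others gtn_eqF // yX. Qed.

Lemma eliminate_bounded : (exists C : R, forall w, (size (X w))%:R <= C) ->
  exists C : R, forall w, (size (eliminate w))%:R <= C.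
Proof.
move=> [C XC]; have oC w : (size (others w))%:R <= C.
  apply: le_trans (XC w); rewrite ler_nat /others; case: eqP => // ->.
  by rewrite size_rem // leq_pred.
have C0 : 0 <= C by apply: le_trans (XC 0%N).
have fC s w : (size (flatten [seq [seq rcomm x y j | y <- if (j * u < w)%N
      then others (w - j * u)%N else [::]] | j <- s]))%:R <= (size s)%:R * C.
  elim: s => [|j s IH] /=; first by rewrite mulr0n mul0r.
  rewrite size_cat natrD -natr1 addrC mulrDl mul1r; apply: lerD => //.
  by rewrite size_map; case: ifP.
exists (C + (1 + p.-1%:R * C)) => w; rewrite !size_cat !natrD; apply: lerD => //.
apply: lerD; first by rewrite -[leRHS]/(1%:R) ler_nat; case: ifP.
by have := fC (iota 1 p.-1) w; rewrite size_iota.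
Qed.

Lemma wsum_others (q : R) m : (u < m)%N -> wsum q others m = wsum q X m - q ^+ u.
Proof.
move=> um; apply/eqP; rewrite eq_sym subr_eq; apply/eqP.
have us : u \in index_iota 1 m by rewrite mem_index_iota u0.
rewrite /wsum (bigD1_seq u) ?iota_uniq //= [in RHS](bigD1_seq u) ?iota_uniq //=.
rewrite /others eqxx size_rem // -[in LHS](prednK (_ : 0 < size (X u))%N); last by case: (X u) Xux.
rewrite -natr1 mulrDl mul1r -!addrA; congr (_ + _); rewrite addrC; congr (_ + _).
by apply: eq_bigr => i /negbTE ->.
Qed.

Lemma wsum_shift (q : R) (Y : nat -> seq E) (f : E -> E) k m : 0 <= q ->
  wsum q (fun w => [seq f y | y <- if (k < w)%N then Y (w - k)%N else [::]]) m
  <= q ^+ k * wsum q Y m.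
Proof.
move=> q0; elim: m => [|m IH]; first by rewrite /wsum !big_geq // mulr0.
have [m0|m0] := posnP m; first by rewrite m0 /wsum !big_geq // mulr0.
have [mk|km] := leqP m.+1 k.
  rewrite /wsum big_nat big1; first by rewrite mulr_ge0 ?exprn_ge0 // sumr_ge0 // => *;
    rewrite mulr_ge0 ?exprn_ge0.
  by move=> w /andP[_ wm]; rewrite ltnNge (leq_trans (ltnW wm)) ?mul0r // ltnW.
apply: le_trans (_ : q ^+ k * wsum q Y (m.+1 - k)%N <= _); last first.
  by apply: ler_wpM2l; [exact: exprn_ge0|apply: wsum_le => //; exact: leq_subr].
rewrite /wsum (big_cat_nat (n := k.+1)) //= big_nat big1 ?add0r; last first.
  by move=> w /andP[_ wk]; rewrite ltnNge -ltnS wk mul0r.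
rewrite -[k.+1]add1n -{1}(subnK (ltnW km)) big_addn addnK mulr_sumr le_eqVlt; apply/orP; left.
apply/eqP; rewrite !big_nat; apply: eq_bigr => w /andP[w0 _].
by rewrite size_map -[X in (X < _)%N]add0n ltn_add2r w0 addnK exprD; ring.
Qed.

Lemma wsum_eliminate (q : R) : 0 < q -> q < 1 -> (forall m, wsum q X m <= 1) ->
  forall m, wsum q eliminate m <= 1.
Proof.
move=> q0 q1 Xs m; have q0' := ltW q0.
(* Beyond u and p u, so that both the removed x and the new x^p are counted. *)
pose n := (maxn m (p * u).+1); apply: le_trans (wsum_le _ q0' (leq_maxl m (p * u).+1)) _.
have nu : (u < n)%N by rewrite /n leq_max; apply/orP; right; move: u0 p1; clear; nia.
have npu : (p * u < n)%N by rewrite /n leq_max ltnSn orbT.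
have so : wsum q others n <= 1 - q ^+ u by rewrite wsum_others // lerB.
have sf s : wsum q (fun w => flatten [seq [seq rcomm x y j | y <- if (j * u < w)%N
      then others (w - j * u)%N else [::]] | j <- s]) n
    <= (\sum_(j <- s) (q ^+ u) ^+ j) * (1 - q ^+ u).
  elim: s => [|j s IH]; first by rewrite big_nil mul0r /wsum big1 // => i _; rewrite mul0r.
  rewrite big_cons mulrDl [leLHS](wsum_cat q
    (fun w => [seq rcomm x y j | y <- if (j * u < w)%N then others (w - j * u)%N else [::]])).
  apply: lerD IH; apply: le_trans (wsum_shift _ _ _ _ q0') _.
  by rewrite mulnC exprM; apply: ler_wpM2l so; rewrite exprn_ge0 // exprn_ge0.
rewrite (wsum_cat q others) (wsum_cat q (fun w => if w == (p * u)%N then [:: (x ^+ p)%g] else [::])).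
rewrite wsum_single // ?muln_gt0 ?(prime_gt0 p_pr) //.
have geo : 1 - q ^+ u + (\sum_(j <- iota 1 p.-1) (q ^+ u) ^+ j) * (1 - q ^+ u) = 1 - q ^+ (p * u).
  transitivity ((\sum_(0 <= j < p) (q ^+ u) ^+ j) * (1 - q ^+ u)).
    rewrite /index_iota subn0; have -> : iota 0 p = 0%N :: iota 1 p.-1 by case: (p) p1.
    by rewrite big_cons expr0; ring.
  rewrite mulnC exprM; elim: (p) => [|k IH]; first by rewrite big_geq // mul0r subrr.
  by rewrite big_nat_recr //= mulrDl IH exprS; ring.
have := sf (iota 1 p.-1); move: so geo; lra.
Qed.

Lemma eliminate_sub : K' `<=` K.
Proof.
have Xk w y : y \in X w -> K y by move=> yX; apply: gen_sub; exists w.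
apply: (gen_min sK) => y [w] /eliminateP[/othersP/Xk//|[_ ->]|[j [v [y' [_ /othersP/Xk Ky _ _ ->]]]]].
  by apply: (subgroupX _ sK); exact: Xk Xux.
by elim: j => //= j IH; apply: (subgroupR sK) => //; exact: Xk Xux.
Qed.

Lemma eliminate_xp : K' (x ^+ p)%g.
Proof.
apply: gen_sub; exists (p * u)%N; rewrite !mem_cat eqxx; apply/orP; right.
by rewrite inE eqxx.
Qed.

Lemma eliminate_rcomm w y j : y \in others w -> (j < p)%N -> K' (rcomm x y j).
Proof.
move=> yo; have [w0 _] := wX (othersP yo).
case: j => [_|j jp]; first by apply: gen_sub; exists w; rewrite mem_cat yo.
apply: gen_sub; exists (w + j.+1 * u)%N; rewrite !mem_cat; apply/orP; right; apply/orP; right.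
apply/flattenP; eexists; first by apply: map_f (_ : j.+1 \in _); rewrite mem_iota; move: jp;
  clear; lia.
by rewrite -[X in (X < _)%N]add0n ltn_add2r w0 addnK; apply: map_f.
Qed.

(** Conjugation by x adds at most one entry x to a commutator; the critical case of p entries
    reduces to the conjugate of y by x^p, an element of K'. *)
Lemma eliminate_conj a : K' a -> K' (a ^ x)%g.
Proof.
apply: (@gen_min _ _ [set a | K' (a ^ x)%g]).
  split; first by rewrite /= conj1g; exact: (subgroup1 sK').
  move=> b c /= Kb Kc; rewrite conjMg conjVg; apply: (subgroupM sK') => //.
  exact: (subgroupV sK').
have xp := eliminate_xp.
have allc w y j : y \in others w -> (j <= p)%N -> K' (rcomm x y j).
  move=> yo; apply: rcomm_of_conj => //; move: j => _ j; rewrite leq_eqVlt => /orP[/eqP ->|jp].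
    have Ky : K' y by have := eliminate_rcomm yo (ltnW p1).
    by rewrite /conjg; apply: (subgroupM sK'); [exact: (subgroupV sK')|exact: (subgroupM sK')].
  apply: (@conj_of_rcomm _ K' x p.-1) => // [i ip|]; last by move: jp; clear; lia.
  by apply: eliminate_rcomm yo _; move: ip p1; clear; lia.
have cE y : (y ^ x = y * [~ y, x])%g by rewrite commgEl mulKVg.
move=> y [w] /eliminateP[yo|[_ ->]|[j [v [y' [/andP[_ jp] y'o _ _ ->]]]]] /=.
- rewrite cE; apply: (subgroupM sK'); first exact: (allc w y 0%N).
  exact: (allc w y 1%N yo (ltnW p1)).
- by rewrite conjXg [(x ^ x)%g]mulKg.
rewrite cE; apply: (subgroupM sK'); first exact: allc y'o (ltnW jp).
exact: (allc v y' j.+1).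
Qed.

Section Quotient.
Variables (i : nat) (gT : finGroupType) (pi : E -> gT).
Hypothesis piV : quotient_map p (Z i) pi.

(** Modulo Z_i, K is generated by K' and x, where x normalizes K' and x^p lies in K'; the index is
    thus 1 or p. *)
Lemma card_eliminate : pi x \notin fimage pi K' ->
  #|fimage pi K| = (p * #|fimage pi K'|)%N.
Proof.
move=> xK'; have [piM _ _ _] := piV.
pose G := Group (fimage_group_set piV sK); pose G' := Group (fimage_group_set piV sK').
have xN : pi x \in ('N(G'))%g.
  rewrite inE; apply/fintype.subsetP => _ /imsetP[_ /fimageP[a Ka <-] ->].
  rewrite /conjg -(quotient_mapV piV) -!piM; apply: mem_fimage; exact: eliminate_conj.
have Ge : G = (G' <*> <[pi x]>)%G :> {set gT}.
  apply/eqP; rewrite finset.eqEsubset; apply/andP; split; last first.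
    rewrite join_subG cycle_subG; apply/andP; split.
      exact: fimageS eliminate_sub.
    by apply: mem_fimage; apply: gen_sub; exists u.
  apply/fintype.subsetP => _ /fimageP[k Kk <-].
  move: k Kk; apply: (@gen_min _ _ [set k | pi k \in (G' <*> <[pi x]>)%g]).
    split=> [|a b /= ha hb]; first by rewrite /= (quotient_map1 piV) group1.
    by rewrite /= piM (quotient_mapV piV) groupM ?groupV.
  move=> y [w] /mem_X[yo|[_ ->]] /=; last by rewrite (fintype.subsetP (joing_subr _ _)) // cycle_id.
  by rewrite (fintype.subsetP (joing_subl _ _)) //; apply: mem_fimage;
    exact: (@eliminate_rcomm w y 0%N yo (ltnW p1)).
have cN : (<[pi x]> \subset 'N(G'))%g by rewrite cycle_subG.
have GN : (G \subset 'N(G'))%g by rewrite Ge join_subG normG.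
have G'G : G' \subset G by exact: fimageS eliminate_sub.
change (#|G| = (p * #|G'|)%N).
rewrite -(Lagrange G'G) mulnC -card_quotient //; congr (_ * _)%N.
rewrite Ge /= (norm_joinEr cN) quotientMidl quotient_cycle // -orderE.
apply: nt_prime_order => //.
  by rewrite -morphX // -(quotient_mapX piV); apply: coset_id; apply: mem_fimage;
    exact: eliminate_xp.
by apply: contra xK' => /eqP; exact: (coset_idr xN).
Qed.

End Quotient.

Lemma kappa_eliminate_gt i : ~ mulset K' (Z i) x -> kappa p K i = (kappa p K' i).+1.
Proof.
have [gT [pi piV]] := zassenhaus_quotient p_pr Ep Efg i => xK'.
have := @card_eliminate i gT pi piV _.
rewrite !(card_fimage_kappa p_pr piV) // -expnS => h; apply/eqP.
rewrite -(eqn_exp2l (m := p)) //; apply/eqP/h.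
apply/negP => /fimageP[k Kk] e; apply: xK'; exists k => //; exists (k^-1 * x)%g;
  last by rewrite mulKVg.
exact/(quotient_mapE piV).
Qed.

Lemma eliminate_le i : (i <= u)%N -> mulset K' (Z i) = mulset K (Z i).
Proof.
move=> iu; apply/seteqP; split=> [_ [a /eliminate_sub Ka [z Zz <-]]|].
  by exists a => //; exists z.
have sS : is_subgroup (mulset K' (Z i)) by apply: mulset_subgroup => //; exact: zassenhaus_normal.
have sZ := zassenhaus_sub E p_pr i.
move=> _ [a Ka [z Zz <-]]; apply: (subgroupM sS); last by apply: mulset_subr => //;
  exact: subgroup1.
move: a Ka; apply: (gen_min sS) => y [w] /mem_X[yo|[_ ->]].
  by apply: mulset_subl; [exact: subgroup1|exact: (@eliminate_rcomm w y 0%N yo (ltnW p1))].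
by apply: mulset_subr; [exact: subgroup1|exact: zassenhaus_le iu _ Zx].
Qed.

(* If x became redundant modulo Z_(u+1), it could be replaced by a generator of
   weight u + 1, and the weighted sum would drop below 1. *)
Lemma eliminate_big (lam : R) : 1 < lam -> (exists C : R, forall w, (size (X w))%:R <= C) ->
  (forall m, wsum lam^-1 X m <= 1) -> big lam (kappa p K) -> ~ mulset K' (Z u.+1) x.
Proof.
move=> l1 [C XC] Xs Kb [k K'k [z Zz xE]].
pose X1 w := others w ++ (if w == u.+1 then [:: z] else [::]).
pose T := gen (generators X1); have sT : is_subgroup T by exact: gen_subgroup.
have l0 : 0 < lam by exact: lt_trans ltr01 l1.
have q0 : 0 < lam^-1 by rewrite invr_gt0.
have q1 : lam^-1 < 1 by rewrite invf_lt1.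
have oT w y : y \in others w -> T y.
  by move=> yo; apply: gen_sub; exists w; rewrite mem_cat yo.
have Tz : T z by apply: gen_sub; exists u.+1; rewrite mem_cat eqxx inE eqxx orbT.
have wX1 : weighted p X1.
  move=> w y; rewrite mem_cat => /orP[/othersP/wX//|].
  by case: eqP => // ->; rewrite inE => /eqP ->.
have X1C w : (size (X1 w))%:R <= C + 1.
  rewrite size_cat natrD; apply: lerD; last by rewrite -[leRHS]/(1%:R) ler_nat; case: ifP.
  apply: le_trans (XC w); rewrite ler_nat /others; case: eqP => // ->.
  by rewrite size_rem // leq_pred.
have X1s m : wsum lam^-1 X1 m <= 1 - lam^-1 ^+ u + lam^-1 ^+ u.+1.
  apply: le_trans (wsum_le _ (ltW q0) (leq_maxl m u.+2)) _.
  rewrite (wsum_cat _ others) wsum_single ?leq_max ?ltnSn ?orbT // lerD2r.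
  by rewrite wsum_others ?lerB // leq_max ltnS leqnSn orbT.
have Ts : slow lam (kappa p T).
  apply: (kappa_slow p_pr Ep Efg l1 _ wX1 X1C X1s).
  have : lam^-1 ^+ u.+1 < lam^-1 ^+ u by rewrite exprS gtr_pMl // exprn_gt0.
  by lra.
(* If x is congruent modulo Z_i to some t in T, then modulo Z_(i+1) its commutators and p-th power
   can be computed with t; so K' lies in T Z_(i+1), and with it x. *)
have step i : (0 < i)%N -> K `<=` mulset T (Z i) -> K `<=` mulset T (Z i.+1).
  move=> i0 KT; pose S := mulset T (Z i.+1).
  have sZ := zassenhaus_sub E p_pr i.+1.
  have sS : is_subgroup S by apply: mulset_subgroup => //; exact: zassenhaus_normal.
  have TS : T `<=` S by apply: mulset_subl; exact: subgroup1.
  have ZS : Z i.+1 `<=` S by apply: mulset_subr; exact: subgroup1.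
  have Kx : K x by apply: gen_sub; exists u.
  have [t Tt [zt Zzt xt]] := KT x Kx.
  have Sc a : S a -> S [~ a, x]%g.
    move=> Sa; rewrite commgEl; apply: (subgroupM sS); first exact: (subgroupV sS).
    rewrite -xt conjgM; rewrite -[X in S X](mulKVg (a ^ t)%g) -commgEl.
    apply: (subgroupM sS).
      by rewrite /conjg; apply: (subgroupM sS); [apply: (subgroupV sS);
        exact: TS|apply: (subgroupM sS) => //; exact: TS].
    by apply: ZS; rewrite -add1n; exact: zassenhausR.
  have K'S : K' `<=` S.
    apply: (gen_min sS) => y [w] /eliminateP[/oT/TS//|[_ ->]|[j [v [y' [_ /oT/TS Sy _ _ ->]]]]].
      have [gT [pi piV]] := zassenhaus_quotient p_pr Ep Efg i.+1.
      have [piM pi1 _ _] := piV.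
      exists (t ^+ p)%g; first exact: (subgroupX _ sT).
      exists ((t ^+ p)^-1 * x ^+ p)%g; last by rewrite mulKVg.
      apply/(quotient_mapE piV); rewrite -xt !(quotient_mapX piV) piM expgMn.
        rewrite -[(pi zt ^+ p)%g](quotient_mapX piV) (_ : pi (zt ^+ p)%g = 1%g) ?mulg1 //.
        apply/pi1; apply: (zassenhaus_le p_pr Ep (_ : i.+1 <= p * i)%N); last exact: zassenhausXp.
        by move: i0 p1; clear; nia.
      apply/commgP; rewrite -(quotient_mapR piV); apply/eqP/pi1.
      by rewrite -add1n; exact: zassenhausR.
    by elim: j => //= j IH; exact: Sc.
  apply: (gen_min sS) => y [w] /mem_X[/oT/TS//|[_ ->]].
  by rewrite -xE; apply: (subgroupM sS); [exact: K'S|exact: TS].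
have all i : (0 < i)%N -> K `<=` mulset T (Z i).
  elim: i => // -[_ _|i IH _]; last by apply: step => //; exact: IH.
  by move=> a _; exists 1%g; [exact: subgroup1|exists a; rewrite ?mul1g].
apply: (slow_not_big _ Kb).
case: Ts => mu [D [m1 ml TD]]; exists mu, D; split=> // i i0.
apply: le_trans (TD i i0); rewrite ler_nat.
have [gT [pi piV]] := zassenhaus_quotient p_pr Ep Efg i.
rewrite -(@leq_exp2l p) // -!(card_fimage_kappa p_pr piV) //.
apply: subset_leq_card; rewrite -(fimage_mulset (quotient_mapE piV) T);
  last exact: subgroup1 (zassenhaus_sub _ _ _).
by apply: fimageS; exact: all.
Qed.

End Elimination.

(** * The factors *)

Section SmallFactor.
Variables (p : nat) (E : topGroupType).
Hypotheses (p_pr : prime p) (Ep : pro_p p E) (Efg : finitely_generated E).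
Notation Z := (zassenhaus p E).

(** Ito's theorem: conjugation by a1 b1 and by b1 a1 agree on the commutators [a, b], so these
    commute with each other and generate an abelian group. *)
Lemma ito_abelian (gT : finGroupType) (A B : {group gT}) : abelian A -> abelian B ->
  (A * B)%g = [set: gT]%G -> abelian ([set: gT]%G^`(1))%g.
Proof.
move=> aA aB AB; pose G := [set: gT]%G.
have BA : (B * A)%g = G.
  by apply/setP => x; rewrite !inE -[x]invgK -mem_invg invMg !invGid AB inE.
have cA a a' : a \in A -> a' \in A -> [~ a, a']%g = 1%g.
  by move=> Aa Aa'; apply/eqP/commgP; exact: (centsP aA).
have cB b b' : b \in B -> b' \in B -> [~ b, b']%g = 1%g.
  by move=> Bb Bb'; apply/eqP/commgP; exact: (centsP aB).
have conjA a a' : a \in A -> a' \in A -> (a ^ a')%g = a.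
  by move=> Aa Aa'; rewrite conjgE (centsP aA a Aa a' Aa') mulKg.
have conjB b b' : b \in B -> b' \in B -> (b ^ b')%g = b.
  by move=> Bb Bb'; rewrite conjgE (centsP aB b Bb b' Bb') mulKg.
have key a b a1 b1 : a \in A -> b \in B -> a1 \in A -> b1 \in B ->
    ([~ a, b] ^ (a1 * b1) = [~ a, b] ^ (b1 * a1))%g.
  move=> Aa Bb Aa1 Bb1.
  have /mulsgP[b2 a2 Bb2 Aa2 e2] : (a ^ b1)%g \in (B * A)%g by rewrite BA inE.
  have /mulsgP[a3 b3 Aa3 Bb3 e3] : (b ^ a1)%g \in (A * B)%g by rewrite AB inE.
  transitivity [~ a2, b3]%g.
    rewrite conjgM conjRg e3 (conjA a a1) // commgMJ (cA a a3) // conj1g mulg1.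
    by rewrite conjRg e2 (conjB b3 b1) // commMgJ (cB b2 b3) // conj1g mul1g.
  rewrite conjgM conjRg e2 (conjB b b1) // commMgJ (cB b2 b) // conj1g mul1g.
  by rewrite conjRg e3 (conjA a2 a1) // commgMJ (cA a2 a3) // conj1g mulg1.
have abC : abelian [~: A, B]%g.
  rewrite abelian_gen; apply/centsP => _ /imset2P[a b Aa Bb ->] _ /imset2P[a1 b1 Aa1 Bb1 ->].
  have h := key a b a1^-1%g b1^-1%g Aa Bb (groupVr Aa1) (groupVr Bb1).
  apply/commgP/conjg_fixP; rewrite [X in (_ ^ X)%g](_ : _ = (a1^-1 * b1^-1) * (a1 * b1))%g.
    by rewrite conjgM h -conjgM -invMg mulVg conjg1.
  by rewrite commgEl conjgE !mulgA.
suff : (G^`(1) \subset [~: A, B])%g by move=> s; exact: abelianS s abC.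
have GE : (G = A <*> B :> {set gT})%g.
  apply/eqP; rewrite finset.eqEsubset finset.subsetT andbT.
  have : (A * B \subset A <*> B)%g by rewrite mulG_subG joing_subl joing_subr.
  by rewrite AB.
apply: der1_min; first by rewrite GE join_subG commg_normr commg_norml.
rewrite GE quotientY ?commg_norml ?commg_normr //.
by rewrite abelianY !quotient_abelian //= centsC quotient_cents2r.
Qed.

Definition bicyclic := exists t s : E, forall i x, (0 < i)%N ->
  exists e a z, [/\ gen [set s] a, Z i z & x = (t ^+ e * a * z)%g].

Lemma bicyclic_quotient i : bicyclic -> (0 < i)%N ->
  exists (gT : finGroupType) (pi : E -> gT) (t s : E),
  quotient_map p (Z i) pi /\ (<[pi t]> * <[pi s]>)%g = [set: gT]%G.
Proof.
move=> [t [s ts]] i0; have [gT [pi piV]] := zassenhaus_quotient p_pr Ep Efg i.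
exists gT, pi, t, s; split=> //.
have [piM pi1 piS _] := piV; apply/setP => g; rewrite [RHS]inE; have [u <-] := piS g.
have [e [a [z [ga Zz ->]]]] := ts i u i0.
rewrite !piM (_ : pi z = 1%g) ?mulg1; last exact/pi1.
apply: mem_mulg; first by rewrite (quotient_mapX piV) mem_cycle.
move: a ga; apply: (@gen_min _ _ [set a | pi a \in <[pi s]>%g]) => [|_ ->]; last exact: cycle_id.
split=> [|a b /= ha hb]; first by rewrite /= (quotient_map1 piV) group1.
by rewrite /= piM (quotient_mapV piV) groupM ?groupV.
Qed.

(** Modulo each Z_i the group is a product of two cyclic groups, hence metabelian; so the second
    derived group lies in every Z_i. *)
Lemma bicyclic_soluble : bicyclic -> soluble E.
Proof.
move=> Eb; exists 2%N; apply/seteqP; split=> [|x ->]; last exact: subgroup1 (tgen_closed _).1.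
have c1 : closed_subgroup [set (1%g : E)].
  split; first by split=> // x y -> ->; rewrite mulgV.
  apply: accessible_closed_set1; apply: hausdorff_accessible; by case: Ep.
apply: (tgen_min c1) => _ [x Dx [y Dy <-]].
apply: (zassenhaus_separated p_pr Ep) => i i0.
have [gT [pi [t [s [piV AB]]]]] := bicyclic_quotient Eb i0.
have [piM pi1 piS _] := piV.
have ab := ito_abelian (cycle_abelian _) (cycle_abelian _) AB.
have DG u : (derived_series 1 : set E) u -> pi u \in ([set: gT]%G^`(1))%g.
  move: u; apply: tgen_min => [|_ [a _ [b _ <-]]]; last first.
    by rewrite /= (quotient_mapR piV) mem_commg ?inE.
  have sW : is_subgroup [set u | pi u \in ([set: gT]%G^`(1))%g].
    split=> [|a b /= ha hb]; first by rewrite /= (quotient_map1 piV) group1.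
    by rewrite /= piM (quotient_mapV piV) groupM ?groupV.
  split=> //; apply: open_subgroup_closed => //.
  apply: (supergroup_open sW (zassenhaus_open p_pr Ep Efg i) (zassenhaus_sub E p_pr i)) => z Zz.
  by rewrite /= (_ : pi z = 1%g) ?group1 //; exact/pi1.
apply/pi1; rewrite (quotient_mapR piV); apply/eqP/commgP.
by apply: (centsP ab); exact: DG.
Qed.

Lemma bicyclic_kappa i : bicyclic -> (kappa p (setT : set E) i <= 2 * i)%N.
Proof.
have [->|i0] := posnP i; first by rewrite (kappa_T0 p_pr Ep Efg).
move=> Eb; have [gT [pi [t [s [piV AB]]]]] := bicyclic_quotient Eb i0.
have [_ pi1 _ _] := piV.
have op x : (#[pi x]%g <= p ^ i)%N.
  apply: dvdn_leq; first by rewrite expn_gt0 prime_gt0.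
  rewrite order_dvdn -(quotient_mapX piV); apply/eqP/pi1.
  by apply: (zassenhaus_pX p_pr Ep); rewrite ltnW // ltn_expl // prime_gt1.
rewrite -(@leq_exp2l p) ?prime_gt1 // -(card_quotient_kappa p_pr piV) -cardsT.
have -> : #|[set: gT]%SET| = #|(<[pi t]> * <[pi s]>)%g| by rewrite AB.
rewrite mul2n -addnn expnD; apply: leq_trans (leq_mul (op t) (op s)).
rewrite !orderE mul_cardG leq_pmulr //; exact: cardG_gt0.
Qed.

End SmallFactor.

(** The roots of x^2 - D x + 1. The last bound concerns the weighted sum of the starting system of a
    Demushkin group of rank D at q = mu = lam^-1. *)
Lemma root_pair (R : realType) (D : R) : 3 <= D -> exists lam mu, [/\ 1 < lam, 0 <= mu, mu < 1,
  D = lam + mu & lam * mu = 1 /\ mu + (D - 2) * (mu * (1 - mu)^-1) <= 1].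
Proof.
move=> D3; pose r := Num.sqrt (D ^+ 2 - 4).
have r2 : r * r = D * D - 4 by rewrite -!expr2 sqr_sqrtr // subr_ge0; nra.
have r0 : 0 <= r by exact: sqrtr_ge0.
move: r r2 r0 => r r2 r0.
have rD : r < D by rewrite ltNge; apply/negP => h; nra.
exists ((D + r) / 2), ((D - r) / 2).
have m1 : (D - r) / 2 < 1 by nra.
split; [lra|lra|exact: m1|lra|split; first nra].
move: m1; have : (D - r) / 2 * ((D - r) / 2) - D * ((D - r) / 2) + 1 = 0 by nra.
move: ((D - r) / 2) => mu e m1; have mu1' : 0 < 1 - mu by rewrite subr_gt0.
by rewrite -lerBrDl mulrA ler_pdivrMr //; lra.
Qed.

(** * The dichotomy for free and Demushkin groups *)

Section LargeFactor.
Variables (R : realType) (p : nat) (E : topGroupType).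
Hypotheses (p_pr : prime p) (Ep : pro_p p E) (Efg : finitely_generated E).
Notation Z := (zassenhaus p E).
Notation hom1 := (@hom1 p E).
Notation cpol := (@cpol p E).
Implicit Types (X : nat -> seq E) (chi psi : E -> 'F_p).

Lemma geometric_sum1_le (q : R) m : 0 <= q -> q < 1 ->
  \sum_(1 <= w < m) q ^+ w <= q * (1 - q)^-1.
Proof.
move=> q0 q1; apply: le_trans (ler_wpM2l q0 (geometric_sum_le m.-1 q0 q1)).
rewrite mulr_sumr big_add1; case: m => [|m]; first by rewrite !big_geq.
by apply: ler_sum => w _; rewrite exprS.
Qed.

Lemma wsum_two (q : R) X (a b m : nat) : 0 <= q -> q < 1 ->
  (forall w, (0 < w)%N -> (size (X w) <= (w == 1%N) * a + b)%N) ->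
  wsum q X m <= a%:R * q + b%:R * (q * (1 - q)^-1).
Proof.
move=> q0 q1 Xab; have [m1|m1] := leqP m 1.
  rewrite /wsum big_geq // addr_ge0 ?mulr_ge0 // invr_ge0; lra.
apply: le_trans (_ : a%:R * q + b%:R * \sum_(1 <= w < m) q ^+ w <= _); last first.
  by rewrite lerD2l; apply: ler_wpM2l => //; exact: geometric_sum1_le.
rewrite /wsum !(big_ltn m1) mulrDr addrA expr1 -mulrDl mulr_sumr; apply: lerD.
  by apply: ler_wpM2r => //; rewrite -natrD ler_nat; have := Xab 1%N isT; rewrite mul1n.
rewrite !big_nat; apply: ler_sum => w /andP[w2 _]; apply: ler_wpM2r; first exact: exprn_ge0.
by rewrite ler_nat; have := Xab w (ltnW w2); rewrite gtn_eqF.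
Qed.

(** Every weight must occur, so that a system stripped of its large weights has weighted sum
    strictly below 1 ([missed_slow]). *)
Definition growing_gens (lam : R) X := [/\ weighted p X,
  exists C : R, forall w, (size (X w))%:R <= C,
  forall m, wsum lam^-1 X m <= 1, forall w, (0 < w)%N -> X w != [::] &
  big lam (kappa p (gen (generators X)))].

Definition large_factor := exists (lam : R) X, [/\ 1 < lam, growing_gens lam X,
  forall i e, (0 < i)%N -> (i <= p ^ e)%N ->
    (kappa p (setT : set E) i <= kappa p (gen (generators X)) i + e)%N,
  big lam (kappa p (setT : set E)) &
  exists eps C : R, 0 < eps /\ forall i, eps * i%:R <= (kappa p (setT : set E) i)%:R + C].

Definition hom_basis (chis : seq (E -> 'F_p)) := [/\ family_in chis hom1, indep chis &
  forall f, hom1 f -> exists a, f = lin chis a].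

Lemma large_factorP (cl : (E -> E -> 'F_p) -> 'F_p) (rho : bool) chis (lam mu : R) X :
  class_map cl -> (~~ rho -> forall c, cocycle2 c -> cl c = 0) -> hom_basis chis ->
  1 < lam -> 0 <= mu -> (size chis)%:R = lam + mu -> rho%:R = lam * mu ->
  weighted p X -> (exists C : R, forall w, (size (X w))%:R <= C) ->
  (forall m, wsum lam^-1 X m <= 1) -> (forall w, (0 < w)%N -> X w != [::]) ->
  (forall i e, (0 < i)%N -> (i <= p ^ e)%N ->
    (kappa p (setT : set E) i <= kappa p (gen (generators X)) i + e)%N) ->
  large_factor.
Proof.
move=> clP cl0 [cS ci cspan] l1 m0 lD lM wX XC Xs Xn Xk.
have bT := kappa_big p_pr Ep Efg clP cl0 cS ci l1 m0 lD lM.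
exists lam, X; split=> //.
  split=> //; apply: (big_le (k := 1%N) bT l1) => -[|i]; first by rewrite (kappa_T0 p_pr Ep Efg).
  by rewrite mul1n; apply: Xk => //; rewrite ltnW // ltn_expl // prime_gt1.
have lp : 0 < ln p%:R :> R by rewrite ln_gt0 // ltr1n prime_gt1.
have ll : 0 < ln lam by rewrite ln_gt0.
exists (ln lam / ln p%:R), (1 + ln lam / ln p%:R); split=> [|i]; first by rewrite divr_gt0.
case: i => [|i]; first by rewrite mulr0 addr_ge0 // addr_ge0 // ltW // divr_gt0.
have := kappa_lower p_pr Ep Efg clP cl0 cS ci l1 m0 lD lM i.
rewrite -[X in _ <= X -> _](mulrK (unitf_gt0 lp)) => h.
have {}h : i%:R * (ln lam / ln p%:R) <= (kappa p (setT : set E) i.+1).+1%:R.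
  by rewrite mulrA ler_pdivrMr //; move: h; rewrite mulrK ?unitf_gt0.
by rewrite -natr1 mulrDr mulr1 addrA lerD2r mulrC natr1.
Qed.

Lemma cover_bicyclic d k (xs : nat -> E) (s : E) :
  (forall n f, cpol n.+2 f ->
    (forall i, (i < d)%N -> cpol n (dif (xs i) f)) -> cpol n.+1 f) ->
  (forall j n f, (0 < j < k)%N -> (j < d)%N -> cpol n f ->
    (forall i, (k <= i < d)%N -> dif (xs i) f = 0 /\ dif (xs i) (dif (xs 0%N) f) = 0) ->
    (forall i, (0 < i < k)%N -> (i < d)%N -> cpol (n - 2) (dif (xs i) f)) ->
    cpol (n - 3) (dif (xs j) (dif (xs 0%N) f))) ->
  (forall w x, x \in cover_gens d k xs w -> x = s) -> bicyclic p E.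
Proof.
move=> hg hr Xs; exists (xs 0%N), s => i x i0.
have [e [a [z [ga Zz ->]]]] := cover_gens_span p_pr Ep Efg hg hr x i0.
exists e, a, z; split=> //; move: a ga; apply: gen_min; first exact: gen_subgroup.
by move=> y [w /Xs ->]; exact: gen_sub.
Qed.

Lemma size_cover_gens d k (xs : nat -> E) w : (0 < w)%N ->
  size (cover_gens d k xs w) = ((w == 1%N) * (minn d k).-1 + (d - k))%N.
Proof.
by case: w => // -[|w] _; rewrite size_cat !size_map ?size_iota ?mul1n.
Qed.

Lemma cover_gens_bounded d k (xs : nat -> E) :
  exists C : R, forall w, (size (cover_gens d k xs w))%:R <= C.
Proof.
exists ((minn d k).-1 + (d - k))%N%:R => -[|w] //; rewrite size_cover_gens // ler_nat.
by rewrite leq_add2r; case: (w.+1 == _); rewrite ?mul1n ?mul0n.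
Qed.

Lemma ex_hom_basis : exists chis, hom_basis chis.
Proof.
have f0 : family_in [::] hom1 by [].
by have [chis h] := hom1_basis Efg f0 (@indep_nil _ _); exists chis.
Qed.

Lemma free_dichotomy : free_pro_p p E -> bicyclic p E \/ large_factor.
Proof.
move=> Ef; have [chis [cS ci cspan]] := ex_hom_basis.
have [xs dx] := ex_dual cS ci; set d := size chis.
have hg n f := cpol_of_generators p_pr Ep cS cspan dx (n := n) (f := f).
have [d1|d2] := leqP d 1.
  left; apply: (cover_bicyclic (k := 1%N) (s := 1%g) hg) => [j ? ? jk|w x]; first by move: jk;
    clear; lia.
  case: w => // w; rewrite mem_cat; have -> : (d - 1 = 0)%N by move: d1; clear; lia.
  have -> : (minn d 1).-1 = 0%N by move: d1; clear; lia.
  by case: (w == 0%N).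
right; have d0 : 0 < d%:R :> R by rewrite ltr0n ltnW.
have l1 : 1 < d%:R :> R by rewrite ltr1n.
(* H^2 vanishes, so the zero map is a class map; the roots of the recursion are d and 0. *)
apply: (@large_factorP (fun _ => 0) false chis d%:R 0 (cover_gens d 1 xs)) => //.
- split=> [c c' _ _|c hc]; first by rewrite addr0.
  by split=> // _; exact: free_trivial2.
- by rewrite addr0.
- by rewrite mulr0.
- exact: cover_gens_weighted.
- exact: cover_gens_bounded.
- move=> m; have q1 : d%:R^-1 < 1 :> R by rewrite invf_lt1.
  apply: le_trans (@wsum_two _ _ 0%N (d - 1)%N m _ q1 _) _.
  + by rewrite invr_ge0 ltW.
  + by move=> w w0; rewrite size_cover_gens // leq_add2r;
    have -> : (minn d 1).-1 = 0%N by move: d2; clear; lia.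
  rewrite mul0r add0r natrB ?(ltnW d2) // le_eqVlt; apply/orP; left; apply/eqP; field.
  by rewrite subr_eq0 !gt_eqF.
- move=> w w0; rewrite -size_eq0 size_cover_gens //; move: d2; clear; lia.
by move=> i e; apply: kappa_cover => // j n f jk; move: jk; clear; lia.
Qed.

Section Demushkin.
Variable cl : (E -> E -> 'F_p) -> 'F_p.
Hypothesis clP : class_map cl.

(** The sum of the two products is the coboundary of - chi psi. *)
Lemma class_antisym chi psi : hom1 chi -> hom1 psi ->
  cl (fun x y => chi x * psi y) = - cl (fun x y => psi x * chi y).
Proof.
move=> h1 h2; apply/eqP; rewrite -addr_eq0 -clP.1; try exact: tensor_cocycle.
apply/eqP/clP.2; first by apply: cocycle2D; exact: tensor_cocycle.
exists (- (fun x => chi x * psi x)).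
  apply: lcN; have [[V oV cV] [W oW cW]] := (h1.1, h2.1).
  exists (V `&` W); first exact: open_normalI.
  by move=> x v [Vv Wv]; rewrite cV // cW.
by move=> x y; rewrite !foppE h1.2 h2.2; ring.
Qed.

(** By antisymmetry a class with nonzero square exists only for p = 2; if both squares are nonzero,
    they equal 1 and the square of chi + psi is 1 + 1 = 0. *)
Lemma isotropic chi psi : hom1 chi -> hom1 psi -> indep [:: chi; psi] ->
  exists2 phi, hom1 phi & phi <> (fun=> 0) /\ cl (fun x y => phi x * phi y) = 0.
Proof.
move=> h1 h2 ci; pose q f := cl (fun x y => f x * f y).
have nz a b : a != 0 \/ b != 0 -> (fun x => a * chi x + b * psi x) <> (fun=> 0).
  move=> ab e; have H := ci (fun i => if i == 0%N then a else b) _.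
  have {}H : forall i, (i < 2)%N -> (if i == 0%N then a else b) = 0.
    by apply: H; rewrite -e; apply/funext => x; rewrite /lin !big_ord_recl big_ord0 /= addr0.
  have /= a0 := H 0%N isT; have /= b0 := H 1%N isT.
  by move: ab; rewrite a0 b0 eqxx => -[].
have [q1|q1] := eqVneq (q chi) 0.
  exists chi => //; split=> // e; apply: (nz 1 0); first by left; exact: oner_neq0.
  by apply/funext => x; rewrite e; ring.
have [q2|q2] := eqVneq (q psi) 0.
  exists psi => //; split=> // e; apply: (nz 0 1); first by right; exact: oner_neq0.
  by apply/funext => x; rewrite e; ring.
have p2 : p = 2%N.
  have /eqP := class_antisym h1 h1; rewrite -addr_eq0 -mulr2n -mulr_natl mulf_eq0.
  rewrite (negbTE q1) orbF -(dvdn_pcharf (pchar_Fp p_pr)) => /dvdn_leq -/(_ isT).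
  by move: (prime_gt1 p_pr); clear; lia.
have u1 (a : 'F_p) : a != 0 -> a = 1.
  rewrite -[a]natr_valFp; move: (nat_of_ord a) (ltn_ord a) => n.
  by rewrite [pdiv p]pdiv_id ?p2 //; case: n => [|[|n]].
exists (fun x => 1 * chi x + 1 * psi x).
  have := (hom1_linear p E).2 1 _ _ h1 ((hom1_linear p E).2 1 _ _ h2 (hom1_linear p E).1).
  by congr hom1; apply/funext => x; rewrite addr0.
split; first by apply: nz; left; exact: oner_neq0.
have c11 := tensor_cocycle h1 h1; have c22 := tensor_cocycle h2 h2.
have c12 := tensor_cocycle h1 h2; have c21 := tensor_cocycle h2 h1.
transitivity (cl (fun x y => (chi x * chi y + psi x * psi y) + (chi x * psi y + psi x * chi y))).
  by congr cl; apply/funext => x; apply/funext => y; ring.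
rewrite !clP.1 //; try exact: cocycle2D.
rewrite (class_antisym h1 h2) addNr addr0 -/(q chi) -/(q psi) (u1 _ q1) (u1 _ q2).
by apply/eqP; rewrite -[1 + 1]/(2%:R) -(dvdn_pcharf (pchar_Fp p_pr)) p2.
Qed.

Lemma demushkin_large : cup11_nondegenerate p E -> bicyclic p E \/ large_factor.
Proof.
move=> nd; have [chis0 [cS0 ci0 cspan0]] := ex_hom_basis.
have [d1|d2] := leqP (size chis0) 1.
  have [xs dx] := ex_dual cS0 ci0.
  have hg n f := cpol_of_generators p_pr Ep cS0 cspan0 dx (n := n) (f := f).
  left; apply: (cover_bicyclic (k := 1%N) (s := 1%g) hg) => [j n f jk|w x]; first by move: jk;
    clear; lia.
  case: w => // w; rewrite mem_cat; have -> : (size chis0 - 1 = 0)%N by move: d1; clear; lia.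
  have -> : (minn (size chis0) 1).-1 = 0%N by move: d1; clear; lia.
  by case: (w == 0%N).
have [chi hchi [chi0 chi_iso]] : exists2 phi, hom1 phi & phi <> (fun=> 0) /\ cl (fun x y => phi x * phi y) = 0.
  apply: (@isotropic (fnth chis0 0) (fnth chis0 1)); [exact: cS0 (ltnW d2)|exact: cS0|].
  case: chis0 ci0 d2 {cS0 cspan0} => [|c1 [|c2 s]] //= ci0 _.
  exact: (@indepl _ _ [:: c1; c2] s).
have [psi hpsi npsi] := cup_nondegenerate_hom Ep nd hchi chi0.
have cpsi : cl (fun x y => psi x * chi y) != 0.
  apply/eqP => e; apply: npsi; apply/clP.2; first exact: tensor_cocycle.
  by rewrite (class_antisym hchi hpsi) e oppr0.
have i1 : indep [:: chi].
  apply: (@indep_rcons _ _ [::] chi (@indep_nil _ _)) => a e; apply: chi0; rewrite e.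
  by apply/funext => x; rewrite /lin big_ord0.
have i2 : indep [:: chi; psi].
  apply: (@indep_rcons _ _ [:: chi] psi i1) => a e; case/eqP: cpsi.
  have -> : psi = fun x => a 0%N * chi x by rewrite e; apply/funext => x; rewrite /lin big_ord1.
  transitivity (cl (fun x y => a 0%N * (chi x * chi y))).
    by congr cl; apply/funext => x; apply/funext => y; rewrite mulrA.
  by rewrite (class_mapZ clP) ?chi_iso ?mulr0 //; exact: tensor_cocycle.
have f2 : family_in [:: chi; psi] hom1 by case=> [|[|i]].
(* The basis starts with an isotropic chi and a psi whose cup product with chi is nonzero: [gram]
   vanishes at (0, 0) but not at (1, 0). The omitted generator xs 0 is dual to chi. *)
have [t] := hom1_basis Efg f2 i2; set chis := _ ++ t => -[cS ci cspan].
have [xs dx] := ex_dual cS ci; set d := size chis.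
have d2' : (1 < d)%N by [].
have hg n f := cpol_of_generators p_pr Ep cS cspan dx (n := n) (f := f).
have hr j n f : (0 < j < 2)%N -> (j < d)%N -> cpol n f ->
    (forall i, (2 <= i < d)%N -> dif (xs i) f = 0 /\ dif (xs i) (dif (xs 0%N) f) = 0) ->
    (forall i, (0 < i < 2)%N -> (i < d)%N -> cpol (n - 2) (dif (xs i) f)) ->
    cpol (n - 3) (dif (xs j) (dif (xs 0%N) f)).
  move=> j2 jd hf h0 h1; have -> : j = 1%N by move: j2; clear; lia.
  have h := relation_cpol cS cspan dx clP hf.
  pose T i j := gram chis cl i j \*o dif (xs i) (dif (xs j) f).
  (* All terms of the relation but the one at (1, 0) are seen to have degree less than n - 3, so
     that term has it too. *)
  have Tc i j' : (i < d)%N -> (j' < d)%N -> ~~ ((i == 1%N) && (j' == 0%N)) -> cpol (n - 3) (T i j').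
    move=> id j'd ij; have [jge|] := leqP 2 j'.
      have e : dif (xs j') f = 0 by apply: (h0 j' _).1; rewrite jge.
      by rewrite /T e dif0; apply: cpolZ; exact: cpol0.
    case: j' j'd ij => [|[|//]] j'd ij _; last first.
      by apply: cpolZ; rewrite subnS; apply: cpol_dif; exact: h1.
    case: i id ij => [|[//|i]] id _.
      rewrite /T (_ : gram chis cl 0 0 = 0); last exact: chi_iso.
      have -> : (0 : 'F_p) \*o dif (xs 0%N) (dif (xs 0%N) f) = 0.
        by apply/funext => x; rewrite fscaleE mul0r.
      exact: cpol0.
    by rewrite /T (h0 i.+2 _).2 //; apply: cpolZ; exact: cpol0.
  have d0 : (0 < d)%N by exact: ltnW.
  have h2 : cpol (n - 3) (T 1%N 0%N).
    move: h; rewrite (bigD1 (Ordinal d2')) //= (bigD1 (Ordinal d0)) //= -/(T 1%N 0%N) => h.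
    set S1 := (\sum_(i < d | i != Ordinal d0) _) in h; set S2 := (\sum_(i < d | _) _) in h.
    have hS1 : cpol (n - 3) S1.
      by apply: cpol_sum => i; rewrite -val_eqE /= => i0; apply: Tc => //=.
    have hS2 : cpol (n - 3) S2.
      apply: cpol_sum => i; rewrite -val_eqE /= => i0; apply: cpol_sum => i' _.
      by apply: Tc => //=; rewrite (negbTE i0).
    by have := cpolD (cpolD h (cpolN hS1)) (cpolN hS2); rewrite addrAC addrK addrK.
  have := cpolZ (gram chis cl 1 0)^-1 h2; congr (cpol _ _); apply/funext => x.
  by rewrite /T !fscaleE mulrA mulVf ?mul1r.
(* In rank 2 only xs 1 is left besides the omitted generator, as commutators are kept from index 2
   on. *)
have [d3|d3] := leqP d 2.
  left; apply: (cover_bicyclic (k := 2%N) (s := xs 1%N) hg) => // w x.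
  case: w => // w; rewrite mem_cat -/d; have -> : d = 2%N by apply/eqP; rewrite eqn_leq d3.
  by case: w => [|w] //=; rewrite orbF inE => /eqP.
have D3 : 3 <= d%:R :> R by rewrite ler_nat.
right; have [lam [mu [l1 m0 mu1 lD [lm msum]]]] := root_pair D3.
have muE : lam^-1 = mu by rewrite -[LHS]mulr1 -lm mulKf // gt_eqF // (lt_trans ltr01).
apply: (@large_factorP cl true chis lam mu (cover_gens d 2 xs)) => //.
- exact: cover_gens_weighted.
- exact: cover_gens_bounded.
- move=> m; rewrite muE; apply: le_trans msum.
  apply: le_trans (@wsum_two _ _ 1%N (d - 2)%N m m0 mu1 _) _.
    by move=> w w0; rewrite size_cover_gens // leq_add2r leq_mul2l; apply/orP; right; move: d3;
      clear; lia.
  by rewrite mul1r natrB // ltnW.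
- move=> w w0; rewrite -size_eq0 size_cover_gens //; move: d3; clear; lia.
by move=> i e; exact: kappa_cover.
Qed.

End Demushkin.

Lemma factor_dichotomy : free_pro_p p E \/ demushkin p E -> bicyclic p E \/ large_factor.
Proof.
case=> [/free_dichotomy//|[_ _ _ /(demushkin_class_map Ep)[cl clP] nd]].
exact: demushkin_large clP nd.
Qed.

End LargeFactor.

(** * Direct products *)

Section Product.
Variables (p r : nat) (E : 'I_r -> topGroupType).
Hypotheses (p_pr : prime p) (Ep : forall j, pro_p p (E j)) (Efg : forall j, finitely_generated (E j)).
Notation G := (prodG E).
Notation Z := (zassenhaus p).
Implicit Types (H : forall j, set (E j)).

Definition box H : set G := [set x | forall j, H j (x j)].

Lemma box_subgroup H : (forall j, is_subgroup (H j)) -> is_subgroup (box H).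
Proof.
move=> sH; split=> [j|x y hx hy j]; first exact: subgroup1 (sH j).
exact: (sH j).2.
Qed.

Lemma box_closed H : (forall j, closed (H j)) -> closed (box H).
Proof.
move=> cH; have -> : box H = \bigcap_(j in setT) ((fun x : G => x j) @^-1` H j).
  by apply/seteqP; split=> [x hx j _|x hx j]; [exact: hx|exact: (hx j I)].
apply: closed_bigI => j _; apply: closed_comp (cH j) => x _.
exact: prodG_proj_continuous.
Qed.

Lemma prodG_compact : compact [set: G].
Proof.
have := @tychonoff 'I_r E (fun=> setT) (fun j => pro_p_compact (Ep j)).
by congr (compact _); apply/seteqP; split.
Qed.

Lemma prodG_hausdorff : hausdorff_space G.
Proof. by apply: hausdorff_product => j; case: (Ep j). Qed.

Definition incl j (y : E j) : G := dfwith (fun k => 1%g : E k) j y.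

Lemma incl_continuous j : continuous (@incl j).
Proof.
move=> y; apply: (prodG_cvg (fmap_filter _ (nbhs_filter y))) => k.
suff h : (fun z : E j => incl z k) @ y --> incl y k by exact: h.
have [<-|jk] := eqVneq j k.
  have -> : (fun z : E j => incl z j) = id by apply/funext => z; rewrite /incl dfwithin.
  by rewrite /incl dfwithin; exact: cvg_id.
have -> : (fun z : E j => incl z k) = (fun=> 1%g).
  by apply/funext => z; rewrite /incl dfwithout.
by rewrite /incl dfwithout //; exact: cvg_cst.
Qed.

Lemma inclM j (y z : E j) : incl (y * z)%g = (incl y * incl z)%g.
Proof.
apply: functional_extensionality_dep => k; rewrite -[RHS]/(incl y k * incl z k)%g.
rewrite /incl; have [<-|jk] := eqVneq j k; first by rewrite !dfwithin.
by rewrite !dfwithout // mulg1.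
Qed.

Lemma incl1 j : incl (1%g : E j) = 1%g.
Proof. by apply: (@mulgI _ (incl (1%g : E j))); rewrite -inclM !mulg1. Qed.

Lemma inclV j (y : E j) : incl (y^-1)%g = (incl y)^-1%g.
Proof. by apply: (@mulgI _ (incl y)); rewrite -inclM !mulgV incl1. Qed.

Lemma inclX j (y : E j) n : incl (y ^+ n)%g = (incl y ^+ n)%g.
Proof. by elim: n => [|n IH]; rewrite ?incl1 // !expgSr inclM IH. Qed.

Lemma prodGX (x : G) n j : (x ^+ n)%g j = (x j ^+ n)%g.
Proof. by elim: n => [|n IH] //; rewrite !expgSr -IH. Qed.

Lemma incl_zassenhaus i j (y : E j) : (0 < i)%N -> Z (E j) i y -> Z G i (incl y).
Proof.
move=> i0; move: y; apply: (zassenhaus_min p_pr (W := fun i => [set y | Z G i (incl y)])) => //.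
- move=> k; have sZ := zassenhaus_sub G p_pr k; split.
    split=> [|x y /= hx hy]; first by rewrite /= incl1; exact: subgroup1 sZ.
    by rewrite inclM inclV; exact: sZ.2.
  apply: (@closed_comp _ _ (@incl j) (Z G k)) => [x _|]; first exact: incl_continuous.
  by apply: zassenhaus_closed => //; [exact: prodG_compact|exact: prodG_hausdorff].
- by move=> k x k0 /= hx; rewrite inclX; exact: zassenhausX.
- by move=> a b x y a0 b0 /= hx hy; rewrite /commg !(inclM, inclV); exact: zassenhausR.
Qed.

(** Both inclusions rest on [zassenhaus_min], applied to the boxes and to the preimages under the
    embeddings of the factors. *)
Lemma zassenhaus_prodG i : (0 < i)%N -> Z G i = box (fun j => Z (E j) i).
Proof.
move=> i0; apply/seteqP; split.
  apply: (zassenhaus_min p_pr (W := fun i => box (fun j => Z (E j) i))) => //.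
  - move=> k; split; first by apply: box_subgroup => j; exact: zassenhaus_sub.
    by apply: box_closed => j; case: (zassenhaus_closed_subgroup p_pr (Ep j) k).
  - by apply/seteqP; split.
  - by move=> k x k0 hx j; rewrite prodGX; apply: zassenhausX => //; exact: hx.
  - by move=> a b x y a0 b0 hx hy j; apply: (@zassenhausR p (E j) p_pr a b (x j) (y j)).
move=> x hx; have sZ := zassenhaus_sub G p_pr i.
pose part (s : seq 'I_r) : G := fun k => if k \in s then x k else 1%g.
have -> : x = part (enum 'I_r).
  by apply: functional_extensionality_dep => k; rewrite /part mem_enum.
elim: (enum _) => [|j s IH].
  suff -> : part [::] = 1%g by exact: subgroup1.
  by apply: functional_extensionality_dep.
have [js|js] := boolP (j \in s).
  suff -> : part (j :: s) = part s by [].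
  apply: functional_extensionality_dep => k; rewrite /part inE.
  by case: eqVneq => // ->; rewrite js.
suff -> : part (j :: s) = (incl (x j) * part s)%g.
  by apply: (subgroupM sZ) => //; apply: incl_zassenhaus.
apply: functional_extensionality_dep => k; rewrite -[RHS]/(incl (x j) k * part s k)%g.
rewrite /part /incl inE; have [->|kj] := eqVneq k j; first by rewrite dfwithin (negbTE js) mulg1.
by rewrite dfwithout 1?eq_sym // mul1g.
Qed.

Lemma gindex_box i : (0 < i)%N -> exists (T : finType) (pi : G -> T),
  (forall x y, pi x = pi y <-> Z G i (x^-1 * y)%g) /\
  forall H, (forall j, is_subgroup (H j)) ->
    #|fimage pi (box H)| = (p ^ (\sum_j kappa p (H j) i))%N.
Proof.
move=> i0.
pose Q j := cid (zassenhaus_quotient p_pr (Ep j) (Efg j) i).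
pose gT j := sval (Q j); pose Q' j := cid (svalP (Q j)).
pose pi j : E j -> gT j := sval (Q' j).
have piV j : quotient_map p (Z (E j) i) (@pi j) := svalP (Q' j).
exists {dffun forall j, gT j}, (fun x => [ffun j => @pi j (x j)]); split.
  move=> x y; rewrite zassenhaus_prodG //; split=> [/ffunP e j|e].
    by have := e j; rewrite !ffunE => /(quotient_mapE (piV j)).
  by apply/ffunP => j; rewrite !ffunE; apply/(quotient_mapE (piV j)); exact: e.
move=> H sH; pose F j : pred (gT j) := fun t => t \in fimage (@pi j) (H j).
transitivity #|(family F : pred {dffun forall j, gT j})|.
  apply: eq_card => f; apply/idP/idP => [/fimageP[x hx <-]|/familyP fF].
    by apply/familyP => j; rewrite ffunE; apply: mem_fimage; exact: hx.
  have X j : {x | H j x & @pi j x = f j}.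
    by apply: cid2; apply/fimageP; exact: fF.
  apply/fimageP; exists (fun j => s2val (X j)) => [j|]; first by case: (X j).
  by apply/ffunP => j; rewrite ffunE; case: (X j).
rewrite card_family foldrE big_map big_enum /= expn_sum; apply: eq_bigr => j _.
by rewrite -(card_fimage_kappa p_pr (piV j) (sH j)); apply: eq_card.
Qed.

Lemma gindex_prodG i : (0 < i)%N ->
  gindex (setT : set G) (Z G i) = (p ^ (\sum_j kappa p (setT : set (E j)) i))%N.
Proof.
move=> i0; have [T [pi [piP cF]]] := gindex_box i0.
rewrite (gindexE piP) -cF //; congr #|fimage pi _|.
by apply/seteqP; split.
Qed.

Lemma gindex_mulset_box H i : (0 < i)%N -> (forall j, is_subgroup (H j)) ->
  gindex (mulset (box H) (Z G i)) (Z G i) = (p ^ (\sum_j kappa p (H j) i))%N.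
Proof.
move=> i0 sH; have [T [pi [piP cF]]] := gindex_box i0.
by rewrite (gindexE piP) (fimage_mulset piP) ?cF //; exact: subgroup1 (zassenhaus_sub G p_pr i).
Qed.

Lemma gindex_mulset_le (K : set G) i : (0 < i)%N -> K 1%g ->
  (0 < gindex (mulset K (Z G i)) (Z G i) <= gindex (setT : set G) (Z G i))%N.
Proof.
move=> i0 K1; have [T [pi [piP cF]]] := gindex_box i0.
rewrite !(gindexE piP); apply/andP; split; last by apply/subset_leq_card/fimageS.
apply/card_gt0P; exists (pi 1%g); apply: mem_fimage; exists 1%g => //.
by exists 1%g; [exact: subgroup1 (zassenhaus_sub G p_pr i)|rewrite mulg1].
Qed.

End Product.

Lemma kappa_le p (E : topGroupType) i j : prime p -> pro_p p E -> finitely_generated E ->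
  (i <= j)%N -> (kappa p (setT : set E) i <= kappa p (setT : set E) j)%N.
Proof.
move=> p_pr Ep Efg ij.
have [gT [pi piV]] := zassenhaus_quotient p_pr Ep Efg i.
have [gT' [pi' piV']] := zassenhaus_quotient p_pr Ep Efg j.
rewrite -(@leq_exp2l p) ?prime_gt1 // -(card_quotient_kappa p_pr piV) -(card_quotient_kappa p_pr piV').
have [_ _ piS _] := piV; have [sg sgK] := choice piS.
apply: (@leq_card _ _ (fun t => pi' (sg t))) => t t' /(quotient_mapE piV') h.
by rewrite -[t]sgK -[t']sgK; apply/(quotient_mapE piV); exact: zassenhaus_le ij _ h.
Qed.

(** * Successive elimination across the factors *)

Section SlowSequences.
Variable R : realType.
Implicit Types (lam : R) (a b : nat -> nat).

Lemma slow_le lam a b : slow lam a -> (forall i, (0 < i)%N -> (b i <= a i)%N) -> slow lam b.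
Proof.
move=> [mu [C [m1 ml aC]]] ba; exists mu, C; split=> // i i0.
by apply: le_trans (aC i i0); rewrite ler_nat ba.
Qed.

Lemma slow_weaken lam lam' a : slow lam a -> lam <= lam' -> slow lam' a.
Proof.
by move=> [mu [C [m1 ml aC]]] ll; exists mu, C; split=> //; exact: lt_le_trans ll.
Qed.

Lemma slowD lam a b : slow lam a -> slow lam b -> slow lam (fun i => (a i + b i)%N).
Proof.
move=> [mu [C [m1 ml aC]]] [nu [D [n1 nl bD]]].
have wl (x y z : R) (i : nat) : 1 < x -> x <= y -> z * x ^+ i <= `|z| * y ^+ i.
  move=> x1 xy; have x0 : 0 <= x by rewrite ltW // (lt_trans ltr01).
  apply: le_trans (_ : `|z| * x ^+ i <= _); first by rewrite ler_wpM2r ?ler_norm ?exprn_ge0.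
  by apply: ler_wpM2l => //; apply: lerXn2r; rewrite ?nnegrE // (le_trans x0).
exists (Num.max mu nu), (`|C| + `|D|); split; first by rewrite lt_max m1.
  by rewrite gt_max ml nl.
move=> i i0; rewrite natrD mulrDl; apply: lerD.
  by apply: le_trans (aC i i0) (wl _ _ _ _ _ _) => //; rewrite le_max lexx.
by apply: le_trans (bD i i0) (wl _ _ _ _ _ _) => //; rewrite le_max lexx orbT.
Qed.

Lemma slow_linear lam k : 1 < lam -> slow lam (fun i => (k * i)%N).
Proof.
move=> l1; pose mu := (1 + lam) / 2; have m1 : 1 < mu by rewrite /mu; lra.
have e0 : 0 < mu - 1 by rewrite subr_gt0.
exists mu, (k%:R / (mu - 1)); split=> //; first by rewrite /mu; lra.
move=> i _; rewrite natrM -mulrA; apply: ler_wpM2l => //.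
rewrite mulrC ler_pdivlMr //.
have := bernoulli i (ltW e0); rewrite [1 + (mu - 1)]addrC subrK; apply: le_trans.
by rewrite lerDr.
Qed.

Lemma slow_sum lam (I : Type) (s : seq I) (P : pred I) (F : I -> nat -> nat) : 1 < lam ->
  (forall k, P k -> slow lam (F k)) -> slow lam (fun i => \sum_(k <- s | P k) F k i)%N.
Proof.
move=> l1 sF; elim: s => [|k s IH].
  by apply: slow_le (slow_linear 0 l1) _ => i _; rewrite big_nil.
have [Pk|Pk] := boolP (P k).
  by apply: slow_le (slowD (sF k Pk) IH) _ => i _; rewrite big_cons Pk.
by apply: slow_le IH _ => i _; rewrite big_cons (negbTE Pk).
Qed.

Lemma slow_mul lam c a : 1 < lam -> slow lam a -> slow lam (fun i => (c * a i)%N).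
Proof.
move=> l1 sa; elim: c => [|c IH].
  by apply: slow_le (slow_linear 0 l1) _ => i _; rewrite mul0n.
by apply: slow_le (slowD sa IH) _ => i _; rewrite mulSn.
Qed.

End SlowSequences.

(** H is the intersection of the open subgroups K_i Z_i. For x in K_m, elements of K_i Z_i congruent
    to x modulo Z_m accumulate, by compactness, at a point of H. *)
Lemma limit_subgroup p (E : topGroupType) (K : nat -> set E) :
  prime p -> pro_p p E -> finitely_generated E ->
  (forall i, is_subgroup (K i)) -> (forall i, (0 < i)%N -> K i.+1 `<=` K i) ->
  (forall i m, (0 < i)%N -> (m <= i)%N ->
    mulset (K i.+1) (zassenhaus p E m) = mulset (K i) (zassenhaus p E m)) ->
  exists2 H, closed_subgroup H & forall m, (0 < m)%N ->
    mulset H (zassenhaus p E m) = mulset (K m) (zassenhaus p E m).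
Proof.
move=> p_pr Ep Efg sK Kdec KZ; pose Z := zassenhaus p E.
have sZ i : is_subgroup (Z i) by exact: zassenhaus_sub.
pose L i := mulset (K i) (Z i).
have sL i : is_subgroup (L i) by apply: mulset_subgroup => //; exact: zassenhaus_normal.
have cL i : closed (L i).
  apply: open_subgroup_closed => //;
    apply: (supergroup_open (sL i) (zassenhaus_open p_pr Ep Efg i)) => //.
  by apply: mulset_subr; exact: subgroup1.
have Ldec i m : (0 < m)%N -> (m <= i)%N -> L i `<=` L m.
  move=> m0; elim: i => [|i IH]; first by rewrite leqn0 => /eqP ->.
  rewrite leq_eqVlt => /orP[/eqP -> //|]; rewrite ltnS => mi; apply: subset_trans (IH mi).
  move=> _ [k Kk [z Zz <-]]; exists k; first exact: Kdec (leq_trans m0 mi) _ Kk.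
  by exists z => //; exact: zassenhaus_le (leqnSn i) _ Zz.
have KZm i m : (0 < m)%N -> (m <= i)%N -> mulset (K i) (Z m) = mulset (K m) (Z m).
  move=> m0; elim: i => [|i IH]; first by rewrite leqn0 => /eqP ->.
  rewrite leq_eqVlt => /orP[/eqP -> //|]; rewrite ltnS => mi.
  by rewrite KZ ?IH // (leq_trans m0 mi).
pose H := \bigcap_(i in [set i | (0 < i)%N]) L i.
exists H.
  split; last by apply: closed_bigI => i _; exact: cL.
  split=> [i _|x y hx hy i i0]; first exact: subgroup1 (sL i).
  by apply: (sL i).2; [exact: hx|exact: hy].
move=> m m0; apply/seteqP; split=> [_ [h hh [z Zz <-]]|].
  apply: (subgroupM (sL m)); first exact: hh.
  by apply: mulset_subr => //; exact: subgroup1.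
move=> _ [x Kx [z0 Zz0 <-]].
have X i : exists k, (m <= i)%N -> L i k /\ Z m (x^-1 * k)%g.
  have [mi|//] := leqP m i; last by exists 1%g.
  have : mulset (K i) (Z m) x by rewrite KZm //; apply: mulset_subl => //; exact: subgroup1.
  move=> [k Kk [z Zz kz]]; exists k => _; split; first by apply: mulset_subl => //;
    exact: subgroup1.
  by rewrite -kz invMg mulgVK; exact: (subgroupV (sZ m)).
have [k kP] := choice X.
have [y [_ yk]] := @pro_p_compact p E Ep (k @ \oo) _ filterT.
have clos (C : set E) : closed C -> (exists N, forall i, (N <= i)%N -> C (k i)) -> C y.
  move=> cC [N CN]; apply: cC => U Uy; apply: yk => //.
  by exists N => // i /= Ni; exact: CN.
have Hy : H y.
  move=> i i0; apply: clos; first exact: cL.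
  exists (maxn i m) => j; rewrite geq_max => /andP[ij mj].
  by apply: (Ldec j) => //; exact: (kP j mj).1.
have Zy : Z m (x^-1 * y)%g.
  apply: (clos [set v | Z m (x^-1 * v)%g]); last by exists m => i mi; exact: (kP i mi).2.
  have [_ cZ] := zassenhaus_closed_subgroup p_pr Ep m.
  apply: (@closed_comp _ _ (fun v => (x^-1 * v)%g) (Z m)) cZ => v _.
  exact: cvgMg (cvg_cst _) cvg_id.
exists y => //; exists ((x^-1 * y)^-1 * z0)%g; last by rewrite invMg invgK !mulgA mulgV mul1g.
by apply: (subgroupM (sZ m)) => //; exact: (subgroupV (sZ m)).
Qed.

Section Process.
Variables (R : realType) (p r : nat) (E : 'I_r -> topGroupType).
Hypotheses (p_pr : prime p) (Ep : forall j, pro_p p (E j)) (Efg : forall j, finitely_generated (E j)).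
Variables (large : pred 'I_r) (lam : 'I_r -> R).
Hypothesis lam1 : forall j, large j -> 1 < lam j.
Notation Z j := (zassenhaus p (E j)).

Definition state := forall j, nat -> seq (E j).
Implicit Types (S : state) (i m n w : nat).

Definition sgrp S j : set (E j) := if large j then gen (generators (S j)) else setT.
Arguments sgrp : clear implicits.

Definition total_kappa S m := (\sum_j kappa p (sgrp S j) m)%N.

Definition good i S := forall j, large j -> [/\ weighted p (S j),
  exists C : R, forall w, (size (S j w))%:R <= C,
  forall m, wsum (lam j)^-1 (S j) m <= 1, forall w, (i <= w)%N -> S j w != [::] &
  big (lam j) (kappa p (gen (generators (S j))))].

(** The effect of n eliminations of generators of weight i. *)
Definition evolves i S S' n := [/\ forall m, (i < m)%N -> total_kappa S m = (total_kappa S' m + n)%N,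
  forall j m, (m <= i)%N -> mulset (sgrp S' j) (Z j m) = mulset (sgrp S j) (Z j m),
  forall j, sgrp S' j `<=` sgrp S j & forall j w, (w < i)%N -> S' j w = S j w].

Lemma sgrp_subgroup S j : is_subgroup (sgrp S j).
Proof. by rewrite /sgrp; case: ifP => // _; exact: gen_subgroup. Qed.

Lemma evolves_refl i S : evolves i S S 0.
Proof.
by split; [move=> m _; rewrite addn0|move=> j m _|move=> j x|move=> j w _].
Qed.

Lemma evolves_trans i S S' S'' n n' : evolves i S S' n -> evolves i S' S'' n' ->
  evolves i S S'' (n + n').
Proof.
move=> e e'; have [a b c d] := e; have [a' b' c' d'] := e'; split.
- by move=> m im; rewrite a // a' // addnAC addnA.
- by move=> j m mi; rewrite b' // b.
- by move=> j; exact: subset_trans (c' j) (c j).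
- by move=> j w wi; rewrite d' // d.
Qed.

Lemma eliminate_state i S j x : good i.+1 S -> large j -> x \in S j i -> exists S',
  [/\ good i.+1 S', evolves i S S' 1 &
    (\sum_(j | large j) size (S' j i) < \sum_(j | large j) size (S j i))%N].
Proof.
move=> gS lj xS; have [wS bS sS nS gb] := gS j lj.
have l1 := lam1 lj; have l0 : 0 < lam j by exact: lt_trans ltr01 l1.
have q0 : 0 < (lam j)^-1 by rewrite invr_gt0.
have q1 : (lam j)^-1 < 1 by rewrite invf_lt1.
pose S' : state := dfwith S j (eliminate p (S j) i x).
have Sj : S' j = eliminate p (S j) i x by exact: dfwithin.
have Sk k : j != k -> S' k = S k by exact: dfwithout.
have Kj : sgrp S' j = gen (generators (eliminate p (S j) i x)) by rewrite /sgrp lj Sj.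
have Kj0 : sgrp S j = gen (generators (S j)) by rewrite /sgrp lj.
have Kk k : j != k -> sgrp S' k = sgrp S k by move=> jk; rewrite /sgrp Sk.
have nx := eliminate_big p_pr (Ep j) (Efg j) wS xS l1 bS sS gb.
have kgt m : (i < m)%N -> kappa p (sgrp S j) m = (kappa p (sgrp S' j) m).+1.
  move=> im; rewrite Kj Kj0; apply: (kappa_eliminate_gt p_pr (Ep j) (Efg j) wS xS).
  move=> [k Kk' [z Zz kz]]; apply: nx; exists k => //; exists z => //.
  exact: zassenhaus_le im _ Zz.
have kle m : (m <= i)%N -> mulset (sgrp S' j) (Z j m) = mulset (sgrp S j) (Z j m).
  by move=> mi; rewrite Kj Kj0; exact: (eliminate_le p_pr (Ep j) wS xS mi).
exists S'; split.
- move=> k lk; have [kj|kj] := eqVneq j k; last by rewrite Sk //; exact: gS.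
  case: _ / kj lk => _; rewrite Sj; split.
  + exact: eliminate_weighted.
  + exact: eliminate_bounded.
  + exact: wsum_eliminate.
  + move=> w iw; have := nS w iw; case e : (S j w) => [//|y s] _.
    have : y \in eliminate p (S j) i x w by apply: (eliminate_gt p x iw); rewrite e mem_head.
    by case: (eliminate _ _ _ _ w).
  apply: (big_le (k := 1%N) gb l1) => m; rewrite mul1n -Kj0 -Kj.
  have [im|mi] := ltnP i m; first by rewrite kgt // -addn1 leq_add2l (leq_trans _ im).
  by rewrite (eq_kappa (kle m mi)) leq_addr.
- split.
  + move=> m im; rewrite /total_kappa (bigD1 j) //= [in RHS](bigD1 j) //= kgt // addn1 addSn.
    by congr (_ + _).+1; apply: eq_bigr => k; rewrite eq_sym => jk; rewrite Kk.
  + by move=> k m mi; have [<-|jk] := eqVneq j k; [exact: kle|rewrite Kk].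
  + move=> k; have [<-|jk] := eqVneq j k; last by rewrite Kk.
    by rewrite Kj Kj0; exact: eliminate_sub.
  + move=> k w wi; have [<-|jk] := eqVneq j k; last by rewrite Sk.
    by rewrite Sj eliminate_lt.
rewrite (bigD1 j) //= [X in (_ < X)%N](bigD1 j) //= Sj (eliminate_eq p_pr wS xS) size_rem //.
rewrite (eq_bigr (fun k => size (S k i))) => [|k /andP[_]]; last by rewrite eq_sym => /Sk ->.
by rewrite ltn_add2r ltn_predL; case: (S j i) xS.
Qed.

(** Eliminating a generator of weight i adds only generators of larger weight, so the number of
    generators of weight i over all large factors is a decreasing measure. *)
Lemma process_level i S n M : good i.+1 S -> (n <= M)%N -> exists S' n',
  [/\ good i.+1 S', (n <= n' <= M)%N, evolves i S S' (n' - n) &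
    n' = M \/ forall j, large j -> S' j i = [::]].
Proof.
move: {2}(\sum_(j | large j) size (S j i))%N (leqnn (\sum_(j | large j) size (S j i))%N) => k.
elim: k S n => [|k IH] S n Sk gS nM.
  exists S, n; split; rewrite ?leqnn ?subnn //; first exact: evolves_refl.
  right=> j lj; apply/nilP; rewrite /nilp -leqn0; apply: leq_trans Sk.
  by rewrite (bigD1 j) //= leq_addr.
have [->|nM'] := eqVneq n M.
  by exists S, M; split; rewrite ?leqnn ?subnn //; [exact: evolves_refl|left].
have [all0|[j [lj [x xS]]]] : (forall j, large j -> S j i = [::]) \/
    exists j, large j /\ exists x, x \in S j i.
  apply: contrapT => /not_orP[h1 h2]; apply: h1 => j lj.
  case e : (S j i) => [//|x s]; exfalso; apply: h2; exists j; split=> //; exists x.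
  by rewrite e mem_head.
  by exists S, n; split; rewrite ?leqnn ?subnn //; [exact: evolves_refl|right].
have [S1 [g1 e1 lt1]] := eliminate_state gS lj xS.
have [||S' [n' [g' /andP[nn' n'M] e' h']]] := IH S1 n.+1 _ g1.
- by rewrite -ltnS (leq_trans lt1).
- by rewrite ltn_neqAle nM'.
exists S', n'; split=> //; first by rewrite n'M ltnW.
by have := evolves_trans e1 e'; rewrite add1n subnSK.
Qed.

(** Stage i has treated the weights below i. Eliminations in weight i are felt from level i + 1 on,
    hence the target M (i + 1) for them; M is nondecreasing, so earlier eliminations do not
    overshoot. *)
Lemma process (M : nat -> nat) S0 : (forall i, (M i <= M i.+1)%N) -> good 1 S0 ->
  exists (S : nat -> state) (n : nat -> nat), forall i, (0 < i)%N ->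
  [/\ good i (S i), (n i <= M i)%N,
    forall m, (i <= m)%N -> (total_kappa (S i) m + n i)%N = total_kappa S0 m,
    exists n', evolves i (S i) (S i.+1) n' &
    n i.+1 = M i.+1 \/ forall j, large j -> S i.+1 j i = [::]].
Proof.
move=> Mle g0.
pose P m (st : state * nat) := good m.+1 st.1 /\ (st.2 <= M m.+1)%N.
pose Q m (st st' : state * nat) := [/\ P m.+1 st', (st.2 <= st'.2)%N,
  evolves m.+1 st.1 st'.1 (st'.2 - st.2) &
  st'.2 = M m.+2 \/ forall j, large j -> st'.1 j m.+1 = [::]].
have ex (u : nat * (state * nat)) : exists st', P u.1 u.2 -> Q u.1 u.2 st'.
  have [[gS nM]|] := pselect (P u.1 u.2); last by exists u.2.
  have gS' : good u.1.+2 u.2.1.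
    by move=> j lj; have [a b c d e] := gS j lj; split=> // w uw; apply: d; exact: ltnW.
  have [S' [n' [g' /andP[nn' n'M] e' h']]] := process_level gS' (leq_trans nM (Mle _)).
  by exists (S', n').
have [f fP] := choice ex.
pose st := fix st m := if m is k.+1 then f (k, st k) else (S0, 0%N).
have stP m : P m (st m) by elim: m => [//|m IH]; have [] := fP (m, st m) IH.
have stQ m : Q m (st m) (st m.+1) by exact: (fP (m, st m) (stP m)).
exists (fun i => (st i.-1).1), (fun i => (st i.-1).2) => -[//|i] _ /=.
have [gi ni] := stP i; have [_ nn ev hit] := stQ i.
split=> //; last by exists ((st i.+1).2 - (st i).2)%N.
elim: i {gi ni nn ev hit} => [|i IH] m im; first by rewrite addn0.
have [_ nn [ev _ _ _] _] := stQ i.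
rewrite -(IH m (ltnW im)) ev // -addnA; congr (_ + _)%N.
by rewrite -[in LHS](subnK nn).
Qed.

Variable j0 : 'I_r.
Hypotheses (large0 : large j0) (lam_max : forall j, large j -> lam j <= lam j0).
Hypothesis small : forall j, ~~ large j -> forall i, (kappa p (setT : set (E j)) i <= 2 * i)%N.

(** If the weights from N on are always exhausted, only generators of weight less than N remain
    modulo Z_i. As weight N was still present at stage N, their weighted sum is at most 1 -
    lam^-N. *)
Lemma missed_slow (S : nat -> state) N : (0 < N)%N ->
  (forall i, (0 < i)%N -> good i (S i) /\ exists n, evolves i (S i) (S i.+1) n) ->
  (forall i, (N <= i)%N -> forall j, large j -> S i.+1 j i = [::]) ->
  slow (lam j0) (fun i => total_kappa (S i) i).
Proof.
move=> N0 gS S0; have l1 := lam1 large0.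
apply: slow_sum => // j _; have [lj|/small sj] := boolP (large j); last first.
  apply: slow_le (slow_linear 2 l1) _ => i _; apply: leq_trans (sj i).
  by apply: (kappaS p_pr (Ep j) (Efg j)) => //; exact: sgrp_subgroup.
apply: slow_weaken (lam_max lj).
have [wS [C bS] sS nS _] := (gS N N0).1 j lj.
pose T w := if (w < N)%N then S N j w else [::].
have lj1 := lam1 lj; have l0 : 0 < lam j by exact: lt_trans ltr01 lj1.
have q0 : 0 < (lam j)^-1 by rewrite invr_gt0.
have TS w x : x \in T w -> x \in S N j w by rewrite /T; case: ifP.
have wT : weighted p T by move=> w x /TS/wS.
have bT w : (size (T w))%:R <= C.
  by rewrite /T; case: ifP => _ //; apply: le_trans (bS 0%N).
have sT m : wsum (lam j)^-1 T m <= 1 - (lam j)^-1 ^+ N.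
  rewrite lerBrDr; apply: le_trans (sS (maxn m N.+1)).
  apply: le_trans (lerD (wsum_le _ (ltW q0) (leq_maxl m N.+1)) (lexx _)) _.
  rewrite -(@wsum_single _ (E j) (lam j)^-1 1%g N (maxn m N.+1)) ?leq_maxr //.
  rewrite -wsum_cat; apply: ler_sum => w _; apply: ler_wpM2r.
    by rewrite exprn_ge0 // ltW.
  rewrite ler_nat size_cat /T; case: (ltngtP w N) => [||->]; rewrite ?addn0 //.
  by rewrite add0n lt0n size_eq0; exact: nS.
have s1 : 1 - (lam j)^-1 ^+ N < 1 by rewrite gtrBl exprn_gt0.
have slT := kappa_slow p_pr (Ep j) (Efg j) lj1 s1 wT bT sT.
pose c := kappa p (setT : set (E j)) N.
apply: slow_le (slowD slT (slow_linear c lj1)) _ => i i0.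
have [iN|Ni] := ltnP i N.
  apply: leq_trans (leq_addl _ _); apply: leq_trans (leq_pmulr _ i0).
  apply: leq_trans (kappa_le p_pr (Ep j) (Efg j) (ltnW iN)).
  by apply: (kappaS p_pr (Ep j) (Efg j)) => //; exact: sgrp_subgroup.
apply: leq_trans (leq_addr _ _).
have stab w i1 i2 : (w < i1)%N -> (i1 <= i2)%N -> S i2 j w = S i1 j w.
  move=> wi; elim: i2 => [|i2 IH]; first by rewrite leqn0 => /eqP ->.
  rewrite leq_eqVlt => /orP[/eqP -> //|]; rewrite ltnS => ii.
  have w2 := leq_trans wi ii.
  by have [_ [n [_ _ _ ->]]] := gS i2 (leq_trans (ltn0Sn w) w2); rewrite ?IH.
have sZ := zassenhaus_sub (E j) p_pr i.
have sL : is_subgroup (mulset (gen (generators T)) (Z j i)).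
  by apply: mulset_subgroup; [exact: gen_subgroup|exact: zassenhaus_normal].
have sub : sgrp (S i) j `<=` mulset (gen (generators T)) (Z j i).
  rewrite /sgrp lj; apply: (gen_min sL) => x [w xw].
  (* Weights at least i are trivial modulo Z_i, weights from N to i - 1 are exhausted, and weights
     below N have not changed since stage N. *)
  have [iw|wi] := leqP i w.
    apply: mulset_subr; first exact: subgroup1 (gen_subgroup _).
    have [wSi _ _ _ _] := (gS i i0).1 j lj.
    exact: zassenhaus_le iw _ (wSi w x xw).2.
  have [Nw|wN] := leqP N w.
    by move: xw; rewrite (stab w w.+1 i) // S0.
  apply: mulset_subl; first exact: subgroup1.
  by apply: gen_sub; exists w; rewrite /T wN -(stab w N i).
have [gT [pi piV]] := zassenhaus_quotient p_pr (Ep j) (Efg j) i.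
rewrite -(@leq_exp2l p) ?prime_gt1 // -!(card_fimage_kappa p_pr piV) //;
  [|exact: gen_subgroup|exact: sgrp_subgroup].
apply: subset_leq_card; rewrite -(fimage_mulset (quotient_mapE piV) (gen (generators T))).
  exact: fimageS.
exact: subgroup1.
Qed.

End Process.

Arguments sgrp {r E} large S j _ : rename.

(** * Hausdorff dimension *)

Section LimitInferior.
Variable R : realType.
Implicit Types (u : nat -> R) (a e : R).

Lemma limn_inf_sup_infs u : (forall n, 0 <= u n <= 1) -> limn_inf u = sup (range (infs u)).
Proof.
move=> u01; apply: limn_infE; exists 1; split=> // M M1 n _ /=.
by have /andP[u0 u1] := u01 n; rewrite ger0_norm // (le_trans u1) // ltW.
Qed.

Lemma infs_bounds u n : (forall n, 0 <= u n <= 1) ->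
  0 <= infs u n /\ forall k, (n <= k)%N -> infs u n <= u k.
Proof.
move=> u01; have lb : lbound (sdrop u n) 0 by move=> _ [k _ <-]; have /andP[] := u01 k.
split; first by apply: lb_le_inf => //; exists (u n); exists n => /=.
by move=> k nk; apply: ge_inf; [exists 0|exists k].
Qed.

Lemma limn_inf_bounds u : (forall n, 0 <= u n <= 1) -> 0 <= limn_inf u <= 1.
Proof.
move=> u01; rewrite limn_inf_sup_infs //.
have ub : ubound (range (infs u)) 1.
  move=> _ [n _ <-]; have [_ h] := infs_bounds n u01.
  by apply: le_trans (h n (leqnn n)) _; have /andP[] := u01 n.
apply/andP; split; last by apply: ge_sup => //; exists (infs u 0%N); exists 0%N.
have [h _] := infs_bounds 0%N u01; apply: le_trans h _.
by apply: ub_le_sup; [exists 1|exists 0%N].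
Qed.

Lemma limn_inf_eq u a : (forall n, 0 <= u n <= 1) ->
  (forall e, 0 < e -> exists N, forall n, (N <= n)%N -> a - e <= u n) ->
  (forall e N, 0 < e -> exists2 n, (N <= n)%N & u n <= a + e) -> limn_inf u = a.
Proof.
move=> u01 ulow uhit; rewrite limn_inf_sup_infs //; apply/eqP; rewrite eq_le; apply/andP; split.
  apply: ge_sup; first by exists (infs u 0%N); exists 0%N.
  move=> _ [n _ <-]; apply/ler_addgt0Pr => e e0; have [k nk uk] := uhit e n e0.
  have [_ h] := infs_bounds n u01; exact: le_trans (h k nk) uk.
apply/ler_addgt0Pr => e e0; have [N uN] := ulow e e0; rewrite -lerBlDr.
apply: le_trans (_ : infs u N <= _); last first.
  apply: ub_le_sup; last by exists N.
  exists 1 => _ [n _ <-]; have [_ h] := infs_bounds n u01.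
  by apply: le_trans (h n (leqnn n)) _; have /andP[] := u01 n.
apply: lb_le_inf; first by exists (u N); exists N => /=.
by move=> _ [k /= Nk <-]; exact: uN.
Qed.

Lemma exists_log_small (p c : nat) : (1 < p)%N ->
  exists N, forall i, (N <= i)%N -> exists2 e, (i <= p ^ e)%N & (c * e <= i)%N.
Proof.
move=> p1; have [->|c0] := posnP c.
  by exists 0%N => i _; exists i; rewrite ?mul0n // ltnW // ltn_expl.
(* From q = 6 on, (q + 1)^2 <= 2^q. *)
pose Q := maxn 6 c; exists (c * Q)%N => i Qi; exists (i %/ c)%N; last first.
  by rewrite mulnC leq_trunc_div.
have Qq : (Q <= i %/ c)%N by rewrite leq_divRL // mulnC.
apply: leq_trans (ltnW (ltn_ceil i c0)) _; move: (i %/ c)%N Qq => q.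
rewrite geq_max => /andP[q6 qc].
apply: leq_trans (_ : q.+1 * q.+1 <= _)%N; first by rewrite leq_mul2l ltnW ?orbT // ltnS.
apply: leq_trans (_ : 2 ^ q <= _)%N; last by rewrite leq_exp2r // (leq_trans _ q6).
move: q6; clear; elim: q => // q IH; rewrite leq_eqVlt => /orP[/eqP <- //|].
by rewrite ltnS => /[dup] q6 /IH; rewrite expnS; move: (2 ^ q)%N => x; move: q6; clear; nia.
Qed.

(** The lower bound holds at every level up to r k = O(log i), negligible against the linear growth
    of l. At the levels that hit the target, the ratio exceeds a by at most 1 / l i. *)
Lemma ratio_liminf u (p r : nat) (h l : nat -> nat) (a eps C : R) : (1 < p)%N ->
  (forall i, 0 <= u i <= 1) -> (forall i, (0 < i)%N -> u i = (h i)%:R / (l i)%:R) ->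
  (forall i k : nat, (0 < i)%N -> (i <= p ^ k)%N -> a * (l i)%:R <= (h i + r * k)%:R) ->
  (forall N, exists2 i, (N <= i)%N & (h i)%:R <= a * (l i)%:R + 1) ->
  0 < eps -> (forall i, eps * i%:R <= (l i)%:R + C) -> limn_inf u = a.
Proof.
move=> p1 u01 uE hlow hhit eps0 lgrow.
have lbig (B : R) : exists N, forall i, (N <= i)%N -> B <= (l i)%:R.
  exists (Num.bound ((`|B| + `|C|) / eps)) => i Ni.
  have hb : (`|B| + `|C|) / eps < i%:R.
    apply: (@lt_le_trans _ _ (Num.bound ((`|B| + `|C|) / eps))%:R); last by rewrite ler_nat.
    by apply: archi_boundP; rewrite divr_ge0 ?addr_ge0 // ltW.
  have hB : `|B| + `|C| < eps * i%:R by rewrite mulrC -ltr_pdivrMr.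
  by move: (lgrow i) (ler_norm B) (ler_norm C) hB; clear; lra.
apply: limn_inf_eq => // [d d0|d N d0].
  have [N1 hN1] := lbig `|C|; have [N2 hN2] := lbig 1.
  pose c := Num.bound (r%:R * 2 / (d * eps)).
  have de0 : 0 < d * eps by rewrite mulr_gt0.
  have cP : r%:R * 2 <= c%:R * (d * eps).
    rewrite -ler_pdivrMr // ltW //; apply: archi_boundP.
    by rewrite divr_ge0 ?mulr_ge0 // ltW.
  have [N3 hN3] := exists_log_small c p1.
  exists (maxn 1 (maxn N1 (maxn N2 N3))) => i; rewrite !geq_max => /and4P[i0 i1 i2 i3].
  have [e ie ce] := hN3 i i3; have l1 := hN2 i i2; have l2 := hN1 i i1.
  have l0 : 0 < (l i)%:R :> R by exact: lt_le_trans ltr01 l1.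
  rewrite uE // ler_pdivlMr // mulrBl.
  have := hlow i e i0 ie; rewrite natrD natrM => hl.
  have re : r%:R * e%:R * 2 <= d * (eps * i%:R).
    apply: le_trans (_ : c%:R * e%:R * (d * eps) <= _).
      by rewrite mulrAC [leRHS]mulrAC; apply: ler_wpM2r.
    by rewrite mulrC -mulrA; apply: ler_wpM2l; [exact: ltW|rewrite ler_pM2l // -natrM ler_nat].
  have : d * (eps * i%:R) <= d * ((l i)%:R * 2).
    apply: ler_wpM2l; first exact: ltW.
    by move: (lgrow i) (ler_norm C) l2; clear; lra.
  by move: hl re; clear; lra.
have [N1 hN1] := lbig d^-1; have [i] := hhit (maxn 1 (maxn N N1)).
rewrite !geq_max => /and3P[i0 iN i1] hi; exists i => //.
have l1 := hN1 i i1; have d1 : 0 < d^-1 by rewrite invr_gt0.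
have l0 : 0 < (l i)%:R :> R by exact: lt_le_trans d1 l1.
rewrite uE // ler_pdivrMr // mulrDl; apply: le_trans hi _; rewrite lerD2l.
by rewrite -ler_pdivrMl // mulr1.
Qed.

End LimitInferior.

Section Dimension.
Variables (R : realType) (p r : nat) (E : 'I_r -> topGroupType).
Hypotheses (p_pr : prime p) (Ep : forall j, pro_p p (E j)) (Efg : forall j, finitely_generated (E j)).
Notation G := (prodG E).
Notation Z := (zassenhaus p).

Definition dim_ratio (K : set G) i : R :=
  logp p (gindex (mulset K (Z G i)) (Z G i))%:R / logp p (gindex [set: G] (Z G i))%:R.

Lemma ln_p_gt0 : 0 < ln p%:R :> R.
Proof. by rewrite ln_gt0 // ltr1n prime_gt1. Qed.

Lemma logp_exp k : logp p (p ^ k)%:R = k%:R :> R.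
Proof.
rewrite /logp natrX lnXn ?ltr0n ?prime_gt0 // -[ln _ *+ _]mulr_natl mulfK //.
by rewrite gt_eqF // ln_p_gt0.
Qed.

Lemma dim_ratio_bounds K i : K 1%g -> 0 <= dim_ratio K i <= 1.
Proof.
(* Z_0 and Z_1 are both the whole group, so index 0 reduces to index 1 by conversion. *)
move=> K1; wlog i0 : i / (0 < i)%N.
  by case: i => [|i] H; [exact: (H 1%N)|exact: H].
have /andP[x0 xy] := gindex_mulset_le p_pr Ep Efg i0 K1.
rewrite /dim_ratio /logp; move: x0 xy.
set x := gindex (mulset K _) _; set y := gindex setT _; move: x y => x y x0 xy.
have lx : 0 <= ln x%:R :> R by rewrite ln_ge0 // ler1n.
have lxy : ln x%:R <= ln y%:R :> R by rewrite ler_ln ?posrE ?ltr0n ?ler_nat // (leq_trans x0).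
have lp := ln_p_gt0.
have ly0 := le_trans lx lxy; have lp0 := ltW lp.
have a0 : 0 <= ln x%:R / ln p%:R :> R by exact: divr_ge0.
have b0 : 0 <= ln y%:R / ln p%:R :> R by exact: divr_ge0.
rewrite divr_ge0 //=.
have [y0|y0] := eqVneq (ln y%:R : R) 0; first by rewrite y0 mul0r invr0 mulr0.
have ly : 0 < ln y%:R :> R by rewrite lt_def y0 (le_trans lx).
by rewrite ler_pdivrMr ?divr_gt0 // mul1r ler_pM2r ?invr_gt0.
Qed.

Lemma dim_ratio_box (H : forall j, set (E j)) i : (0 < i)%N -> (forall j, is_subgroup (H j)) ->
  dim_ratio (box H) i = (\sum_j kappa p (H j) i)%:R /
    (\sum_j kappa p (setT : set (E j)) i)%:R.
Proof.
by move=> i0 sH; rewrite /dim_ratio gindex_mulset_box // gindex_prodG // !logp_exp.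
Qed.

Lemma kappa_1 (j : 'I_r) i : kappa p [set (1%g : E j)] i = 0%N.
Proof.
have [gT [pi piV]] := zassenhaus_quotient p_pr (Ep j) (Efg j) i.
have s1 : is_subgroup [set (1%g : E j)] by split=> // x y -> ->; rewrite mulgV.
apply/eqP; rewrite -leqn0 -(@leq_exp2l p) ?prime_gt1 // -(card_fimage_kappa p_pr piV s1) expn0.
rewrite -[leqRHS](cards1 (pi 1%g)); apply/subset_leq_card/fintype.subsetP => _ /fimageP[x -> <-].
by rewrite inE.
Qed.

Lemma dimension_attained (j1 : 'I_r) (a : R) : large_factor R p (E j1) ->
  (forall j, bicyclic p (E j) \/ large_factor R p (E j)) -> 0 < a -> a <= 1 ->
  exists2 H, closed_subgroup H & limn_inf (dim_ratio H) = a.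
Proof.
move=> lj1 dich a0 a1.
pose large : pred 'I_r := fun j => `[< large_factor R p (E j) >].
have small j : ~~ large j -> forall i, (kappa p (setT : set (E j)) i <= 2 * i)%N.
  move=> nl i; case: (dich j) => [bj|lj]; first exact: (bicyclic_kappa p_pr (Ep j) (Efg j)).
  by case/negP: nl; apply/asboolP.
pose data j (d : R * (nat -> seq (E j))) := [/\ 1 < d.1, growing_gens p d.1 d.2,
  forall i e, (0 < i)%N -> (i <= p ^ e)%N ->
    (kappa p (setT : set (E j)) i <= kappa p (gen (generators d.2)) i + e)%N,
  big d.1 (kappa p (setT : set (E j))) &
  exists eps C : R, 0 < eps /\ forall i, eps * i%:R <= (kappa p (setT : set (E j)) i)%:R + C].
have exD j : exists d, large j -> data j d.
  have [/asboolP[lam [X h]]|_] := boolP (large j); first by exists (lam, X).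
  by exists (0, fun=> [::]).
pose D j := cid (exD j).
pose lam j := (sval (D j)).1; pose S0 : state E := fun j => (sval (D j)).2.
have DP j : large j -> data j (lam j, S0 j).
  by move=> lj; have := svalP (D j) lj; rewrite /lam /S0; case: (sval (D j)).
have lam1 j : large j -> 1 < lam j by case/DP.
have lj1' : large j1 by apply/asboolP.
(* A sequence that is slow for the rate of some large factor is slow for the largest rate, so the
   contradiction is drawn there. *)
have [j0 lj0 jmax] : exists2 j0, large j0 & forall j, large j -> lam j <= lam j0.
  by case: (@arg_maxP _ _ 'I_r j1 large lam lj1') => j0 lj0 jmax; exists j0.
have [_ _ _ big0 [eps [C [eps0 grow]]]] := DP j0 lj0.
pose l i := (\sum_j kappa p (setT : set (E j)) i)%N.
pose total0 : state E -> nat -> nat := total_kappa p large.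
have tl S i : (total0 S i <= l i)%N.
  apply: leq_sum => j _; apply: (kappaS p_pr (Ep j) (Efg j)) => //; exact: sgrp_subgroup.
have lt i e : (0 < i)%N -> (i <= p ^ e)%N -> (l i <= total0 S0 i + r * e)%N.
  move=> i0 ie; rewrite -[X in (_ <= _ + X * _)%N]card_ord -sum_nat_const -big_split /=.
  apply: leq_sum => j _; rewrite /sgrp; case: ifP => lj; last exact: leq_addr.
  by have [_ _ h _ _] := DP j lj; exact: h.
have l0 i : (kappa p (setT : set (E j0)) i <= l i)%N by rewrite /l (bigD1 j0) //= leq_addr.
have lmono i : (l i <= l i.+1)%N by apply: leq_sum => j _; exact: kappa_le.
pose M i := Num.truncn ((1 - a) * (l i)%:R).
have MP i : (M i)%:R <= (1 - a) * (l i)%:R < (M i).+1%:R.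
  by apply: truncn_itv; rewrite mulr_ge0 // subr_ge0.
have Mmono i : (M i <= M i.+1)%N.
  rewrite -ltnS -(ltr_nat R); have /andP[h1 _] := MP i; have /andP[_ h2] := MP i.+1.
  apply: le_lt_trans h1 (le_lt_trans _ h2); apply: ler_wpM2l; first by rewrite subr_ge0.
  by rewrite ler_nat.
have g0 : good p large lam 1 S0.
  by move=> j /DP[_ [wX bX sX nX bgX] _ _ _]; split.
have [S [n SP]] := process p_pr Ep Efg lam1 Mmono g0.
pose h i := total0 (S i) i.
have hn i : (0 < i)%N -> (h i + n i)%N = total0 S0 i.
  by move=> i0; have [_ _ e _ _] := SP i i0; exact: e.
have hlow i e : (0 < i)%N -> (i <= p ^ e)%N -> a * (l i)%:R <= (h i + r * e)%:R.
  move=> i0 ie; have [_ nM _ _ _] := SP i i0; have /andP[h1 _] := MP i.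
  have := lt i e i0 ie; rewrite -(hn i i0) -(ler_nat R) !natrD.
  by move: nM; rewrite -(ler_nat R); move: h1; rewrite mulrBl mul1r; clear; lra.
have hit N : exists2 i, (N <= i)%N & (h i)%:R <= a * (l i)%:R + 1.
  suff [i i0 [Ni ni]] : exists2 i, (0 < i)%N & (N <= i)%N /\ n i = M i.
    exists i => //; have := tl S0 i; rewrite -(hn i i0) ni -(ler_nat R) natrD.
    by have /andP[_] := MP i; rewrite -natr1 mulrBl mul1r; clear; lra.
  (* Otherwise h is slow, and a l_i <= h_i + r i makes l slow too, after multiplication by a
     constant c >= 1 / a; but l dominates the growth of factor j0. *)
  apply: contrapT => nohit.
  have nM i : (0 < i)%N -> (N <= i)%N -> n i <> M i by move=> i0 Ni e; apply: nohit; exists i.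
  have sl : slow (lam j0) h.
    apply: (missed_slow p_pr Ep Efg lam1 lj0 jmax small (N := N.+1)) => //.
      by move=> i i0; have [g _ _ ev _] := SP i i0.
    move=> i Ni; have [_ _ _ _ [e|//]] := SP i (leq_ltn_trans (leq0n N) Ni).
    by case: (nM i.+1 isT _ e); rewrite (leq_trans (ltnW Ni)).
  apply: slow_not_big big0.
  pose c := Num.bound a^-1.
  have ca : 1 <= c%:R * a.
    by rewrite -ler_pdivrMr // mul1r ltW //; apply: archi_boundP; rewrite invr_ge0 ltW.
  have sl' := slow_mul c (lam1 j0 lj0) (slowD sl (slow_linear r (lam1 j0 lj0))).
  apply: slow_le sl' _ => i i0; apply: leq_trans (l0 i) _.
  have ie : (i <= p ^ i)%N by rewrite ltnW // ltn_expl // prime_gt1.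
  have := hlow i i i0 ie; rewrite -(ler_nat R) natrM => hh.
  apply: le_trans (ler_wpM2l (ler0n R c) hh); rewrite mulrA -[leLHS]mul1r.
  exact: ler_wpM2r.
have exH j : exists H : set (E j), closed_subgroup H /\ forall m, (0 < m)%N ->
    mulset H (Z (E j) m) = mulset (sgrp large (S m) j) (Z (E j) m).
  have [H cH HZ] := @limit_subgroup p (E j) (fun i => sgrp large (S i) j) p_pr (Ep j) (Efg j)
    (fun i => sgrp_subgroup large (S i) j)
    (fun i i0 => let: And5 _ _ _ (ex_intro _ (And4 _ _ s _)) _ := SP i i0 in s j)
    (fun i m i0 => let: And5 _ _ _ (ex_intro _ (And4 _ e _ _)) _ := SP i i0 in e j m).
  by exists H.
pose Hs j := cid (exH j); pose H j := sval (Hs j).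
have cH j : closed_subgroup (H j) := (svalP (Hs j)).1.
have HZ j m : (0 < m)%N -> mulset (H j) (Z (E j) m) = mulset (sgrp large (S m) j) (Z (E j) m).
  exact: (svalP (Hs j)).2.
have sH j : is_subgroup (H j) := (cH j).1.
exists (box H).
  by split; [exact: box_subgroup|apply: box_closed => j; case: (cH j)].
apply: (@ratio_liminf R _ p r h l a eps C) => //; first exact: prime_gt1.
- by move=> i; apply: dim_ratio_bounds; exact: subgroup1 (box_subgroup sH).
- move=> i i0; rewrite dim_ratio_box //; congr (_%:R / _).
  by apply: eq_bigr => j _; apply: eq_kappa; exact: HZ.
move=> i; apply: le_trans (grow i) _; rewrite lerD2r ler_nat; exact: l0.
Qed.

End Dimension.

Theorem corollary1p6 (R : realType) (p : nat) (p_prime : prime p)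
    (r : nat) (E : 'I_r -> topGroupType)
    (E_pro_p : forall j, pro_p p (E j))
    (E_fg : forall j, finitely_generated (E j))
    (E_free_or_demushkin : forall j, free_pro_p p (E j) \/ demushkin p (E j))
    (E_nonsoluble : exists j, ~ soluble (E j)) :
  hspec R p (zassenhaus p (prodG E)) = [set x : R | 0 <= x <= 1].
Proof.
apply/seteqP; split.
  move=> _ [H [sH cH] <-]; apply: limn_inf_bounds => i.
  by apply: dim_ratio_bounds => //; exact: subgroup1.
move=> a /andP[a0 a1].
have dich j := factor_dichotomy R p_prime (E_pro_p j) (E_fg j) (E_free_or_demushkin j).
have [j1 nsol] := E_nonsoluble.
have lj1 : large_factor R p (E j1).
  by case: (dich j1) => // /(bicyclic_soluble p_prime (E_pro_p j1) (E_fg j1)).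
have [a_eq0|a_neq0] := eqVneq a 0; last first.
  have [|H cH Ha] := dimension_attained p_prime E_pro_p E_fg lj1 dich _ a1.
    by rewrite lt_def a_neq0.
  by exists H.
pose H j : set (E j) := [set 1%g].
have sH j : is_subgroup (H j) by split=> // x y -> ->; rewrite mulgV.
have cH j : closed (H j).
  by apply: accessible_closed_set1; apply: hausdorff_accessible; case: (E_pro_p j).
exists (box H); first by split; [exact: box_subgroup|exact: box_closed].
have u0 i : dim_ratio R p (box H) i = 0.
  wlog i0 : i / (0 < i)%N by case: i => [|i] W; [exact: (W 1%N)|exact: W].
  rewrite dim_ratio_box // big1 ?mul0r // => j _; exact: kappa_1.
rewrite a_eq0; apply: limn_inf_eq => [i|e e0|e N e0]; rewrite -/(dim_ratio R p _ _) ?u0.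
- by rewrite lexx ler01.
- by exists 0%N => i _; rewrite -/(dim_ratio R p _ _) u0 sub0r oppr_le0 ltW.
- by exists N => //; rewrite -/(dim_ratio R p _ _) u0 add0r ltW.
Qed.
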